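(* Let $k$ be a field, let $A=A^0\oplus A^1\oplus\cdots$ be a graded $k$-algebra of finite type with dual graded coalgebra $C=DA$, let $M$ be a bounded-above graded left $A$-module and $N$ a bounded-above graded right $A$-module. Then for each $n$ there is a natural isomorphism of graded vector spaces $$\operatorname{Cotor}_C^n(M,N)\;\cong\; H^n_{gr}(A,M\otimes N).$$
   Context: $\otimes=\otimes_k$; signs follow the usual Koszul convention. A graded vector space $V$ is of finite type if each $V^n$ is finite-dimensional, and bounded above if $V^p=0$ for $p\gg0$. Upper and lower indexing are related by $V^n=V_{-n}$. $\operatorname{Hom}^p(V,V')$ is the space of linear maps $f$ with $f(V^i)\subset (V')^{i+p}$ for all $i$; $\operatorname{Hom}(V,V')$ is the graded vector space with these components. The graded dual is $DV=\operatorname{Hom}(V,k)$, so $(DV)_n=(DV)^{-n}=\operatorname{Hom}_k(V^n,k)$. Since $A$ is of finite type, $C=DA$ is a graded coassociative coalgebra, concentrated in degrees $C_n$, $n\ge0$. A bounded-above graded left $A$-module $M$ is locally finite (each element generates a finite-dimensional submodule) and is regarded as a graded right $C$-comodule via $\Delta_M\colon M\to M\otimes DA\subset\operatorname{Hom}(A,M)$, $\Delta_M(m)(a)=am$; similarly right modules give left comodules. $M\square_C N$ is the kernel of $\Delta_M\otimes1-1\otimes\Delta_N\colon M\otimes N\to M\otimes C\otimes N$, a graded vector space, and $\operatorname{Cotor}_C^n(M,N)$ is its $n$-th right derived functor: the $n$-th cohomology (a graded vector space) of the total complex of $I^*\square_C J^*$, where $M\to I^*$, $N\to J^*$ are injective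 resolutions in graded comodules. $A^e=A\otimes A^{\mathrm{op}}$; $M\otimes N$ is the graded $A$-bimodule with left action on $M$ and right action on $N$. $H^n_{gr}(A,B)$, graded Hochschild cohomology, is the $n$-th right derived functor on the category of graded $A$-bimodules $B$ of the graded $\operatorname{Hom}_{A^e}(A,B)$, the graded vector space whose degree $p$ part consists of the degree $p$ bimodule maps $A\to B$. *)

(* Defs.v *)
From HB Require Import structures.
From mathcomp Require Import all_boot all_order all_algebra.
From mathcomp Require Import boolp functions.
From mathcomp Require Import zify.
From mathcomp Require Import freeg.

Set Implicit Arguments.
Unset Strict Implicit.
Unset Printing Implicit Defensive.

Import Order.TTheory GRing.Theory Num.Theory.

Local Open Scope ring_scope.
Local Open Scope quotient_scope.

Section LinearMaps.
Variables (k : fieldType) (V W : lmodType k) (f : V -> W).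
Hypothesis f_lin : linear f.

Definition lin_of : {linear V -> W} :=
  HB.pack_for {linear V -> W} f (GRing.isLinear.Build k V W *:%R f f_lin).

Lemma lin0 : f 0 = 0.
Proof. exact: (linear0 lin_of). Qed.
Lemma linD u v : f (u + v) = f u + f v.
Proof. exact: (linearD lin_of). Qed.
Lemma linN u : f (- u) = - f u.
Proof. exact: (linearN lin_of). Qed.
Lemma linB u v : f (u - v) = f u - f v.
Proof. exact: (linearB lin_of). Qed.
Lemma linZ a u : f (a *: u) = a *: f u.
Proof. by rewrite -[a *: u]addr0 f_lin lin0 addr0. Qed.
Lemma lin_sum (I : Type) (r : seq I) (P : pred I) (F : I -> V) :
  f (\sum_(i <- r | P i) F i) = \sum_(i <- r | P i) f (F i).
Proof. exact: (linear_sum lin_of). Qed.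
End LinearMaps.

Lemma lin_comp (k : fieldType) (U V W : lmodType k) (f : V -> W) (g : U -> V) :
  linear f -> linear g -> linear (f \o g).
Proof. by move=> hf hg a u v /=; rewrite hg hf. Qed.

Lemma lin_id (k : fieldType) (V : lmodType k) : linear (@id V).
Proof. by []. Qed.

Definition bilinear_map (k : fieldType) (U V W : lmodType k)
    (b : U -> V -> W) : Prop :=
  (forall v, linear (b^~ v)) /\ (forall u, linear (b u)).

Record subspace (k : fieldType) (V : lmodType k) := Subspace {
  subspace_mem :> V -> Prop;
  subspace0 : subspace_mem 0;
  subspaceP : forall a u v,
    subspace_mem u -> subspace_mem v -> subspace_mem (a *: u + v) }.

Section Sub.
Variables (k : fieldType) (V : lmodType k) (S : subspace V).

Lemma subspaceD u v : S u -> S v -> S (u + v).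
Proof. by move=> Su Sv; rewrite -[u]scale1r; apply: subspaceP. Qed.

Lemma subspaceZ a u : S u -> S (a *: u).
Proof. by move=> Su; rewrite -[_ *: _]addr0; apply: subspaceP (subspace0 S). Qed.

Lemma subspaceB u v : S u -> S v -> S (u - v).
Proof. by move=> Su Sv; rewrite addrC -scaleN1r; apply: subspaceP. Qed.

Lemma subspace_sum (I : Type) (r : seq I) (F : I -> V) :
  (forall i, S (F i)) -> S (\sum_(i <- r) F i).
Proof. by move=> h; apply: big_ind => //; [apply: subspace0|apply: subspaceD]. Qed.

Definition subspace_pred : {pred V} := [pred x | `[< S x >]].

Lemma subspace_predP x : reflect (S x) (x \in subspace_pred).
Proof. exact: asboolP. Qed.

Lemma subspace_pred_closed : submod_closed subspace_pred.
Proof.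
split; first by apply/subspace_predP/subspace0.
by move=> a u v /subspace_predP Su /subspace_predP Sv; apply/subspace_predP/subspaceP.
Qed.

HB.instance Definition _ :=
  GRing.isSubmodClosed.Build k V subspace_pred subspace_pred_closed.

Record subv := SubV { subv_val : V; subv_mem : subv_val \in subspace_pred }.
HB.instance Definition _ := [isSub for subv_val].
HB.instance Definition _ := [Choice of subv by <:].
HB.instance Definition _ := [SubChoice_isSubLmodule of subv by <:].

Definition subv_of x (Sx : S x) : subv := SubV (introT (subspace_predP x) Sx).

Lemma subvP (x : subv) : S (subv_val x).
Proof. by apply/subspace_predP; case: x. Qed.

End Sub.

Record quotient_space (k : fieldType) (V : lmodType k) (S : subspace V) :=
  QuotientSpace {
    quot_sort :> lmodType k;
    quot_cls : V -> quot_sort;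
    quot_repr : quot_sort -> V;
    quot_cls_lin : linear quot_cls;
    quot_reprK : cancel quot_repr quot_cls;
    quot_clsP : forall x y, quot_cls x = quot_cls y <-> S (x - y) }.

Section Quotient.
Variables (k : fieldType) (V : lmodType k) (S : subspace V).

Let Q := {ideal_quot (subspace_pred S)}.
HB.instance Definition _ := GRing.Zmodule.on Q.
HB.instance Definition _ := EqQuotient.on Q.
Let cls (x : V) : Q := \pi_Q x.

Let clsP x y : cls x = cls y <-> S (x - y).
Proof.
have -> : (cls x = cls y) <-> (x == y %[mod {ideal_quot (subspace_pred S)}]).
  by split=> [e|/eqP //]; apply/eqP.
rewrite -Quotient.idealrBE.
by split=> [/subspace_predP //|?]; exact/subspace_predP.
Qed.

Let clsD x y : cls (x + y) = cls x + cls y.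
Proof. exact: (raddfD (\pi_Q)). Qed.

Let scale (a : k) (q : Q) : Q := cls (a *: repr q).

Let scaleE a x : scale a (cls x) = cls (a *: x).
Proof.
apply/clsP; rewrite -scalerBr; apply/subspaceZ.
by apply/clsP; rewrite /cls reprK.
Qed.

Let scaleA a b q : scale a (scale b q) = scale (a * b) q.
Proof. by rewrite -[q]reprK -/(cls _) !scaleE scalerA. Qed.
Let scale1 : left_id 1 scale.
Proof. by move=> q; rewrite -[q]reprK -/(cls _) scaleE scale1r. Qed.
Let scaleDr : right_distributive scale +%R.
Proof.
move=> a q r; rewrite -[q]reprK -[r]reprK -!/(cls _) -clsD !scaleE -clsD.
by rewrite scalerDr.
Qed.
Let scaleDl q : {morph scale^~ q : a b / a + b}.
Proof. by move=> a b; rewrite -[q]reprK -/(cls _) !scaleE -clsD scalerDl. Qed.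

HB.instance Definition _ := GRing.Zmodule_isLmodule.Build k Q
  scaleA scale1 scaleDr scaleDl.

Fact quotient_space_exists : quotient_space S.
Proof.
apply: (@QuotientSpace k V S Q cls (fun q => repr q)) => [a u v|q|].
- by rewrite clsD -scaleE.
- exact: reprK.
- exact: clsP.
Qed.
End Quotient.

Section QuotientTheory.
Variables (k : fieldType) (V : lmodType k) (S : subspace V).

Definition quotv : lmodType k := quotient_space_exists S.
Definition qcls : V -> quotv := @quot_cls _ _ _ (quotient_space_exists S).
Definition qrepr : quotv -> V := @quot_repr _ _ _ (quotient_space_exists S).

Lemma qcls_lin : linear qcls.
Proof. exact: quot_cls_lin. Qed.
Lemma qreprK : cancel qrepr qcls.
Proof. exact: quot_reprK. Qed.
Lemma qclsP x y : qcls x = qcls y <-> S (x - y).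
Proof. exact: quot_clsP. Qed.
Lemma qcls_repr x : S (qrepr (qcls x) - x).
Proof. by apply/qclsP; rewrite qreprK. Qed.
End QuotientTheory.

Section Span.
Variables (k : fieldType) (V : lmodType k) (P : V -> Prop).

Definition span_mem (x : V) : Prop :=
  forall S : subspace V, (forall y, P y -> S y) -> S x.
Fact span0 : span_mem 0.
Proof. by move=> S _; apply: subspace0. Qed.
Fact spanP a u v : span_mem u -> span_mem v -> span_mem (a *: u + v).
Proof. by move=> hu hv S hS; apply: subspaceP; [apply: hu|apply: hv]. Qed.
Definition span : subspace V := Subspace span0 spanP.
Lemma span_gen y : P y -> span y.
Proof. by move=> Py S; apply. Qed.
End Span.

Record tensor_product (k : fieldType) (V W : lmodType k) := TensorProduct {
  tp_sort :> lmodType k;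
  tp_mul : V -> W -> tp_sort;
  tp_lift : forall U : lmodType k, (V -> W -> U) -> tp_sort -> U;
  tp_mul_bil : bilinear_map tp_mul;
  tp_sumP : forall x, exists s : seq (V * W), x = \sum_(p <- s) tp_mul p.1 p.2;
  tp_lift_lin : forall (U : lmodType k) (b : V -> W -> U),
    bilinear_map b -> linear (tp_lift b);
  tp_liftE : forall (U : lmodType k) (b : V -> W -> U), bilinear_map b ->
    forall v w, tp_lift b (tp_mul v w) = b v w }.

Section TensorConstruction.
Variables (k : fieldType) (V W : lmodType k).

Inductive tens_rel : {freeg (V * W) / k} -> Prop :=
| TensRelL a v v' w :
    tens_rel (<< (a *: v + v', w) >> - (a *: << (v, w) >> + << (v', w) >>))
| TensRelR a v w w' :
    tens_rel (<< (v, a *: w + w') >> - (a *: << (v, w) >> + << (v, w') >>)).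

Let tens : lmodType k := quotv (span tens_rel).

Let tmul (v : V) (w : W) : tens := qcls (span tens_rel) << (v, w) >>.

Let tmul_bilinear : bilinear_map tmul.
Proof.
split=> [w|v] a u u'; (apply: etrans; last exact: qcls_lin);
  apply/qclsP/span_gen; [exact: TensRelL|exact: TensRelR].
Qed.

Let tens_sumP (x : tens) :
  exists s : seq (V * W), x = \sum_(p <- s) tmul p.1 p.2.
Proof.
rewrite -[x]qreprK -[qrepr x]freeg_sumE (lin_sum (@qcls_lin _ _ (span tens_rel))).
exists [seq (coeff z (qrepr x) *: z.1, z.2) | z <- dom (qrepr x)].
rewrite [RHS]big_map; apply: eq_bigr => -[v w] _ /=.
rewrite (linZ (tmul_bilinear.1 w)) /tmul -(linZ (@qcls_lin _ _ (span tens_rel))).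
congr qcls; apply/eqP/freeg_eqP => y.
by rewrite coeffZ !coeffU mul1r.
Qed.

Let tlift (U : lmodType k) (b : V -> W -> U) (x : tens) : U :=
  fglift (fun p => b p.1 p.2) (qrepr x).

Section Lift.
Variables (U : lmodType k) (b : V -> W -> U).
Hypothesis b_bil : bilinear_map b.
Let F := fglift (fun p : V * W => b p.1 p.2).

Let F_add : {morph F : x y / x + y}.
Proof.
have F_sub : {morph F : x y / x - y} by exact: lift_is_additive.
have F0 : F 0 = 0 by rewrite -[0 in LHS](subrr 0) F_sub subrr.
have FN x : F (- x) = - F x by rewrite -sub0r F_sub F0 sub0r.
by move=> x y; rewrite -{1}[y]opprK F_sub FN opprK.
Qed.
Let F_unit a p : F << a *g p >> = a *: b p.1 p.2.
Proof. exact: liftU. Qed.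
Let F_lin : linear F.
Proof.
have F0 : F 0 = 0 by apply: (addIr (F 0)); rewrite -F_add !add0r.
have FS (I : Type) (r : seq I) G : F (\sum_(i <- r) G i) = \sum_(i <- r) F (G i).
  by elim/big_rec2: _ => // i _ x _ <-; rewrite F_add.
move=> a x y; rewrite F_add; congr (_ + _).
rewrite -[in LHS](freeg_sumE x) -[in RHS](freeg_sumE x) scaler_sumr !FS scaler_sumr.
apply: eq_bigr => z _; rewrite F_unit scalerA -F_unit; congr F.
by apply/eqP/freeg_eqP => t; rewrite coeffZ !coeffU mulrA.
Qed.

Let F_rel x : span tens_rel x -> F x = 0.
Proof.
pose S := @Subspace k _ (fun x => F x = 0) (lin0 F_lin)
  (fun a u v hu hv => etrans (F_lin a u v)
     (etrans (congr2 (fun s t => a *: s + t) hu hv)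
             (etrans (addr0 _) (scaler0 _ a)))).
move=> /(_ S); apply=> _ [] a v w w' /=;
  rewrite (linB F_lin) (linD F_lin) (linZ F_lin) !F_unit !scale1r /=.
- by rewrite (b_bil.1 _ a) subrr.
- by rewrite (b_bil.2 _ a) subrr.
Qed.

Fact tensor_lift_qcls x : tlift b (qcls _ x) = F x.
Proof. by apply/eqP; rewrite -subr_eq0 -(linB F_lin); apply/eqP/F_rel/qcls_repr. Qed.

Fact tensor_lift_lin : linear (tlift b).
Proof.
move=> a x y; rewrite -[x]qreprK -[y]qreprK -qcls_lin !tensor_lift_qcls; exact: F_lin.
Qed.

Fact tensor_liftE v w : tlift b (tmul v w) = b v w.
Proof. by rewrite tensor_lift_qcls F_unit scale1r. Qed.
End Lift.

Fact tensor_product_exists : tensor_product V W.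
Proof. exact: (TensorProduct tmul_bilinear tens_sumP
  tensor_lift_lin tensor_liftE). Qed.
End TensorConstruction.

Section Tensor.
Variables (k : fieldType) (V W : lmodType k).

Definition tens : lmodType k := tensor_product_exists V W.
Definition tmul : V -> W -> tens := @tp_mul _ _ _ (tensor_product_exists V W).
(* Meaningful when [b] is bilinear: the linear map induced by [b].          *)
Definition tlift (U : lmodType k) (b : V -> W -> U) : tens -> U :=
  @tp_lift _ _ _ (tensor_product_exists V W) U b.

Lemma tmul_bilinear : bilinear_map tmul.
Proof. exact: tp_mul_bil. Qed.
Lemma tmul_linl w : linear (tmul^~ w).
Proof. exact: tmul_bilinear.1. Qed.
Lemma tmul_linr v : linear (tmul v).
Proof. exact: tmul_bilinear.2. Qed.
Lemma tens_sumP (x : tens) :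
  exists s : seq (V * W), x = \sum_(p <- s) tmul p.1 p.2.
Proof. exact: tp_sumP. Qed.
Lemma tlift_lin (U : lmodType k) (b : V -> W -> U) :
  bilinear_map b -> linear (tlift b).
Proof. exact: tp_lift_lin. Qed.
Lemma tliftE (U : lmodType k) (b : V -> W -> U) : bilinear_map b ->
  forall v w, tlift b (tmul v w) = b v w.
Proof. exact: tp_liftE. Qed.

Lemma tens_ind (P : tens -> Prop) :
  P 0 -> (forall x y, P x -> P y -> P (x + y)) -> (forall v w, P (tmul v w)) ->
  forall x, P x.
Proof.
by move=> P0 PD Pm x; have [s ->] := tens_sumP x; apply: big_ind => // p _.
Qed.

Lemma tens_ext (U : lmodType k) (f g : tens -> U) : linear f -> linear g ->
  (forall v w, f (tmul v w) = g (tmul v w)) -> f =1 g.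
Proof.
move=> hf hg e; apply: tens_ind => //; first by rewrite (lin0 hf) (lin0 hg).
by move=> x y ex ey; rewrite (linD hf) (linD hg) ex ey.
Qed.

End Tensor.

Notation "v ⊗ w" := (tmul v w) (at level 40, left associativity).

Section TensorMaps.
Variable k : fieldType.
Implicit Types U V W : lmodType k.

Definition tmap V V' W W' (f : V -> V') (g : W -> W') : tens V W -> tens V' W' :=
  tlift (fun v w => f v ⊗ g w).

Lemma tmap_bil V V' W W' (f : V -> V') (g : W -> W') : linear f -> linear g ->
  bilinear_map (fun v w => f v ⊗ g w).
Proof.
move=> hf hg; have [bl br] := tmul_bilinear V' W'.
by split=> [w|v] a x y; rewrite ?hf ?hg; [apply: bl|apply: br].
Qed.

Lemma tmap_lin V V' W W' (f : V -> V') (g : W -> W') : linear f -> linear g ->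
  linear (tmap f g).
Proof. by move=> hf hg; apply: tlift_lin; apply: tmap_bil. Qed.

Lemma tmapE V V' W W' (f : V -> V') (g : W -> W') v w : linear f -> linear g ->
  tmap f g (v ⊗ w) = f v ⊗ g w.
Proof. by move=> hf hg; rewrite /tmap tliftE //; apply: tmap_bil. Qed.

Lemma tmap_comp V V' V'' W W' W'' (f : V -> V') (f' : V' -> V'')
    (g : W -> W') (g' : W' -> W'') x :
  linear f -> linear f' -> linear g -> linear g' ->
  tmap f' g' (tmap f g x) = tmap (f' \o f) (g' \o g) x.
Proof.
move=> hf hf' hg hg'.
have hff := lin_comp hf' hf; have hgg := lin_comp hg' hg.
move: x; apply: (@tens_ext _ _ _ _ (tmap f' g' \o tmap f g)) => [||v w].
- by apply: lin_comp; apply: tmap_lin.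
- exact: tmap_lin.
- by rewrite /= !tmapE.
Qed.

Lemma tmap_id V W (x : tens V W) : tmap id id x = x.
Proof.
move: x; apply: (tens_ext (g := id)) => [||v w].
- exact: tmap_lin.
- exact: lin_id.
- by rewrite tmapE.
Qed.

Lemma tmap0l V V' W W' (f : V -> V') (g : W -> W') x : (forall v, f v = 0) ->
  linear g -> tmap f g x = 0.
Proof.
move=> f0 hg; have hf : linear f by move=> a u v; rewrite !f0 scaler0 addr0.
move: x; apply: (tens_ext (g := fun=> 0)) => [||v w].
- exact: tmap_lin.
- by move=> a u v; rewrite scaler0 addr0.
- by rewrite tmapE // f0 (lin0 (@tmul_linl _ _ _ _)).
Qed.

Lemma tmap0r V V' W W' (f : V -> V') (g : W -> W') x : linear f ->
  (forall w, g w = 0) -> tmap f g x = 0.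
Proof.
move=> hf g0; have hg : linear g by move=> a u v; rewrite !g0 scaler0 addr0.
move: x; apply: (tens_ext (g := fun=> 0)) => [||v w].
- exact: tmap_lin.
- by move=> a u v; rewrite scaler0 addr0.
- by rewrite tmapE // g0 (lin0 (@tmul_linr _ _ _ _)).
Qed.

Definition tassoc U V W : tens (tens U V) W -> tens U (tens V W) :=
  tlift (fun x w => tlift (fun u v => u ⊗ (v ⊗ w)) x).

Lemma tassoc_bil_in U V W (w : W) :
  bilinear_map (fun (u : U) (v : V) => u ⊗ (v ⊗ w)).
Proof.
have [bl br] := tmul_bilinear U (tens V W); have [cl cr] := tmul_bilinear V W.
by split=> [v|u] a x y; rewrite ?cl; [apply: bl|apply: br].
Qed.

Lemma tassoc_bil U V W : bilinear_map
  (fun (x : tens U V) (w : W) => tlift (fun u v => u ⊗ (v ⊗ w)) x).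
Proof.
have T_lin w := tlift_lin (tassoc_bil_in U V w).
split=> [w|x]; first by move=> a x y; apply: T_lin.
move=> a w w'; move: x.
apply: (tens_ext (g := fun x => a *: tlift (fun u v => u ⊗ (v ⊗ w)) x
                               + tlift (fun u v => u ⊗ (v ⊗ w')) x)).
- exact: T_lin.
- move=> c u v; rewrite !T_lin !scalerDr !scalerA [a * c]mulrC.
  by rewrite addrACA.
- move=> u v; rewrite !tliftE; try exact: tassoc_bil_in.
  by rewrite tmul_linr tmul_linr.
Qed.

Lemma tassoc_lin U V W : linear (@tassoc U V W).
Proof. exact: tlift_lin (tassoc_bil _ _ _). Qed.

Lemma tassocE U V W (u : U) (v : V) (w : W) :
  tassoc (u ⊗ v ⊗ w) = u ⊗ (v ⊗ w).
Proof.
by rewrite /tassoc tliftE ?tliftE //; [apply: tassoc_bil_in|apply: tassoc_bil].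
Qed.

Lemma tens3_ext U V W (X : lmodType k)
    (f g : tens (tens U V) W -> X) : linear f -> linear g ->
  (forall u v w, f (u ⊗ v ⊗ w) = g (u ⊗ v ⊗ w)) -> f =1 g.
Proof.
move=> hf hg e; apply: tens_ext => // x w.
suff E : (fun x => f (x ⊗ w)) =1 (fun x => g (x ⊗ w)) by exact: E.
apply: tens_ext => [a u v|a u v|u v]; last exact: e.
  by rewrite tmul_linl hf.
by rewrite tmul_linl hg.
Qed.

Lemma tassoc_nat U U' V V' W W' (f : U -> U') (g : V -> V') (h : W -> W') x :
  linear f -> linear g -> linear h ->
  tassoc (tmap (tmap f g) h x) = tmap f (tmap g h) (tassoc x).
Proof.
move=> hf hg hh; have hfg := tmap_lin hf hg; have hgh := tmap_lin hg hh.
move: x; apply: (@tens3_ext _ _ _ _ (@tassoc _ _ _ \o tmap (tmap f g) h)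
  (tmap f (tmap g h) \o @tassoc _ _ _)) => [||u v w].
- exact: lin_comp (@tassoc_lin _ _ _) (tmap_lin hfg hh).
- exact: lin_comp (tmap_lin hf hgh) (@tassoc_lin _ _ _).
- by rewrite /= tassocE !tmapE // tassocE.
Qed.
End TensorMaps.

(* The decomposition V = ⊕_i V^i (upper indexing, i : int) is given by the  *)
(* family of projections onto the V^i.                                      *)
Record gvect (k : fieldType) := GVect {
  gv_sort :> lmodType k;
  gproj : int -> gv_sort -> gv_sort;
  gproj_lin : forall i, linear (gproj i);
  gprojK : forall i j x, gproj i (gproj j x) = if i == j then gproj j x else 0;
  gproj_fin : forall x, exists s : seq int,
    uniq s /\ x = \sum_(i <- s) gproj i x }.

Definition homog (k : fieldType) (V : gvect k) (i : int) (x : V) : Prop :=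
  gproj i x = x.

Definition deg_map (k : fieldType) (V W : gvect k) (p : int) (f : V -> W) : Prop :=
  forall i x, homog i x -> homog (i + p) (f x).

Definition bounded_above (k : fieldType) (V : gvect k) : Prop :=
  exists N : int, forall i (x : V), (N < i)%R -> homog i x -> x = 0.

Definition nonneg_graded (k : fieldType) (V : gvect k) : Prop :=
  forall i (x : V), (i < 0)%R -> homog i x -> x = 0.

Definition finite_type (k : fieldType) (V : gvect k) : Prop :=
  forall i, exists (n : nat) (e : 'I_n -> V),
    forall x : V, homog i x -> exists c : 'I_n -> k, x = \sum_j c j *: e j.

Lemma sum_widen (V : nmodType) (s t : seq int) (F : int -> V) :
  uniq s -> uniq t -> {subset s <= t} -> (forall i, i \notin s -> F i = 0) ->
  \sum_(i <- t) F i = \sum_(i <- s) F i.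
Proof.
move=> us ut st F0.
rewrite (bigID (mem s)) /= [X in _ + X]big1 ?addr0; last exact: F0.
rewrite -big_filter; apply: perm_big; apply: uniq_perm => //.
  exact: filter_uniq.
move=> i; rewrite mem_filter; apply/andP/idP => [[]//|si].
by split=> //; apply: st.
Qed.

Section GVectTheory.
Variables (k : fieldType) (V : gvect k).
Implicit Types (x y : V) (s : seq int).

Lemma gproj0 i : gproj i (0 : V) = 0.
Proof. exact: lin0 (@gproj_lin _ V i). Qed.

Lemma gproj_sum i (I : Type) (r : seq I) (F : I -> V) :
  gproj i (\sum_(j <- r) F j) = \sum_(j <- r) gproj i (F j).
Proof. exact: lin_sum (@gproj_lin _ V i) _ _ _ _. Qed.

Lemma homog_gproj i x : homog i (gproj i x).
Proof. by rewrite /homog gprojK eqxx. Qed.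

Lemma homog0 i : homog i (0 : V).
Proof. exact: gproj0. Qed.

Lemma homogP i a x y : homog i x -> homog i y -> homog i (a *: x + y).
Proof. by rewrite /homog gproj_lin => -> ->. Qed.

Lemma homogD i x y : homog i x -> homog i y -> homog i (x + y).
Proof. by move=> hx hy; rewrite -[x]scale1r; apply: homogP. Qed.

Lemma homogZ i a x : homog i x -> homog i (a *: x).
Proof. by move=> hx; rewrite -[_ *: _]addr0; apply: homogP (homog0 i). Qed.

Lemma homog_sum i (I : Type) (r : seq I) (P : pred I) (F : I -> V) :
  (forall j, P j -> homog i (F j)) -> homog i (\sum_(j <- r | P j) F j).
Proof. by move=> h; apply: big_ind => //; [apply: homog0|apply: homogD]. Qed.

Lemma gproj_homog i j x : homog j x -> gproj i x = if i == j then x else 0.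
Proof. by move=> <-; rewrite gprojK. Qed.

Lemma gprojNmem s i x : x = \sum_(j <- s) gproj j x -> i \notin s -> gproj i x = 0.
Proof.
move=> -> si; rewrite gproj_sum big_seq big1 // => j js.
by rewrite gprojK; case: eqP => // ij; rewrite ij js in si.
Qed.

(* A finite set of degrees containing the support of [x].                   *)
Definition gsupp x : seq int := sval (cid (gproj_fin x)).

Lemma gsupp_uniq x : uniq (gsupp x).
Proof. by rewrite /gsupp; case: cid => s []. Qed.

Lemma gsuppE x : x = \sum_(i <- gsupp x) gproj i x.
Proof. by rewrite /gsupp; case: cid => s []. Qed.

Lemma gsuppN x i : i \notin gsupp x -> gproj i x = 0.
Proof. exact: gprojNmem (gsuppE x). Qed.

Lemma gsum_eq (U : nmodType) x s (F : int -> U) :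
  (forall i, gproj i x = 0 -> F i = 0) -> uniq s ->
  (forall i, i \notin s -> F i = 0) ->
  \sum_(i <- gsupp x) F i = \sum_(i <- s) F i.
Proof.
move=> F0 us Fs; pose t := undup (gsupp x ++ s).
have ut : uniq t by exact: undup_uniq.
have st : {subset s <= t} by move=> i si; rewrite mem_undup mem_cat si orbT.
have xt : {subset gsupp x <= t} by move=> i xi; rewrite mem_undup mem_cat xi.
have xF i : i \notin gsupp x -> F i = 0 by move/gsuppN/F0.
by rewrite -(sum_widen (gsupp_uniq x) ut xt xF) (sum_widen us ut st Fs).
Qed.

Lemma gsum_lin (U : lmodType k) (F : int -> V -> U) :
  (forall i, linear (F i)) -> (forall i x, gproj i x = 0 -> F i x = 0) ->
  linear (fun x => \sum_(i <- gsupp x) F i x).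
Proof.
move=> Fl F0 a x y; pose s := undup (gsupp x ++ gsupp y).
have us : uniq s by exact: undup_uniq.
have sN i : i \notin s -> gproj i x = 0 /\ gproj i y = 0.
  by rewrite mem_undup mem_cat negb_or => /andP[/gsuppN ? /gsuppN].
rewrite !(@gsum_eq _ _ s) ?scaler_sumr -?big_split //; try by move=> i; apply: F0.
- by apply: eq_bigr => i _; apply: Fl.
- by move=> i /sN [? ?]; apply: F0.
- by move=> i /sN [? ?]; apply: F0.
- by move=> i /sN [xi yi]; apply: F0; rewrite gproj_lin xi yi scaler0 addr0.
Qed.

Lemma gsum_homog (U : nmodType) j x (F : int -> U) : homog j x ->
  (forall i, gproj i x = 0 -> F i = 0) -> \sum_(i <- gsupp x) F i = F j.
Proof.
move=> hx F0; rewrite (@gsum_eq _ _ [:: j]) ?big_seq1 // => i.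
rewrite inE => ij; apply: F0; rewrite (gproj_homog _ hx).
by case: eqP ij.
Qed.

Lemma homog_ext (U : lmodType k) (f g : V -> U) : linear f -> linear g ->
  (forall i x, homog i x -> f x = g x) -> f =1 g.
Proof.
move=> hf hg e x; rewrite (gsuppE x) (lin_sum hf) (lin_sum hg).
by apply: eq_bigr => i _; apply: e (homog_gproj i x).
Qed.

End GVectTheory.

Lemma deg_map_gproj (k : fieldType) (V W : gvect k) p (f : V -> W) :
  linear f -> deg_map p f ->
  forall i x, f (gproj i x) = gproj (i + p) (f x).
Proof.
move=> hf df i; apply: homog_ext.
- exact: lin_comp hf (@gproj_lin _ _ _).
- exact: lin_comp (@gproj_lin _ _ _) hf.
- move=> j x hx; rewrite (gproj_homog i hx) (gproj_homog (i + p) (df _ _ hx)).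
  rewrite (inj_eq (addIr p)); case: eqP => // _; exact: lin0.
Qed.

Lemma deg_map0 (k : fieldType) (V W : gvect k) (f : V -> W) :
  (forall i x, homog i x -> homog i (f x)) -> deg_map 0 f.
Proof. by move=> h i x; rewrite addr0; apply: h. Qed.

Lemma deg_map_id (k : fieldType) (V : gvect k) : deg_map 0 (@id V).
Proof. exact: deg_map0. Qed.

Lemma deg_map_comp (k : fieldType) (U V W : gvect k) p q (f : V -> W) (g : U -> V) :
  deg_map p f -> deg_map q g -> deg_map (p + q) (f \o g).
Proof. by move=> hf hg i x hx; rewrite [p + q]addrC addrA; apply/hf/hg. Qed.

Section GradedTensor.
Variables (k : fieldType) (V W : gvect k).

Definition tproj (n : int) : tens V W -> tens V W :=
  tlift (fun v w => \sum_(i <- gsupp v) gproj i v ⊗ gproj (n - i) w).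

Fact tproj_bil n : bilinear_map
  (fun (v : V) (w : W) => \sum_(i <- gsupp v) gproj i v ⊗ gproj (n - i) w).
Proof.
split=> [w|v].
- apply: (@gsum_lin _ _ _ (fun i v => gproj i v ⊗ gproj (n - i) w)).
  + by move=> i a x y; rewrite gproj_lin tmul_linl.
  + by move=> i x ->; rewrite (lin0 (@tmul_linl _ _ _ _)).
- move=> a x y; rewrite scaler_sumr -big_split; apply: eq_bigr => i _.
  by rewrite gproj_lin tmul_linr.
Qed.

Fact tproj_lin n : linear (tproj n).
Proof. exact: tlift_lin (tproj_bil n). Qed.

Fact tprojE n i j (v : V) (w : W) : homog i v -> homog j w ->
  tproj n (v ⊗ w) = if n == i + j then v ⊗ w else 0.
Proof.
move=> hv hw; rewrite /tproj (tliftE (tproj_bil n)) (gsum_homog hv); last first.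
  by move=> l ->; rewrite (lin0 (@tmul_linl _ _ _ _)).
rewrite hv (gproj_homog _ hw) subr_eq [j + i]addrC.
by case: eqP => // _; rewrite (lin0 (@tmul_linr _ _ _ _)).
Qed.

Lemma tens_homog_ext (U : lmodType k) (f g : tens V W -> U) :
  linear f -> linear g ->
  (forall i j v w, homog i v -> homog j w -> f (v ⊗ w) = g (v ⊗ w)) -> f =1 g.
Proof.
move=> hf hg e; apply: tens_ext => // v w.
rewrite (gsuppE v) (lin_sum (@tmul_linl _ _ _ w)) (lin_sum hf) (lin_sum hg).
apply: eq_bigr => i _; rewrite (gsuppE w) (lin_sum (@tmul_linr _ _ _ (gproj i v))).
rewrite (lin_sum hf) (lin_sum hg); apply: eq_bigr => j _.
exact: e (homog_gproj _ _) (homog_gproj _ _).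
Qed.

Fact tprojK i j x : tproj i (tproj j x) = if i == j then tproj j x else 0.
Proof.
move: x; apply: tens_homog_ext.
- exact: lin_comp (@tproj_lin _) (@tproj_lin _).
- case: (i == j); first exact: tproj_lin.
  by move=> a u v; rewrite scaler0 addr0.
- move=> m n v w hv hw; rewrite (tprojE j hv hw).
  have [jmn|jmn] := eqVneq j (m + n).
    by rewrite (tprojE i hv hw) -jmn; case: eqP.
  by rewrite (lin0 (@tproj_lin i)) if_same.
Qed.

Fact tproj_fin x : exists s : seq int, uniq s /\ x = \sum_(i <- s) tproj i x.
Proof.
pose D x := exists s : seq int, uniq s /\ x = \sum_(i <- s) tproj i x.
have D0 : D 0 by exists [::]; rewrite big_nil.
have proj_sum i (r : seq int) F :
    tproj i (\sum_(j <- r) F j) = \sum_(j <- r) tproj i (F j).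
  exact: lin_sum (@tproj_lin i) _ _ _ _.
have projN s i y : y = \sum_(j <- s) tproj j y -> i \notin s -> tproj i y = 0.
  move=> -> si; rewrite proj_sum big_seq big1 // => j js.
  by rewrite tprojK; case: eqP => // ij; rewrite ij js in si.
have DD y z : D y -> D z -> D (y + z).
  move=> [s [us ys]] [t [ut zt]]; pose r := undup (s ++ t).
  have ur : uniq r by exact: undup_uniq.
  have sr : {subset s <= r} by move=> i si; rewrite mem_undup mem_cat si.
  have tr : {subset t <= r} by move=> i ti; rewrite mem_undup mem_cat ti orbT.
  exists r; split=> //; under eq_bigr do rewrite (linD (@tproj_lin _)).
  rewrite big_split /= (sum_widen us ur sr (fun i => projN s i y ys)).
  by rewrite (sum_widen ut ur tr (fun i => projN t i z zt)) -ys -zt.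
have [s ->] := tens_sumP x; apply: (@big_ind _ D) => // -[v w] _ /=.
rewrite (gsuppE v) (lin_sum (@tmul_linl _ _ _ w)).
apply: (@big_ind _ D) => // i _.
rewrite (gsuppE w) (lin_sum (@tmul_linr _ _ _ (gproj i v))).
apply: (@big_ind _ D) => // j _; exists [:: i + j]; split=> //.
by rewrite big_seq1 (tprojE _ (homog_gproj i v) (homog_gproj j w)) eqxx.
Qed.

Definition gtens : gvect k := GVect tproj_lin tprojK tproj_fin.
End GradedTensor.

Section GradedTensorTheory.
Variable k : fieldType.

Lemma tmul_homog (V W : gvect k) i j (v : V) (w : W) :
  homog i v -> homog j w -> homog (V := gtens V W) (i + j) (v ⊗ w).
Proof. by move=> hv hw; rewrite /homog /= (tprojE _ hv hw) eqxx. Qed.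

Lemma tmap_deg (V V' W W' : gvect k) (f : V -> V') (g : W -> W') :
  linear f -> linear g -> deg_map 0 f -> deg_map 0 g ->
  deg_map (V := gtens V W) (W := gtens V' W') 0 (tmap f g).
Proof.
move=> hf hg df dg; apply: deg_map0 => n x hx.
have hfg := tmap_lin hf hg; rewrite /homog /= -[in RHS]hx /=.
move: x {hx}; apply: (tens_homog_ext (f := fun x => tproj n (tmap f g x))
  (g := fun x => tmap f g (tproj n x))) => [||i j v w hv hw].
- exact: lin_comp (@tproj_lin _ _ _ n) hfg.
- exact: lin_comp hfg (@tproj_lin _ _ _ n).
- have := df _ _ hv; have := dg _ _ hw; rewrite !addr0 => hgw hfv.
  rewrite tmapE // (tprojE _ hv hw) (tprojE _ hfv hgw).
  by case: eqP => _; rewrite ?tmapE // (lin0 hfg).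
Qed.
End GradedTensorTheory.

Section GradedDual.
Variables (k : fieldType) (V : gvect k).

Definition dual_mem (phi : V -> k^o) : Prop :=
  linear phi /\
  exists s : seq int, uniq s /\ forall x, phi x = \sum_(i <- s) phi (gproj i x).

Lemma dual_memN (phi : V -> k^o) s : linear phi ->
  (forall x, phi x = \sum_(i <- s) phi (gproj i x)) ->
  forall i x, homog i x -> i \notin s -> phi x = 0.
Proof.
move=> hphi hs i x hx si; rewrite hs big_seq big1 // => j js.
rewrite (gproj_homog _ hx); case: eqP => [ji|_]; last exact: lin0.
by rewrite -ji js in si.
Qed.

Lemma dual_mem_intro (phi : V -> k^o) (s : seq int) : linear phi ->
  (forall i x, homog i x -> i \notin s -> phi x = 0) -> dual_mem phi.
Proof.
move=> hphi h; split=> //; exists (undup s); split; first exact: undup_uniq.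
move=> x; rewrite {1}(gsuppE x) (lin_sum hphi); apply: gsum_eq.
- by move=> i ->; rewrite (lin0 hphi).
- exact: undup_uniq.
- by move=> i; rewrite mem_undup => si; apply: h (homog_gproj i x) si.
Qed.

Fact dual_mem0 : dual_mem 0.
Proof.
by apply: (@dual_mem_intro 0 [::]) => // a u v; rewrite scaler0 addr0.
Qed.

Fact dual_memP a (phi psi : V -> k^o) :
  dual_mem phi -> dual_mem psi -> dual_mem (a *: phi + psi).
Proof.
move=> [hphi [s [us hs]]] [hpsi [t [ut ht]]].
have hl : linear (a *: phi + psi).
  move=> b u v; change (a *: phi (b *: u + v) + psi (b *: u + v) =
    b *: (a *: phi u + psi u) + (a *: phi v + psi v)).
  by rewrite hphi hpsi !scalerDr !scalerA [a * b]mulrC addrACA.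
apply: (@dual_mem_intro _ (s ++ t) hl) => i x hx; rewrite mem_cat negb_or.
move=> /andP[si ti]; change (a *: phi x + psi x = 0).
rewrite (dual_memN hphi hs hx si) (dual_memN hpsi ht hx ti).
by rewrite scaler0 addr0.
Qed.

Definition dual_space : lmodType k := subv (Subspace dual_mem0 dual_memP).

Definition dual_app (phi : dual_space) (x : V) : k^o := subv_val phi x.
Definition dual_of (phi : V -> k^o) (h : dual_mem phi) : dual_space :=
  @subv_of _ _ (Subspace dual_mem0 dual_memP) phi h.

Lemma dual_app_of phi (h : dual_mem phi) x : dual_app (dual_of h) x = phi x.
Proof. by []. Qed.

Lemma dual_app_mem phi : dual_mem (dual_app phi).
Proof. exact: (subvP phi). Qed.

Lemma dual_app_linr phi : linear (dual_app phi).
Proof. exact: (dual_app_mem phi).1. Qed.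

Lemma dual_app_linl x : linear (dual_app^~ x).
Proof. by []. Qed.

Lemma dual_ext phi psi : (forall x, dual_app phi x = dual_app psi x) -> phi = psi.
Proof. by move=> h; apply/val_inj/funext. Qed.

Fact dual_proj_mem (i : int) (phi : dual_space) :
  dual_mem (fun x => dual_app phi (gproj (- i) x)).
Proof.
apply: (@dual_mem_intro _ [:: - i]).
  exact: lin_comp (dual_app_linr phi) (@gproj_lin _ V (- i)).
move=> j x hx; rewrite inE (gproj_homog _ hx) eq_sym => /negbTE ->.
exact: lin0 (dual_app_linr phi).
Qed.

Definition dual_proj (i : int) (phi : dual_space) : dual_space :=
  dual_of (dual_proj_mem i phi).

Fact dual_proj_lin i : linear (dual_proj i).
Proof. by move=> a phi psi; apply: dual_ext. Qed.

Fact dual_projK i j phi :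
  dual_proj i (dual_proj j phi) = if i == j then dual_proj j phi else 0.
Proof.
apply: dual_ext => x; rewrite /dual_proj !dual_app_of gprojK (inj_eq oppr_inj).
rewrite eq_sym; case: eqP => [->|_] //.
by rewrite (lin0 (dual_app_linr phi)).
Qed.

Fact dual_proj_fin phi : exists s : seq int,
  uniq s /\ phi = \sum_(i <- s) dual_proj i phi.
Proof.
have [_ [s [us hs]]] := dual_app_mem phi.
exists (map -%R s); split; first by rewrite map_inj_uniq //; apply: oppr_inj.
apply: dual_ext => x; rewrite big_map (lin_sum (dual_app_linl x)) hs.
by apply: eq_bigr => i _; rewrite dual_app_of opprK.
Qed.

Definition gdual : gvect k := GVect dual_proj_lin dual_projK dual_proj_fin.

Lemma gdual_projE i (phi : gdual) x :
  dual_app (gproj i phi) x = dual_app phi (gproj (- i) x).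
Proof. by []. Qed.

Lemma gdual_homogP i (phi : gdual) :
  homog i phi <-> forall j x, homog j x -> j != - i -> dual_app phi x = 0.
Proof.
split=> [h j x hx ji|h].
  rewrite -h gdual_projE (gproj_homog _ hx) eq_sym (negbTE ji).
  exact: lin0 (dual_app_linr phi).
apply: dual_ext; apply: homog_ext.
- exact: dual_app_linr.
- exact: dual_app_linr.
- move=> j x hx; rewrite gdual_projE (gproj_homog _ hx) eq_sym.
  case: eqVneq => // ji; rewrite (h j x hx ji).
  exact: lin0 (dual_app_linr phi).
Qed.
End GradedDual.

Section Contraction.
Variable k : fieldType.
Implicit Types U V W : lmodType k.

Definition contr_r U V (e : V -> k^o) : tens U V -> U :=
  tlift (fun u v => e v *: u).
Definition contr_l U V (e : U -> k^o) : tens U V -> V :=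
  tlift (fun u v => e u *: v).

Fact contr_r_bil U V (e : V -> k^o) : linear e ->
  bilinear_map (fun (u : U) (v : V) => e v *: u).
Proof.
move=> he; split=> [v|u] a x y; first by rewrite scalerDr !scalerA mulrC.
by rewrite he scalerDl scalerA.
Qed.

Fact contr_l_bil U V (e : U -> k^o) : linear e ->
  bilinear_map (fun (u : U) (v : V) => e u *: v).
Proof.
move=> he; split=> [v|u] a x y; last by rewrite scalerDr !scalerA mulrC.
by rewrite he scalerDl scalerA.
Qed.

Lemma contr_r_lin U V (e : V -> k^o) : linear e -> linear (@contr_r U V e).
Proof. by move=> he; apply/tlift_lin/contr_r_bil. Qed.

Lemma contr_l_lin U V (e : U -> k^o) : linear e -> linear (@contr_l U V e).
Proof. by move=> he; apply/tlift_lin/contr_l_bil. Qed.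

Lemma contr_rE U V (e : V -> k^o) (u : U) v : linear e ->
  contr_r e (u ⊗ v) = e v *: u.
Proof. by move=> he; rewrite /contr_r tliftE //; apply: contr_r_bil. Qed.

Lemma contr_lE U V (e : U -> k^o) u (v : V) : linear e ->
  contr_l e (u ⊗ v) = e u *: v.
Proof. by move=> he; rewrite /contr_l tliftE //; apply: contr_l_bil. Qed.

Definition tswap U V : tens U V -> tens V U := tlift (fun u v => v ⊗ u).

Fact tswap_bil U V : bilinear_map (fun (u : U) (v : V) => v ⊗ u).
Proof. by split=> [v|u] a x y; [apply: tmul_linr|apply: tmul_linl]. Qed.

Lemma tswap_lin U V : linear (@tswap U V).
Proof. exact: tlift_lin (tswap_bil _ _). Qed.

Lemma tswapE U V (u : U) (v : V) : tswap (u ⊗ v) = v ⊗ u.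
Proof. exact: (tliftE (tswap_bil U V)). Qed.

Lemma tswapK U V : cancel (@tswap U V) (@tswap V U).
Proof.
apply: (tens_ext (g := id)) => // [|u v]; last by rewrite !tswapE.
exact: lin_comp (@tswap_lin _ _) (@tswap_lin _ _).
Qed.

Definition tassocV U V W (x : tens U (tens V W)) : tens (tens U V) W :=
  tmap (@tswap V U) id (tswap (tassoc (tswap (tmap id (@tswap V W) x)))).

Lemma tassocV_lin U V W : linear (@tassocV U V W).
Proof.
apply: (lin_comp (tmap_lin (@tswap_lin V U) (@lin_id _ W))).
apply: (lin_comp (@tswap_lin W (tens V U))).
apply: (lin_comp (@tassoc_lin _ W V U)).
apply: (lin_comp (@tswap_lin U (tens W V))).
exact: (tmap_lin (@lin_id _ U) (@tswap_lin V W)).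
Qed.

Lemma tassocVE U V W (u : U) (v : V) (w : W) :
  tassocV (u ⊗ (v ⊗ w)) = u ⊗ v ⊗ w.
Proof.
have l1 := @tswap_lin V W; have l2 := @tswap_lin V U.
by rewrite /tassocV tmapE // !tswapE tassocE tswapE tmapE // tswapE.
Qed.

Lemma tassocVK U V W : cancel (@tassocV U V W) (@tassoc _ U V W).
Proof.
apply: (tens_ext (g := id)) => // [|u x].
  exact: lin_comp (@tassoc_lin _ _ _ _) (@tassocV_lin _ _ _).
suff E : (fun x : tens V W => tassoc (tassocV (u ⊗ x))) =1 tmul u by exact: E.
apply: tens_ext => [||v w].
- by move=> a y z; rewrite tmul_linr tassocV_lin tassoc_lin.
- exact: tmul_linr.
- by rewrite tassocVE tassocE.
Qed.
End Contraction.

Section Evaluation.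
Variables (k : fieldType) (V : gvect k).
Notation DV := (gdual V).

(* The inclusion M ⊗ DV ⊂ Hom(V, M), (m ⊗ phi)(x) = phi(x) m, and its       *)
(* mirror image (phi ⊗ m)(x) = phi(x) m. No Koszul sign: with a sign,       *)
(* Delta_M(m)(a) = a m would not be coassociative.                          *)
Definition tev (M : lmodType k) (x : tens M DV) (a : V) : M :=
  contr_r ((@dual_app k V)^~ a) x.
Definition tevl (M : lmodType k) (x : tens DV M) (a : V) : M :=
  contr_l ((@dual_app k V)^~ a) x.

Variable M : lmodType k.

Lemma tev_lin a : linear (fun x : tens M DV => tev x a).
Proof. exact: contr_r_lin. Qed.

Lemma tevl_lin a : linear (fun x : tens DV M => tevl x a).
Proof. exact: contr_l_lin. Qed.

Lemma tevE (m : M) (phi : DV) a : tev (m ⊗ phi) a = dual_app phi a *: m.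
Proof. exact: contr_rE. Qed.

Lemma tevlE (m : M) (phi : DV) a : tevl (phi ⊗ m) a = dual_app phi a *: m.
Proof. exact: contr_lE. Qed.

Lemma tev_linr x : linear (tev x : V -> M).
Proof.
move=> a u v; move: x; apply: (tens_ext (f := fun x => tev x (a *: u + v))
  (g := fun x => a *: tev x u + tev x v)); first exact: tev_lin.
  move=> b x y; rewrite !tev_lin !scalerDr !scalerA [a * b]mulrC.
  by rewrite addrACA.
by move=> m phi; rewrite !tevE (dual_app_linr phi) scalerDl scalerA.
Qed.

Lemma tevl_swap x a : tevl (tswap x) a = tev x a :> M.
Proof.
move: x; apply: (tens_ext (f := fun x => tevl (tswap x) a)
  (g := fun x => tev x a)).
- exact: lin_comp (@tevl_lin a) (@tswap_lin _ _ _).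
- exact: tev_lin.
- by move=> m phi; rewrite tswapE tevE tevlE.
Qed.

Lemma tev_swap x a : tev (tswap x) a = tevl x a :> M.
Proof. by rewrite -tevl_swap tswapK. Qed.

Lemma tev_eq0 (x : tens M DV) : (forall a, tev x a = 0) -> x = 0.
Proof.
have [s ->] := tens_sumP x; elim: {x}(size s) {-2}s (erefl (size s)) => [|n IH].
  by move=> t /size0nil ->; rewrite big_nil.
move=> [|[m phi] t] //= [st] h.
have {}h a : dual_app phi a *: m + \sum_(p <- t) dual_app p.2 a *: p.1 = 0.
  rewrite -[RHS](h a) (lin_sum (@tev_lin a)) big_cons tevE; congr (_ + _).
  by apply: eq_bigr => p _; rewrite tevE.
have [phi0|[b phib]] : (forall a, dual_app phi a = 0) \/
    exists a, dual_app phi a != 0.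
  have [?|] := pselect (forall a, dual_app phi a = 0); first by left.
  by move/existsNP => [a /eqP ?]; right; exists a.
- have -> : phi = 0 by apply: dual_ext.
  rewrite big_cons (lin0 (@tmul_linr _ _ _ _)) add0r; apply: IH => // a.
  rewrite (lin_sum (@tev_lin a)) -[RHS](h a) phi0 scale0r add0r.
  by apply: eq_bigr => p _; rewrite tevE.
pose c (p : M * DV) := dual_app p.2 b / dual_app phi b.
have em : m = - \sum_(p <- t) c p *: p.1.
  apply: (scalerI phib); rewrite scalerN scaler_sumr.
  have := h b; move/eqP; rewrite addr_eq0 => /eqP ->; congr (- _).
  by apply: eq_bigr => p _; rewrite scalerA /c mulrC divfK.
pose t' := [seq (p.1, p.2 - c p *: phi) | p <- t].
have -> : \sum_(p <- (m, phi) :: t) p.1 ⊗ p.2 =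
    \sum_(p <- t') p.1 ⊗ p.2.
  rewrite big_cons big_map /= {1}em (linN (@tmul_linl _ _ _ phi)).
  rewrite (lin_sum (@tmul_linl _ _ _ phi)) addrC -sumrB.
  apply: eq_bigr => p _; rewrite (linB (@tmul_linr _ _ _ p.1)).
  by rewrite (linZ (@tmul_linl _ _ _ phi)) (linZ (@tmul_linr _ _ _ p.1)).
apply: IH; first by rewrite size_map.
move=> a; rewrite (lin_sum (@tev_lin a)) big_map -[RHS](h a) {1}em.
rewrite scalerN scaler_sumr addrC -sumrB; apply: eq_bigr => p _.
rewrite tevE (linB (@dual_app_linl _ _ a)) (linZ (@dual_app_linl _ _ a)).
by rewrite scalerBl scalerA [_ * c p]mulrC.
Qed.

Lemma tev_inj (x y : tens M DV) :
  (forall i a, homog i a -> tev x a = tev y a) -> x = y.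
Proof.
move=> h; apply/eqP; rewrite -subr_eq0; apply/eqP/tev_eq0.
apply: (homog_ext (g := fun=> 0)); first exact: tev_linr.
  by move=> a u v; rewrite scaler0 addr0.
by move=> i a ha; rewrite (linB (@tev_lin a)) (h i a ha) subrr.
Qed.

Lemma tevl_inj (x y : tens DV M) :
  (forall i a, homog i a -> tevl x a = tevl y a) -> x = y.
Proof.
move=> h; apply: (can_inj (@tswapK _ _ _)); apply: tev_inj => i a ha.
by rewrite !tev_swap; apply: h ha.
Qed.

Fact dual_coordinates (i : int) : finite_type V ->
  exists (n : nat) (e : 'I_n -> V) (c : 'I_n -> DV),
    forall x, gproj i x = \sum_j dual_app (c j) x *: e j.
Proof.
move=> /(_ i) fi.
pose P n := `[< exists e : 'I_n -> V,
  forall x, homog i x -> exists c : 'I_n -> k, x = \sum_j c j *: e j >].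
have exP : exists n, P n by have [n ?] := fi; exists n; apply/asboolP.
case: (ex_minnP exP) => n /asboolP[e he] nmin; exists n, e.
have indep (c : 'I_n -> k) : \sum_j c j *: e j = 0 -> forall j, c j = 0.
  move=> c0 j0; apply/eqP; apply: contraT => cj0.
  case: n => [|n] in e he nmin c c0 j0 cj0 *; first by case: j0 cj0.
  have : P n; last by move/nmin; rewrite ltnn.
  apply/asboolP; exists (e \o fintype.lift j0) => x hx; have [d ->] := he x hx.
  exists (fun j => d (fintype.lift j0 j) - d j0 / c j0 * c (fintype.lift j0 j)).
  have ej0 : e j0 = - \sum_j (c (fintype.lift j0 j) / c j0) *: e (fintype.lift j0 j).
    apply: (scalerI cj0); rewrite scalerN scaler_sumr; apply/eqP.
    rewrite -addr_eq0 -[X in _ == X]c0 (bigD1_ord j0) //=; apply/eqP.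
    congr (_ + _); apply: eq_bigr => j _.
    by rewrite scalerA mulrC divfK.
  rewrite (bigD1_ord j0) //= ej0 scalerN scaler_sumr addrC -sumrB.
  apply: eq_bigr => j _; rewrite scalerBl scalerA; congr (_ - _ *: _).
  by rewrite -mulrA [c _ / _]mulrC.
have hx x : exists c : 'I_n -> k, gproj i x = \sum_j c j *: e j.
  exact: he (homog_gproj i x).
pose c x := sval (cid (hx x)).
have cE x : gproj i x = \sum_j c x j *: e j by rewrite /c; case: cid.
have clin j : linear (fun x => c x j : k^o).
  move=> a x y; apply/eqP; rewrite -subr_eq0; apply/eqP.
  apply: (indep (fun j => c (a *: x + y) j - (a * c x j + c y j)) _ j).
  under eq_bigr do rewrite scalerBl scalerDl -scalerA.
  by rewrite sumrB big_split -scaler_sumr /= -!cE gproj_lin subrr.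
have cmem j : dual_mem (fun x => c x j : k^o).
  apply: (@dual_mem_intro _ _ _ [:: i] (clin j)) => l x hl; rewrite inE => li.
  apply: (indep (c x)); rewrite -cE (gproj_homog _ hl) eq_sym.
  by rewrite (negbTE li).
by exists (fun j => dual_of (cmem j)).
Qed.

Fact tev_surj (f : V -> M) (s : seq int) : finite_type V -> linear f ->
  (forall i a, homog i a -> i \notin s -> f a = 0) ->
  exists x : tens M DV, forall a, tev x a = f a.
Proof.
move=> ft hf fs.
have fi i : exists x : tens M DV, forall a, tev x a = f (gproj i a).
  have [n [e [c ec]]] := dual_coordinates i ft.
  exists (\sum_j f (e j) ⊗ c j) => a; rewrite (lin_sum (@tev_lin a)) ec.
  by rewrite (lin_sum hf); apply: eq_bigr => j _; rewrite tevE (linZ hf).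
pose g i := sval (cid (fi i)).
have gE i a : tev (g i) a = f (gproj i a) by rewrite /g; case: cid.
exists (\sum_(i <- undup s) g i).
apply: (homog_ext (@tev_linr _) hf) => i a ha.
rewrite (lin_sum (@tev_lin a)); have [si|si] := boolP (i \in s); last first.
  rewrite (fs i a ha si) big_seq big1 // => j; rewrite mem_undup => js.
  rewrite gE (gproj_homog _ ha); case: eqP => [ji|_]; last exact: lin0 hf.
  by rewrite -ji js in si.
rewrite (bigD1_seq i) ?mem_undup ?undup_uniq //= big1 ?addr0.
  by rewrite gE ha.
by move=> j /negbTE ji; rewrite gE (gproj_homog _ ha) ji (lin0 hf).
Qed.
End Evaluation.

(* Not an [algType], which would exclude the zero algebra.                  *)
Record galgebra (k : fieldType) := GAlgebra {
  ga :> gvect k;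
  gmul : ga -> ga -> ga;
  gone : ga;
  gmul_bil : bilinear_map gmul;
  gmulA : associative gmul;
  gmul1l : left_id gone gmul;
  gmul1r : right_id gone gmul;
  gone_deg : homog 0 gone;
  gmul_deg : forall i j a b, homog i a -> homog j b -> homog (i + j) (gmul a b) }.

Record glmodule (k : fieldType) (A : galgebra k) := GLModule {
  glm :> gvect k;
  lact : A -> glm -> glm;
  lact_bil : bilinear_map lact;
  lactA : forall a b m, lact (gmul a b) m = lact a (lact b m);
  lact1 : forall m, lact (gone A) m = m;
  lact_deg : forall i j a m, homog i a -> homog j m -> homog (i + j) (lact a m) }.

Record grmodule (k : fieldType) (A : galgebra k) := GRModule {
  grm :> gvect k;
  ract : grm -> A -> grm;
  ract_bil : bilinear_map ract;
  ractA : forall m a b, ract m (gmul a b) = ract (ract m a) b;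
  ract1 : forall m, ract m (gone A) = m;
  ract_deg : forall i j m a, homog i m -> homog j a -> homog (i + j) (ract m a) }.

Record gbimodule (k : fieldType) (A : galgebra k) := GBimodule {
  gbm :> gvect k;
  blact : A -> gbm -> gbm;
  bract : gbm -> A -> gbm;
  blact_bil : bilinear_map blact;
  blactA : forall a b m, blact (gmul a b) m = blact a (blact b m);
  blact1 : forall m, blact (gone A) m = m;
  blact_deg : forall i j a m,
    homog i a -> homog j m -> homog (i + j) (blact a m);
  bract_bil : bilinear_map bract;
  bractA : forall m a b, bract m (gmul a b) = bract (bract m a) b;
  bract1 : forall m, bract m (gone A) = m;
  bract_deg : forall i j m a,
    homog i m -> homog j a -> homog (i + j) (bract m a);
  blractA : forall a m b, bract (blact a m) b = blact a (bract m b) }.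

Definition lmodule_map (k : fieldType) (A : galgebra k) (M M' : glmodule A)
    (f : M -> M') : Prop :=
  [/\ linear f, deg_map 0 f & forall a m, f (lact a m) = lact a (f m)].

Definition rmodule_map (k : fieldType) (A : galgebra k) (N N' : grmodule A)
    (f : N -> N') : Prop :=
  [/\ linear f, deg_map 0 f & forall n a, f (ract n a) = ract (f n) a].

(* These are the A^e-linear maps of degree [p]: moving the map past [a]     *)
(* costs the Koszul sign (-1)^(p |a|).                                      *)
Definition bimodule_map (k : fieldType) (A : galgebra k) (B B' : gbimodule A)
    (p : int) (f : B -> B') : Prop :=
  [/\ linear f, deg_map p f,
      forall i a b, homog i a ->
        f (blact a b) = ((-1) ^+ absz (p * i) : k) *: blact a (f b)
    & forall b a, f (bract b a) = bract (f b) a].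

Section Bimodules.
Variables (k : fieldType) (A : galgebra k).

Definition regular_bimodule : gbimodule A :=
  @GBimodule k A A (@gmul k A) (@gmul k A)
    (gmul_bil A) (fun a b m => esym (gmulA a b m)) (@gmul1l k A) (@gmul_deg k A)
    (gmul_bil A) (fun m a b => gmulA m a b) (@gmul1r k A) (@gmul_deg k A)
    (fun a m b => esym (gmulA a m b)).

Variables (M : glmodule A) (N : grmodule A).

Lemma lact_linl m : linear (fun a => @lact _ _ M a m).
Proof. exact: (lact_bil M).1. Qed.
Lemma lact_linr a : linear (@lact _ _ M a).
Proof. exact: (lact_bil M).2. Qed.
Lemma ract_linl a : linear (fun n => @ract _ _ N n a).
Proof. exact: (ract_bil N).1. Qed.
Lemma ract_linr n : linear (@ract _ _ N n).
Proof. exact: (ract_bil N).2. Qed.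

Let MN := gtens M N.
Definition tens_lact (a : A) : MN -> MN := tmap (@lact _ _ M a) id.
Definition tens_ract (x : MN) (a : A) : MN := tmap id (fun n => ract n a) x.

Let tlE a m n : tens_lact a (m ⊗ n) = lact a m ⊗ n.
Proof. exact/tmapE/lin_id/lact_linr. Qed.
Let trE a m n : tens_ract (m ⊗ n) a = m ⊗ ract n a.
Proof. exact: (tmapE _ _ (@lin_id _ _) (@ract_linl a)). Qed.
Let tl_lin a : linear (tens_lact a).
Proof. exact: (tmap_lin (@lact_linr a) (@lin_id _ _)). Qed.
Let tr_lin a : linear (tens_ract^~ a).
Proof. exact: (tmap_lin (@lin_id _ _) (@ract_linl a)). Qed.

Fact tens_lact_bil : bilinear_map tens_lact.
Proof.
split=> [x|a]; last exact: tl_lin.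
move=> c a b; move: x; apply: (tens_ext (f := fun x => tens_lact (c *: a + b) x)
  (g := fun x => c *: tens_lact a x + tens_lact b x)) => [||m n].
- exact: tl_lin.
- move=> d x y; rewrite !tl_lin !scalerDr !scalerA [c * d]mulrC.
  by rewrite addrACA.
- by rewrite !tlE lact_linl tmul_linl.
Qed.

Fact tens_ract_bil : bilinear_map tens_ract.
Proof.
split=> [a|x]; first exact: tr_lin.
move=> c a b; move: x; apply: (tens_ext (f := fun x => tens_ract x (c *: a + b))
  (g := fun x => c *: tens_ract x a + tens_ract x b)) => [||m n].
- exact: tr_lin.
- move=> d x y; rewrite !tr_lin !scalerDr !scalerA [c * d]mulrC.
  by rewrite addrACA.
- by rewrite !trE ract_linr tmul_linr.
Qed.

Fact tens_lactA a b x : tens_lact (gmul a b) x = tens_lact a (tens_lact b x).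
Proof.
move: x; apply: (tens_ext (g := fun x => tens_lact a (tens_lact b x))) => [||m n].
- exact: tl_lin.
- exact: lin_comp (@tl_lin a) (@tl_lin b).
- by rewrite !tlE lactA.
Qed.

Fact tens_lact1 x : tens_lact (gone A) x = x.
Proof.
move: x; apply: (tens_ext (f := tens_lact (gone A)) (g := id)) => [||m n].
- exact: tl_lin.
- exact: lin_id.
- by rewrite tlE lact1.
Qed.

Fact tens_ractA x a b : tens_ract x (gmul a b) = tens_ract (tens_ract x a) b.
Proof.
move: x; apply: (tens_ext (f := fun x => tens_ract x (gmul a b))
  (g := fun x => tens_ract (tens_ract x a) b)) => [||m n].
- exact: tr_lin.
- exact: lin_comp (@tr_lin b) (@tr_lin a).
- by rewrite !trE ractA.
Qed.

Fact tens_ract1 x : tens_ract x (gone A) = x.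
Proof.
move: x; apply: (tens_ext (f := fun x => tens_ract x (gone A)) (g := id))
  => [||m n].
- exact: tr_lin.
- exact: lin_id.
- by rewrite trE ract1.
Qed.

Fact tens_lractA a x b :
  tens_ract (tens_lact a x) b = tens_lact a (tens_ract x b).
Proof.
move: x; apply: (tens_ext (f := fun x => tens_ract (tens_lact a x) b)
  (g := fun x => tens_lact a (tens_ract x b))) => [||m n].
- exact: lin_comp (@tr_lin b) (@tl_lin a).
- exact: lin_comp (@tl_lin a) (@tr_lin b).
- by rewrite !(trE, tlE).
Qed.

Fact tens_lact_deg i j a (x : MN) :
  homog i a -> homog j x -> homog (i + j) (tens_lact a x).
Proof.
move=> ha <-; rewrite /homog /=.
move: x; apply: (tens_homog_ext (f := fun x => tproj (i + j) (tens_lact a (tproj j x)))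
  (g := fun x => tens_lact a (tproj j x))) => [||l r m n hm hn].
- exact: (lin_comp (@tproj_lin _ _ _ _) (lin_comp (@tl_lin a) (@tproj_lin _ _ _ _))).
- exact: (lin_comp (@tl_lin a) (@tproj_lin _ _ _ _)).
- rewrite (tprojE j hm hn); case: eqP => [->|_].
    by rewrite tlE (tprojE _ (lact_deg ha hm) hn) addrA eqxx.
  by rewrite (lin0 (@tl_lin a)) (lin0 (@tproj_lin _ _ _ _)).
Qed.

Fact tens_ract_deg i j (x : MN) a :
  homog i x -> homog j a -> homog (i + j) (tens_ract x a).
Proof.
move=> <- ha; rewrite /homog /=.
move: x; apply: (tens_homog_ext (f := fun x => tproj (i + j) (tens_ract (tproj i x) a))
  (g := fun x => tens_ract (tproj i x) a)) => [||l r m n hm hn].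
- exact: (lin_comp (@tproj_lin _ _ _ _) (lin_comp (@tr_lin a) (@tproj_lin _ _ _ _))).
- exact: (lin_comp (@tr_lin a) (@tproj_lin _ _ _ _)).
- rewrite (tprojE i hm hn); case: eqP => [->|_].
    by rewrite trE (tprojE _ hm (ract_deg hn ha)) addrA eqxx.
  by rewrite (lin0 (@tr_lin a)) (lin0 (@tproj_lin _ _ _ _)).
Qed.

Definition tens_bimodule : gbimodule A :=
  @GBimodule k A MN tens_lact tens_ract
    tens_lact_bil tens_lactA tens_lact1 tens_lact_deg
    tens_ract_bil tens_ractA tens_ract1 tens_ract_deg tens_lractA.
End Bimodules.

Record gcoalgebra (k : fieldType) := GCoalgebra {
  gc :> gvect k;
  comul : gc -> gtens gc gc;
  counit : gc -> k^o;
  comul_lin : linear comul;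
  comul_deg : deg_map 0 comul;
  counit_lin : linear counit;
  counit_deg : forall i c, homog i c -> i != 0 -> counit c = 0;
  comulA : forall c, tassoc (tmap comul id (comul c)) = tmap id comul (comul c);
  counitl : forall c, contr_l counit (comul c) = c;
  counitr : forall c, contr_r counit (comul c) = c }.

Record grcomodule (k : fieldType) (C : gcoalgebra k) := GRComodule {
  grc :> gvect k;
  rcoact : grc -> gtens grc C;
  rcoact_lin : linear rcoact;
  rcoact_deg : deg_map 0 rcoact;
  rcoactA : forall x,
    tassoc (tmap rcoact id (rcoact x)) = tmap id (@comul k C) (rcoact x);
  rcoact1 : forall x, contr_r (@counit k C) (rcoact x) = x }.

Record glcomodule (k : fieldType) (C : gcoalgebra k) := GLComodule {
  glc :> gvect k;
  lcoact : glc -> gtens C glc;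
  lcoact_lin : linear lcoact;
  lcoact_deg : deg_map 0 lcoact;
  lcoactA : forall x,
    tassoc (tmap (@comul k C) id (lcoact x)) = tmap id lcoact (lcoact x);
  lcoact1 : forall x, contr_l (@counit k C) (lcoact x) = x }.

Definition rcomodule_map (k : fieldType) (C : gcoalgebra k) (X Y : grcomodule C)
    (f : X -> Y) : Prop :=
  [/\ linear f, deg_map 0 f & forall x, rcoact (f x) = tmap f id (rcoact x)].

Definition lcomodule_map (k : fieldType) (C : gcoalgebra k) (X Y : glcomodule C)
    (f : X -> Y) : Prop :=
  [/\ linear f, deg_map 0 f & forall x, lcoact (f x) = tmap id f (lcoact x)].

Lemma rcomodule_map_id (k : fieldType) (C : gcoalgebra k) (X : grcomodule C) :
  rcomodule_map (@id X).
Proof. by split=> [||x] //; [apply: deg_map_id|rewrite tmap_id]. Qed.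

Lemma lcomodule_map_id (k : fieldType) (C : gcoalgebra k) (X : glcomodule C) :
  lcomodule_map (@id X).
Proof. by split=> [||x] //; [apply: deg_map_id|rewrite tmap_id]. Qed.

Section Coaction.
Variables (k : fieldType) (A : galgebra k) (M : gvect k).
Hypotheses (A0 : nonneg_graded A) (Aft : finite_type A) (Mb : bounded_above M).
Variable act : A -> M -> M.
Hypothesis act_bil : bilinear_map act.
Hypothesis act_deg : forall i j a m,
  homog i a -> homog j m -> homog (i + j) (act a m).

Let act_linl m : linear (act^~ m). Proof. exact: act_bil.1. Qed.
Let act_linr a : linear (act a). Proof. exact: act_bil.2. Qed.

Fact coaction_exists (m : M) : exists x : tens M (gdual A),
  forall a, tev x a = act a m.
Proof.
have [N hN] := Mb; pose K := \sum_(j <- gsupp m) `|N - j|.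
pose s := [seq Posz n | n <- iota 0 `|K|.+1].
apply: (@tev_surj _ _ _ (act^~ m) s) => // i a ha si.
rewrite (gsuppE m) (lin_sum (@act_linr a)) big_seq big1 // => j mj.
have hj := act_deg ha (homog_gproj j m).
have [i0|i0] := ltP i 0; first by rewrite (A0 i0 ha) (lin0 (@act_linl _)).
apply: hN hj; have jK : `|N - j| <= K.
  rewrite /K (big_rem j) //= lerDl; apply: sumr_ge0 => l _; exact: normr_ge0.
have : ~~ (i <= K).
  apply: contra si => iK; apply/mapP; exists `|i|%N; last by lia.
  by rewrite mem_iota; lia.
lia.
Qed.

Definition coaction (m : M) : gtens M (gdual A) := sval (cid (coaction_exists m)).

Lemma coactionE m a : tev (coaction m) a = act a m.
Proof. by rewrite /coaction; case: cid. Qed.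

Lemma coaction_lin : linear coaction.
Proof.
move=> c m m'; apply: tev_inj => i a _.
by rewrite (@tev_lin _ _ _ a c) !coactionE act_linr.
Qed.

Lemma coaction_deg : deg_map 0 coaction.
Proof.
apply: deg_map0 => p m hm; rewrite /homog /=; apply: tev_inj => i a ha.
have -> : tev (tproj p (coaction m)) a = gproj (i + p) (tev (coaction m) a).
  move: (coaction m); apply: (tens_homog_ext
    (f := fun x : tens M (gdual A) => tev (tproj p x) a)
    (g := fun x : tens M (gdual A) => gproj (i + p) (tev x a))).
  - exact: lin_comp (@tev_lin _ _ _ a) (@tproj_lin _ _ _ p).
  - exact: lin_comp (@gproj_lin _ _ _) (@tev_lin _ _ _ a).
  - move=> j l n phi hn hphi; rewrite (tprojE p hn hphi) tevE.
    rewrite (linZ (@gproj_lin _ _ _)) (gproj_homog _ hn).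
    have [li|li] := eqVneq i (- l).
      have -> : (p == j + l) = (i + p == j) by rewrite li; apply/eqP/eqP; lia.
      by case: eqP => _; rewrite ?tevE ?scaler0 // (lin0 (@tev_lin _ _ _ a)).
    have phi0 : dual_app phi a = 0 := (gdual_homogP l phi).1 hphi i a ha li.
    rewrite phi0 scale0r; case: eqP => _; last exact: lin0 (@tev_lin _ _ _ a).
    by rewrite tevE phi0 scale0r.
by rewrite coactionE; apply: act_deg.
Qed.
End Coaction.

Section DualCoalgebra.
Variables (k : fieldType) (A : galgebra k).
Hypotheses (A0 : nonneg_graded A) (Aft : finite_type A).

Let gmul_linl b : linear (fun a : A => gmul a b).
Proof. exact: (gmul_bil A).1. Qed.
Let gmul_linr a : linear (@gmul k A a).
Proof. exact: (gmul_bil A).2. Qed.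

(* DA as a left A-module: (b phi)(a) = phi(ab).                             *)
Fact dual_lact_mem (b : A) (phi : gdual A) :
  dual_mem (fun a => dual_app phi (gmul a b)).
Proof.
have [hphi [s [us hs]]] := dual_app_mem phi.
apply: (@dual_mem_intro _ _ _ [seq t - j | t <- s, j <- gsupp b]).
  exact: lin_comp hphi (@gmul_linl b).
move=> i a ha si; rewrite (gsuppE b) (lin_sum (@gmul_linr a)) (lin_sum hphi).
rewrite big_seq big1 // => j bj.
apply: (dual_memN hphi hs (gmul_deg ha (homog_gproj j b))).
apply: contra si => sij; apply/allpairsP; exists (i + j, j); split=> //=.
by rewrite addrK.
Qed.

Definition dual_lact (b : A) (phi : gdual A) : gdual A :=
  dual_of (dual_lact_mem b phi).

Fact dual_lactE b phi a : dual_app (dual_lact b phi) a = dual_app phi (gmul a b).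
Proof. by []. Qed.

Fact dual_lact_bil : bilinear_map dual_lact.
Proof.
split=> [phi|b] c x y; apply: dual_ext => a; last by [].
rewrite dual_lactE gmul_linr (dual_app_linr phi).
by rewrite (@dual_app_linl _ _ a c).
Qed.

Fact dual_lactA a b phi : dual_lact (gmul a b) phi = dual_lact a (dual_lact b phi).
Proof. by apply: dual_ext => c; rewrite !dual_lactE gmulA. Qed.

Fact dual_lact1 phi : dual_lact (gone A) phi = phi.
Proof. by apply: dual_ext => c; rewrite !dual_lactE gmul1r. Qed.

Fact dual_lact_deg i j b (phi : gdual A) :
  homog i b -> homog j phi -> homog (i + j) (dual_lact b phi).
Proof.
move=> hb /gdual_homogP hphi; apply/gdual_homogP => l a ha lij.
rewrite dual_lactE; apply: hphi (gmul_deg ha hb) _.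
by apply: contra lij => /eqP h; apply/eqP; lia.
Qed.

Fact gdual_bounded_above : bounded_above (gdual A).
Proof.
exists 0 => i phi i0 /gdual_homogP hphi; apply: dual_ext.
apply: (homog_ext (dual_app_linr phi) (dual_app_linr (0 : gdual A))) => j a ha.
rewrite (lin0 (@dual_app_linl _ _ a)).
have [ji|/(hphi j a ha)//] := eqVneq j (- i).
have j0 : j < 0 by lia.
by rewrite (A0 j0 ha) (lin0 (dual_app_linr phi)).
Qed.

Definition dual_comul : gdual A -> gtens (gdual A) (gdual A) :=
  coaction A0 Aft gdual_bounded_above dual_lact_bil dual_lact_deg.

(* phi(ab) = sum of phi'(a) phi''(b), writing the coproduct of phi as the   *)
(* sum of the phi' ⊗ phi''.                                                 *)
Lemma dual_comulE phi a b :
  dual_app (tev (dual_comul phi) b) a = dual_app phi (gmul a b).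
Proof. by rewrite /dual_comul coactionE. Qed.

Definition dual_counit (phi : gdual A) : k^o := dual_app phi (gone A).

Section RightCoaction.
Variables (M : glmodule A) (Mb : bounded_above M).
Let D : M -> gtens M (gdual A) :=
  coaction A0 Aft Mb (lact_bil M) (@lact_deg _ _ M).
Let D_lin : linear D. Proof. exact: coaction_lin. Qed.
Let dc_lin : linear dual_comul. Proof. exact: coaction_lin. Qed.

Fact coaction_coassoc m : tassoc (tmap D id (D m)) = tmap id dual_comul (D m).
Proof.
rewrite -[RHS]tassocVK; congr (tassoc _).
apply: tev_inj => i a _; apply: tev_inj => j b _.
have -> : tev (tmap D id (D m)) a = D (tev (D m) a).
  move: (D m); apply: (tens_ext (f := fun z => tev (tmap D id z) a)
    (g := fun z => D (tev z a))) => [||n phi].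
  - exact: lin_comp (@tev_lin _ _ _ a) (tmap_lin D_lin (@lin_id _ _)).
  - exact: lin_comp D_lin (@tev_lin _ _ _ a).
  - by rewrite tmapE // !tevE (linZ D_lin).
have -> : tev (tev (tassocV (tmap id dual_comul (D m))) a) b = tev (D m) (gmul b a).
  move: (D m); apply: (tens_ext
    (f := fun z => tev (tev (tassocV (tmap id dual_comul z)) a) b)
    (g := fun z => tev z (gmul b a))) => [||n phi].
  - apply: lin_comp (@tev_lin _ _ _ b) _; apply: lin_comp (@tev_lin _ _ _ a) _.
    exact: lin_comp (@tassocV_lin _ _ _ _) (tmap_lin (@lin_id _ _) dc_lin).
  - exact: tev_lin.
  - rewrite tmapE // tevE -dual_comulE; move: (dual_comul phi).
    apply: (tens_ext (f := fun w => tev (tev (tassocV (n ⊗ w)) a) b)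
      (g := fun w : tens (gdual A) (gdual A) => dual_app (tev w a) b *: n))
      => [||p q].
    + move=> c x y; rewrite tmul_linr tassocV_lin.
      by rewrite (@tev_lin _ _ _ a c) (@tev_lin _ _ _ b c).
    + move=> c x y; rewrite (@tev_lin _ _ _ a c) (@dual_app_linl _ _ b c).
      by rewrite scalerDl scalerA.
    + rewrite tassocVE !tevE (linZ (@tev_lin _ _ _ b)) tevE.
      by rewrite (linZ (@dual_app_linl _ _ b)) scalerA.
by rewrite !coactionE lactA.
Qed.

Fact coaction_counit m : contr_r dual_counit (D m) = m.
Proof. by have := coactionE A0 Aft Mb (lact_bil M) (@lact_deg _ _ M) m (gone A);
  rewrite lact1. Qed.
End RightCoaction.

Definition dual_lmodule : glmodule A :=
  GLModule dual_lact_bil dual_lactA dual_lact1 dual_lact_deg.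

Fact dual_comulA phi :
  tassoc (tmap dual_comul id (dual_comul phi)) = tmap id dual_comul (dual_comul phi).
Proof. exact: (@coaction_coassoc dual_lmodule gdual_bounded_above). Qed.

Fact dual_counitr phi : contr_r dual_counit (dual_comul phi) = phi.
Proof. exact: (@coaction_counit dual_lmodule gdual_bounded_above). Qed.

Fact dual_counitl phi : contr_l dual_counit (dual_comul phi) = phi.
Proof.
apply: dual_ext => b; rewrite -[in RHS](gmul1l b) -dual_comulE.
move: (dual_comul phi); apply: (tens_ext
  (f := fun z : tens (gdual A) (gdual A) => dual_app (contr_l dual_counit z) b)
  (g := fun z : tens (gdual A) (gdual A) => dual_app (tev z b) (gone A)))
  => [||p q].
- exact: lin_comp (@dual_app_linl _ _ b) (@contr_l_lin _ _ _ dual_counit _).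
- exact: lin_comp (@dual_app_linl _ _ _) (@tev_lin _ _ _ b).
- rewrite contr_lE // tevE !(linZ (@dual_app_linl _ _ _)).
  by rewrite [LHS]mulrC.
Qed.

Fact dual_counit_deg i phi : homog i phi -> i != 0 -> dual_counit phi = 0.
Proof.
move=> /gdual_homogP h i0; apply: h (gone_deg A) _.
by apply: contra i0 => /eqP h; apply/eqP; lia.
Qed.

Definition dual_coalgebra : gcoalgebra k :=
  GCoalgebra (coaction_lin _ _ _ dual_lact_bil dual_lact_deg)
    (coaction_deg _ _ _ dual_lact_bil dual_lact_deg)
    (@dual_app_linl _ _ (gone A)) dual_counit_deg
    dual_comulA dual_counitl dual_counitr.

(* Delta_M(m)(a) = a m, by [coactionE].                                     *)
Definition rcomodule_of (M : glmodule A) (Mb : bounded_above M) :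
    grcomodule dual_coalgebra :=
  @GRComodule _ dual_coalgebra M _ (coaction_lin _ _ _ _ _) (coaction_deg _ _ _ _ _)
    (coaction_coassoc Mb) (coaction_counit Mb).

Section LeftCoaction.
Variables (N : grmodule A) (Nb : bounded_above N).

Let act (a : A) (n : N) : N := ract n a.
Fact act_of_ract_bil : bilinear_map act.
Proof. by split=> [n|a]; [apply: ract_linr|apply: ract_linl]. Qed.
Fact act_of_ract_deg i j (a : A) (n : N) :
  homog i a -> homog j n -> homog (i + j) (act a n).
Proof. by move=> ha hn; rewrite addrC; apply: ract_deg. Qed.

Definition lcoaction (n : N) : gtens (gdual A) N :=
  tswap (coaction A0 Aft Nb act_of_ract_bil act_of_ract_deg n).

(* Delta_N(n)(a) = n a.                                                     *)
Lemma lcoactionE n a : tevl (lcoaction n) a = ract n a.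
Proof. by rewrite /lcoaction tevl_swap coactionE. Qed.

Fact lcoaction_lin : linear lcoaction.
Proof. exact: lin_comp (@tswap_lin _ _ _) (coaction_lin _ _ _ _ _). Qed.

Fact lcoaction_deg : deg_map 0 lcoaction.
Proof.
apply: deg_map0 => i n hn.
have := coaction_deg A0 Aft Nb act_of_ract_bil act_of_ract_deg hn.
rewrite addr0 /lcoaction; move: (coaction _ _ _ _ _ _) => x; rewrite /homog /= => <-.
move: x; apply: (tens_homog_ext
  (f := fun x : tens N (gdual A) => tproj i (tswap (tproj i x)))
  (g := fun x : tens N (gdual A) => tswap (tproj i x))).
- apply: lin_comp (@tproj_lin _ _ _ _) _.
  exact: lin_comp (@tswap_lin _ _ _) (@tproj_lin _ _ _ _).
- exact: lin_comp (@tswap_lin _ _ _) (@tproj_lin _ _ _ _).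
- move=> j l m phi hm hphi; rewrite (tprojE i hm hphi); case: eqP => [->|_].
    by rewrite tswapE (tprojE _ hphi hm) addrC eqxx.
  by rewrite (lin0 (@tswap_lin _ _ _)) (lin0 (@tproj_lin _ _ _ _)).
Qed.

Fact lcoaction_coassoc n :
  tassoc (tmap dual_comul id (lcoaction n)) = tmap id lcoaction (lcoaction n).
Proof.
have dc_lin : linear dual_comul by exact: coaction_lin.
have L_lin := lcoaction_lin.
apply: tevl_inj => i a _; apply: tevl_inj => j b _.
have -> : tevl (tmap id lcoaction (lcoaction n)) a = lcoaction (tevl (lcoaction n) a).
  move: (lcoaction n); apply: (tens_ext (f := fun z => tevl (tmap id lcoaction z) a)
    (g := fun z => lcoaction (tevl z a))) => [||phi m].
  - exact: lin_comp (@tevl_lin _ _ _ a) (tmap_lin (@lin_id _ _) L_lin).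
  - exact: lin_comp L_lin (@tevl_lin _ _ _ a).
  - by rewrite tmapE // !tevlE (linZ L_lin).
have -> : tevl (tevl (tassoc (tmap dual_comul id (lcoaction n))) a) b =
    tevl (lcoaction n) (gmul a b).
  move: (lcoaction n); apply: (tens_ext
    (f := fun z => tevl (tevl (tassoc (tmap dual_comul id z)) a) b)
    (g := fun z => tevl z (gmul a b))) => [||phi m].
  - apply: lin_comp (@tevl_lin _ _ _ b) _; apply: lin_comp (@tevl_lin _ _ _ a) _.
    exact: lin_comp (@tassoc_lin _ _ _ _) (tmap_lin dc_lin (@lin_id _ _)).
  - exact: tevl_lin.
  - rewrite tmapE // tevlE -dual_comulE; move: (dual_comul phi).
    apply: (tens_ext (f := fun w => tevl (tevl (tassoc (w ⊗ m)) a) b)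
      (g := fun w : tens (gdual A) (gdual A) => dual_app (tev w b) a *: m))
      => [||p q].
    + move=> c x y; rewrite tmul_linl tassoc_lin.
      by rewrite (@tevl_lin _ _ _ a c) (@tevl_lin _ _ _ b c).
    + move=> c x y; rewrite (@tev_lin _ _ _ b c) (@dual_app_linl _ _ a c).
      by rewrite scalerDl scalerA.
    + rewrite tassocE !tevlE tevE (linZ (@tevl_lin _ _ _ b)) tevlE.
      by rewrite (linZ (@dual_app_linl _ _ a)) scalerA mulrC.
by rewrite !lcoactionE ractA.
Qed.

Fact lcoaction_counit n : contr_l dual_counit (lcoaction n) = n.
Proof. by have := lcoactionE n (gone A); rewrite ract1. Qed.

Definition lcomodule_of : glcomodule dual_coalgebra :=
  @GLComodule _ dual_coalgebra N lcoaction lcoaction_lin lcoaction_deg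
    lcoaction_coassoc lcoaction_counit.
End LeftCoaction.
End DualCoalgebra.

Record gcategory (k : fieldType) := GCategory {
  gobj :> Type;
  gunder : gobj -> gvect k;
  ghom : forall X Y : gobj, (gunder X -> gunder Y) -> Prop;
  ghom_lin : forall X Y (f : gunder X -> gunder Y), ghom f -> linear f }.
Coercion gunder : gobj >-> gvect.

Definition rcomodule_cat (k : fieldType) (C : gcoalgebra k) : gcategory k :=
  @GCategory k (grcomodule C) (@grc k C) (@rcomodule_map k C)
    (fun X Y f (h : rcomodule_map f) => let: And3 hl _ _ := h in hl).

Definition lcomodule_cat (k : fieldType) (C : gcoalgebra k) : gcategory k :=
  @GCategory k (glcomodule C) (@glc k C) (@lcomodule_map k C)
    (fun X Y f (h : lcomodule_map f) => let: And3 hl _ _ := h in hl).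

Definition bimodule_cat (k : fieldType) (A : galgebra k) : gcategory k :=
  @GCategory k (gbimodule A) (@gbm k A) (fun B B' f => bimodule_map 0 f)
    (fun X Y f (h : bimodule_map 0 f) => let: And4 hl _ _ _ := h in hl).

(* Monomorphisms are taken to be the injective maps, as usual for modules    *)
(* and for comodules over a field.                                          *)
Definition injective_object (k : fieldType) (D : gcategory k) (E : D) : Prop :=
  forall (X Y : D) (i : gunder X -> gunder Y) (f : gunder X -> gunder E),
    ghom i -> injective i -> ghom f ->
    exists g : gunder Y -> gunder E, ghom g /\ forall x, g (i x) = f x.

Record inj_resolution (k : fieldType) (D : gcategory k) (X : D) :=
  InjResolution {
    res :> nat -> D;
    res_aug : gunder X -> gunder (res 0);
    res_d : forall n, gunder (res n) -> gunder (res n.+1);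
    res_aug_hom : ghom res_aug;
    res_d_hom : forall n, ghom (@res_d n);
    res_aug_inj : injective res_aug;
    res_exact0 : forall y, res_d y = 0 <-> exists x, y = res_aug x;
    res_exact : forall n (y : gunder (res n.+1)),
      res_d y = 0 <-> exists x, y = res_d x;
    res_injective : forall n, injective_object (res n) }.

Record res_map (k : fieldType) (D : gcategory k) (X Y : D)
    (R : inj_resolution X) (S : inj_resolution Y) (f : gunder X -> gunder Y) :=
  ResMap {
    rmap : forall n, gunder (R n) -> gunder (S n);
    rmap_hom : forall n, ghom (@rmap n);
    rmap_d : forall n (x : gunder (R n)), rmap (res_d x) = res_d (rmap x);
    rmap_aug : forall x, rmap (res_aug R x) = res_aug S (f x) }.

Section ResolutionTheory.
Variables (k : fieldType) (D : gcategory k) (X : D) (R : inj_resolution X).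

Lemma res_d_lin n : linear (@res_d _ _ _ R n).
Proof. exact/ghom_lin/res_d_hom. Qed.

Lemma res_dd n (x : gunder (R n)) : res_d (res_d x) = 0.
Proof. by apply/res_exact; exists x. Qed.
End ResolutionTheory.

Record cochain_complex (k : fieldType) := CochainComplex {
  cx :> nat -> lmodType k;
  cxd : forall n, cx n -> cx n.+1;
  cxd_lin : forall n, linear (@cxd n);
  cxdd : forall n (x : cx n), cxd (cxd x) = 0 }.

Record cochain_map (k : fieldType) (X Y : cochain_complex k) := CochainMap {
  cmap : forall n, X n -> Y n;
  cmap_lin : forall n, linear (@cmap n);
  cmap_d : forall n (x : X n), cmap (cxd x) = cxd (cmap x) }.

Section Cohomology.
Variables (k : fieldType) (X : cochain_complex k).

Definition coboundary n : X n -> Prop :=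
  match n with
  | 0 => fun x => x = 0
  | m.+1 => fun x => exists y : X m, x = cxd y
  end.

Fact cocycle0 n : cxd (0 : X n) = 0.
Proof. exact: lin0 (@cxd_lin _ X n). Qed.
Fact cocycleP n a (u v : X n) : cxd u = 0 -> cxd v = 0 -> cxd (a *: u + v) = 0.
Proof. by rewrite cxd_lin => -> ->; rewrite scaler0 addr0. Qed.

Definition cocycles n : subspace (X n) := Subspace (@cocycle0 n) (@cocycleP n).

Fact cobound0 n : coboundary (subv_val (0 : subv (cocycles n))).
Proof.
by case: n => [|n] //=; exists 0; rewrite (lin0 (@cxd_lin _ X n)).
Qed.
Fact coboundP n a (u v : subv (cocycles n)) :
  coboundary (subv_val u) -> coboundary (subv_val v) ->
  coboundary (subv_val (a *: u + v)).
Proof.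
have -> : subv_val (a *: u + v) = a *: subv_val u + subv_val v by [].
move: (subv_val u) (subv_val v) => x y {u v}.
case: n x y => [|n] x y /= => [-> ->|[s ->] [t ->]].
  by rewrite scaler0 addr0.
by exists (a *: s + t); rewrite cxd_lin.
Qed.

Definition coboundaries n : subspace (subv (cocycles n)) :=
  @Subspace k (subv (cocycles n)) (fun z => coboundary (subv_val z))
    (@cobound0 n) (@coboundP n).

Definition cohomology n : lmodType k := quotv (coboundaries n).

Definition cohomology_class n (z : subv (cocycles n)) : cohomology n := qcls _ z.
Definition cocycle_of n (c : cohomology n) : subv (cocycles n) := qrepr c.
End Cohomology.

Section CohomologyMap.
Variables (k : fieldType) (X Y : cochain_complex k) (f : cochain_map X Y).

Fact cocycle_map n (z : subv (cocycles X n)) : cocycles Y n (cmap f (subv_val z)).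
Proof. by rewrite /= -cmap_d (subvP z) (lin0 (@cmap_lin _ _ _ f n.+1)). Qed.

Definition cohomology_map n (c : cohomology X n) : cohomology Y n :=
  cohomology_class (subv_of (cocycle_map (cocycle_of c))).

Lemma cohomology_mapE n (z : subv (cocycles X n)) :
  cohomology_map (cohomology_class z) = cohomology_class (subv_of (cocycle_map z)).
Proof.
apply/qclsP.
have h : coboundary (subv_val (qrepr (qcls (coboundaries X n) z)) - subv_val z).
  exact: (qcls_repr (coboundaries X n) z).
change (coboundary (cmap f (subv_val (qrepr (qcls (coboundaries X n) z)))
  - cmap f (subv_val z))).
rewrite -(linB (@cmap_lin _ _ _ f n)); move: (_ - _) h => y {z}.
case: n y => [|n] y /= => [->|[t ->]]; first exact: lin0 (@cmap_lin _ _ _ f 0).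
by exists (cmap f t); rewrite cmap_d.
Qed.
End CohomologyMap.

Definition dprod_type (k : fieldType) (I : Type) (F : I -> lmodType k) : Type :=
  forall i, F i.

Section Product.
Variables (k : fieldType) (I : Type) (F : I -> lmodType k).

HB.instance Definition _ := gen_eqMixin (dprod_type F).
HB.instance Definition _ := gen_choiceMixin (dprod_type F).

Let zero : dprod_type F := fun i => 0.
Let opp (x : dprod_type F) : dprod_type F := fun i => - x i.
Let add (x y : dprod_type F) : dprod_type F := fun i => x i + y i.
Let scale (a : k) (x : dprod_type F) : dprod_type F := fun i => a *: x i.

Fact dprod_addA : associative add.
Proof. by move=> x y z; apply: functional_extensionality_dep => i; apply: addrA. Qed.
Fact dprod_addC : commutative add.
Proof. by move=> x y; apply: functional_extensionality_dep => i; apply: addrC. Qed.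
Fact dprod_add0 : left_id zero add.
Proof. by move=> x; apply: functional_extensionality_dep => i; apply: add0r. Qed.
Fact dprod_addN : left_inverse zero opp add.
Proof. by move=> x; apply: functional_extensionality_dep => i; apply: addNr. Qed.

HB.instance Definition _ := GRing.isZmodule.Build (dprod_type F)
  dprod_addA dprod_addC dprod_add0 dprod_addN.

Fact dprod_scaleA a b x : scale a (scale b x) = scale (a * b) x.
Proof. by apply: functional_extensionality_dep => i; apply: scalerA. Qed.
Fact dprod_scale1 : left_id 1 scale.
Proof. by move=> x; apply: functional_extensionality_dep => i; apply: scale1r. Qed.
Fact dprod_scaleDr : right_distributive scale +%R.
Proof. by move=> a x y; apply: functional_extensionality_dep => i; apply: scalerDr. Qed.
Fact dprod_scaleDl x : {morph scale^~ x : a b / a + b}.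
Proof. by move=> a b; apply: functional_extensionality_dep => i; apply: scalerDl. Qed.

HB.instance Definition _ := GRing.Zmodule_isLmodule.Build k (dprod_type F)
  dprod_scaleA dprod_scale1 dprod_scaleDr dprod_scaleDl.

Definition dprod : lmodType k := dprod_type F.
End Product.

Section Cotensor.
Variables (k : fieldType) (C : gcoalgebra k).

Definition cotensor_mem (X : grcomodule C) (Y : glcomodule C) (x : tens X Y) : Prop :=
  tassoc (tmap (@rcoact k C X) id x) = tmap id (@lcoact k C Y) x.

Section Def.
Variables (X : grcomodule C) (Y : glcomodule C).
Let rl_lin : linear (tmap (@rcoact k C X) (@id Y)) :=
  tmap_lin (@rcoact_lin k C X) (@lin_id _ _).
Let lr_lin : linear (tmap (@id X) (@lcoact k C Y)) :=
  tmap_lin (@lin_id _ _) (@lcoact_lin k C Y).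

Fact cotensor0 : cotensor_mem (0 : tens X Y).
Proof.
by rewrite /cotensor_mem (lin0 rl_lin) (lin0 lr_lin) (lin0 (@tassoc_lin _ _ _ _)).
Qed.
Fact cotensorP a (x y : tens X Y) :
  cotensor_mem x -> cotensor_mem y -> cotensor_mem (a *: x + y).
Proof. by rewrite /cotensor_mem rl_lin lr_lin tassoc_lin => -> ->. Qed.

Definition cotensor : subspace (tens X Y) := Subspace cotensor0 cotensorP.
End Def.

Lemma cotensor_map (X X' : grcomodule C) (Y Y' : glcomodule C)
    (f : X -> X') (g : Y -> Y') x :
  rcomodule_map f -> lcomodule_map g ->
  cotensor X Y x -> cotensor X' Y' (tmap f g x).
Proof.
move=> [hf _ cf] [hg _ cg]; rewrite /= /cotensor_mem => hx.
have hr := @rcoact_lin _ _ X; have hr' := @rcoact_lin _ _ X'.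
have hl := @lcoact_lin _ _ Y; have hl' := @lcoact_lin _ _ Y'.
have hfi := tmap_lin hf (@lin_id _ C); have hig := tmap_lin (@lin_id _ C) hg.
transitivity (tmap f (tmap id g) (tassoc (tmap (@rcoact _ _ X) id x))).
  rewrite -tassoc_nat // !tmap_comp //; congr (tassoc (tmap _ _ x)).
  exact/funext/cf.
rewrite hx !tmap_comp //; congr (tmap _ _ x); apply/esym/funext; exact: cg.
Qed.
End Cotensor.

Section Cotor.
Variables (k : fieldType) (C : gcoalgebra k).
Variables (M : rcomodule_cat C) (N : lcomodule_cat C).
Variables (I : inj_resolution M) (J : inj_resolution N).

(* The degree [p] part of the total complex of I □_C J: the families        *)
(* x i j in (I i □_C J j)^p that vanish unless i + j = n.                   *)
Notation T := (dprod (fun i => dprod (fun j => tens (gunder (I i)) (gunder (J j))))).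

Definition tot_mem (p : int) (n : nat) (x : T) : Prop := forall i j,
  [/\ cotensor (I i) (J j) (x i j),
      homog (V := gtens (gunder (I i)) (gunder (J j))) p (x i j)
    & (i + j)%N != n -> x i j = 0].

Definition tot_dl (x : T) : T := fun i j =>
  match i with
  | 0 => 0
  | i'.+1 => tmap (@res_d _ _ _ I i') id (x i' j)
  end.

Definition tot_dr (x : T) : T := fun i j =>
  match j with
  | 0 => 0
  | j'.+1 => tmap id (@res_d _ _ _ J j') (x i j')
  end.

Definition tot_d (x : T) : T := fun i j =>
  tot_dl x i j + ((-1) ^+ i : k) *: tot_dr x i j.

Let dI_lin i j : linear (tmap (@res_d _ _ _ I i) (@id (gunder (J j)))) :=
  tmap_lin (@res_d_lin _ _ _ I i) (@lin_id _ (gunder (J j))).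
Let dJ_lin i j : linear (tmap (@id (gunder (I i))) (@res_d _ _ _ J j)) :=
  tmap_lin (@lin_id _ (gunder (I i))) (@res_d_lin _ _ _ J j).

Fact tot_dl_lin : linear tot_dl.
Proof.
move=> a x y; apply: functional_extensionality_dep => -[|i];
  apply: functional_extensionality_dep => j.
- by change (0 = a *: 0 + 0 :> tens (gunder (I 0)) (gunder (J j)));
    rewrite scaler0 addr0.
- exact: dI_lin.
Qed.

Fact tot_dr_lin : linear tot_dr.
Proof.
move=> a x y; apply: functional_extensionality_dep => i;
  apply: functional_extensionality_dep => -[|j].
- by change (0 = a *: 0 + 0 :> tens (gunder (I i)) (gunder (J 0)));
    rewrite scaler0 addr0.
- exact: dJ_lin.
Qed.

Fact tot_d_lin : linear tot_d.
Proof.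
move=> a x y; apply: functional_extensionality_dep => i;
  apply: functional_extensionality_dep => j.
rewrite /tot_d tot_dl_lin tot_dr_lin.
change (a *: tot_dl x i j + tot_dl y i j +
    (-1) ^+ i *: (a *: tot_dr x i j + tot_dr y i j) =
  a *: (tot_dl x i j + (-1) ^+ i *: tot_dr x i j) +
    (tot_dl y i j + (-1) ^+ i *: tot_dr y i j)).
by rewrite !scalerDr !scalerA [a * _]mulrC addrACA.
Qed.

Fact tot_dd x : tot_d (tot_d x) = 0.
Proof.
have dI0 i j y : tmap (@res_d _ _ _ I i.+1) (@id (gunder (J j)))
    (tmap (@res_d _ _ _ I i) id y) = 0.
  rewrite tmap_comp //; try exact: res_d_lin.
  by apply: tmap0l => // v; apply: res_dd.
have dJ0 i j y : tmap (@id (gunder (I i))) (@res_d _ _ _ J j.+1)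
    (tmap id (@res_d _ _ _ J j) y) = 0.
  rewrite tmap_comp //; try exact: res_d_lin.
  by apply: tmap0r => // v; apply: res_dd.
have dIJ i j y : tmap (@res_d _ _ _ I i) id (tmap id (@res_d _ _ _ J j) y) =
    tmap id (@res_d _ _ _ J j) (tmap (@res_d _ _ _ I i) id y).
  by rewrite !tmap_comp //; exact: res_d_lin.
apply: functional_extensionality_dep => i; apply: functional_extensionality_dep => j.
change (tot_d (tot_d x) i j = 0); rewrite /tot_d.
case: i => [|[|i]]; case: j => [|[|j]]; rewrite /= ?(linD (@dI_lin _ _))
  ?(linD (@dJ_lin _ _)) ?(linZ (@dI_lin _ _)) ?(linZ (@dJ_lin _ _))
  ?(lin0 (@dI_lin _ _)) ?(lin0 (@dJ_lin _ _)) ?dI0 ?dJ0 ?dIJ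
  ?scaler0 ?addr0 ?add0r ?scaler0 ?addr0 //.
all: by rewrite ?exprS ?expr0 ?mulr1 ?mulN1r ?opprK ?scaleNr ?scale1r ?subrr ?addNr.
Qed.

Section Degree.
Variable p : int.

Fact tot_mem0 n : tot_mem p n 0.
Proof.
by move=> i j; split=> //; [exact: subspace0|exact: homog0].
Qed.
Fact tot_memP n a x y : tot_mem p n x -> tot_mem p n y -> tot_mem p n (a *: x + y).
Proof.
move=> hx hy i j; have [x1 x2 x3] := hx i j; have [y1 y2 y3] := hy i j.
have -> : (a *: x + y) i j = a *: x i j + y i j by [].
split; [exact: subspaceP|exact: homogP|].
by move=> ijn; rewrite x3 // y3 // scaler0 addr0.
Qed.
Definition tot_sub n : subspace T := Subspace (@tot_mem0 n) (@tot_memP n).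

Fact tot_d_mem n x : tot_sub n x -> tot_sub n.+1 (tot_d x).
Proof.
move=> hx i j.
have h0 i' j' : cotensor (I i') (J j') 0 /\
    homog (V := gtens (gunder (I i')) (gunder (J j'))) p 0.
  by split; [exact: (subspace0 (cotensor (I i') (J j')))|exact: homog0].
have [l1 [l2 l3]] : cotensor (I i) (J j) (tot_dl x i j) /\
    homog (V := gtens (gunder (I i)) (gunder (J j))) p (tot_dl x i j) /\
    ((i + j)%N != n.+1 -> tot_dl x i j = 0).
  case: i => [|i]; first by have [? ?] := h0 0 j.
  have [x1 x2 x3] := hx i j; have hd := @res_d_hom _ _ _ I i.
  split; first exact: cotensor_map hd (lcomodule_map_id _) x1.
  have [hl dl _] := hd; split.
    have := tmap_deg hl (@lin_id _ _) dl (@deg_map_id _ (gunder (J j))) x2.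
    by rewrite addr0.
  by rewrite addSn eqSS => /x3 e; rewrite /= e; apply: lin0 (@dI_lin _ _).
have [r1 [r2 r3]] : cotensor (I i) (J j) (tot_dr x i j) /\
    homog (V := gtens (gunder (I i)) (gunder (J j))) p (tot_dr x i j) /\
    ((i + j)%N != n.+1 -> tot_dr x i j = 0).
  case: j {l1 l2 l3} => [|j]; first by have [? ?] := h0 i 0.
  have [x1 x2 x3] := hx i j; have hd := @res_d_hom _ _ _ J j.
  split; first exact: cotensor_map (rcomodule_map_id _) hd x1.
  have [hl dl _] := hd; split.
    have := tmap_deg (@lin_id _ _) hl (@deg_map_id _ (gunder (I i))) dl x2.
    by rewrite addr0.
  by rewrite addnS eqSS => /x3 e; rewrite /= e; apply: lin0 (@dJ_lin _ _).
rewrite /tot_d; split.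
- by apply: subspaceD => //; apply: subspaceZ.
- by apply: homogD => //; apply: homogZ.
- by move=> ij; rewrite l3 // r3 // scaler0 addr0.
Qed.

Definition tot_diff n (x : subv (tot_sub n)) : subv (tot_sub n.+1) :=
  subv_of (tot_d_mem (subvP x)).

Fact tot_diff_lin n : linear (@tot_diff n).
Proof. by move=> a x y; apply: val_inj; apply: tot_d_lin. Qed.

Fact tot_diff_diff n (x : subv (tot_sub n)) : tot_diff (tot_diff x) = 0.
Proof. by apply: val_inj; apply: tot_dd. Qed.

Definition tot_complex : cochain_complex k :=
  @CochainComplex k (fun n => subv (tot_sub n)) tot_diff tot_diff_lin tot_diff_diff.
End Degree.

(* The degree [p] part of Cotor_C^n(M, N).                                  *)
Definition Cotor (n : nat) (p : int) : lmodType k := cohomology (tot_complex p) n.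
End Cotor.

Section CotorMap.
Variables (k : fieldType) (C : gcoalgebra k).
Variables (M M' : rcomodule_cat C) (N N' : lcomodule_cat C).
Variables (I : inj_resolution M) (J : inj_resolution N).
Variables (I' : inj_resolution M') (J' : inj_resolution N').
Variables (f : gunder M -> gunder M') (g : gunder N -> gunder N').
Variables (u : res_map I I' f) (v : res_map J J' g) (p : int).

Notation T := (dprod (fun i => dprod (fun j => tens (gunder (I i)) (gunder (J j))))).
Notation T' :=
  (dprod (fun i => dprod (fun j => tens (gunder (I' i)) (gunder (J' j))))).

Let u_lin i : linear (@rmap _ _ _ _ _ _ _ u i).
Proof. exact/ghom_lin/rmap_hom. Qed.
Let v_lin j : linear (@rmap _ _ _ _ _ _ _ v j).
Proof. exact/ghom_lin/rmap_hom. Qed.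

Definition tot_mapv (x : T) : T' := fun i j =>
  tmap (@rmap _ _ _ _ _ _ _ u i) (@rmap _ _ _ _ _ _ _ v j) (x i j).

Let uv_lin i j := tmap_lin (@u_lin i) (@v_lin j).

Fact tot_mapv_mem n x : tot_sub I J p n x -> tot_sub I' J' p n (tot_mapv x).
Proof.
move=> hx i j; have [x1 x2 x3] := hx i j.
have hu := @rmap_hom _ _ _ _ _ _ _ u i; have hv := @rmap_hom _ _ _ _ _ _ _ v j.
split; first exact: cotensor_map hu hv x1.
  have [hul hud _] := hu; have [hvl hvd _] := hv.
  by have := tmap_deg hul hvl hud hvd x2; rewrite addr0.
by move/x3 => e; rewrite /tot_mapv e; apply: lin0 (@uv_lin i j).
Qed.

Definition tot_mapn n (x : tot_complex I J p n) : tot_complex I' J' p n :=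
  subv_of (tot_mapv_mem (subvP x)).

Fact tot_mapn_lin n : linear (@tot_mapn n).
Proof.
move=> a x y; apply: val_inj; apply: functional_extensionality_dep => i.
by apply: functional_extensionality_dep => j; apply: uv_lin.
Qed.

Fact tot_mapn_d n (x : tot_complex I J p n) :
  tot_mapn (cxd x) = cxd (tot_mapn x).
Proof.
apply: val_inj; apply: functional_extensionality_dep => i.
apply: functional_extensionality_dep => j.
change (tot_mapv (tot_d (subv_val x)) i j = tot_d (tot_mapv (subv_val x)) i j).
move: (subv_val x) => y; rewrite /tot_d {1}/tot_mapv (linD (@uv_lin i j)).
rewrite (linZ (@uv_lin i j)); congr (_ + _ *: _).
  case: i => [|i]; first exact: lin0 (@uv_lin 0 j).
  have du := @res_d_lin _ _ _ I i; have du' := @res_d_lin _ _ _ I' i.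
  have ui := @u_lin i; have ui' := @u_lin i.+1; have vj := @v_lin j.
  rewrite [LHS]tmap_comp // [RHS]tmap_comp //.
  congr (tmap _ _ _); apply/funext => z; exact: (@rmap_d _ _ _ _ _ _ _ u i z).
case: j => [|j]; first exact: lin0 (@uv_lin i 0).
have dv := @res_d_lin _ _ _ J j; have dv' := @res_d_lin _ _ _ J' j.
have vj := @v_lin j; have vj' := @v_lin j.+1; have ui := @u_lin i.
rewrite [LHS]tmap_comp // [RHS]tmap_comp //.
congr (tmap _ _ _); apply/funext => z; exact: (@rmap_d _ _ _ _ _ _ _ v j z).
Qed.

Definition tot_map : cochain_map (tot_complex I J p) (tot_complex I' J' p) :=
  CochainMap tot_mapn_lin tot_mapn_d.

Definition Cotor_map n : Cotor I J n p -> Cotor I' J' n p :=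
  @cohomology_map _ _ _ tot_map n.
End CotorMap.

Section BimoduleHom.
Variables (k : fieldType) (A : galgebra k).

Section Space.
Variables (B B' : gbimodule A) (p : int).

Fact bimodule_map0 : bimodule_map p (0 : B -> B').
Proof.
split=> [a x y|i x _|i a x _|x a].
- by rewrite /= scaler0 addr0.
- exact: homog0.
- by rewrite (lin0 ((blact_bil B').2 a)) scaler0.
- by rewrite (lin0 ((bract_bil B').1 a)).
Qed.

Fact bimodule_mapP c (f g : B -> B') :
  bimodule_map p f -> bimodule_map p g -> bimodule_map p (c *: f + g).
Proof.
move=> [fl fd fa fr] [gl gd ga gr].
have E x : (c *: f + g) x = c *: f x + g x by [].
split=> [a x y|i x hx|i a x ha|x a]; rewrite !E.
- by rewrite fl gl !scalerDr !scalerA [a * c]mulrC addrACA.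
- by apply: homogP; [apply: fd|apply: gd].
- rewrite (fa i) // (ga i) // ((blact_bil B').2 a) scalerDr !scalerA.
  by rewrite [c * _]mulrC.
- by rewrite fr gr ((bract_bil B').1 a).
Qed.

Definition bimodule_hom : subspace (B -> B') :=
  Subspace bimodule_map0 bimodule_mapP.
End Space.

Lemma bimodule_map_comp (B B' B'' : gbimodule A) p (f : B' -> B'') (g : B -> B') :
  bimodule_map 0 f -> bimodule_map p g -> bimodule_map p (f \o g).
Proof.
move=> [fl fd fa fr] [gl gd ga gr]; split.
- exact: lin_comp.
- by rewrite -[p]add0r; apply: deg_map_comp.
- by move=> i a x ha /=; rewrite (ga i) // (linZ fl) (fa i) // mul0r scale1r.
- by move=> x a /=; rewrite gr fr.
Qed.
End BimoduleHom.

Section Hochschild.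
Variables (k : fieldType) (A : galgebra k).
Notation Hom B p := (subv (bimodule_hom (regular_bimodule A) B p)).

Section HomMap.
Variables (B B' : gbimodule A) (f : B -> B') (p : int).
Hypothesis hf : bimodule_map 0 f.

Definition bimodule_hom_map (h : Hom B p) : Hom B' p :=
  @subv_of _ _ (bimodule_hom _ _ p) (f \o subv_val h)
    (bimodule_map_comp hf (subvP h)).

Fact bimodule_hom_map_lin : linear bimodule_hom_map.
Proof.
have [fl _ _ _] := hf.
by move=> a x y; apply: val_inj; apply/funext => b; apply: fl.
Qed.
End HomMap.

Section Complex.
Variables (B : bimodule_cat A) (K : inj_resolution B) (p : int).

(* The degree [p] part of Hom_{A^e}(A, K).                                  *)
Definition hoch_diff n : Hom (K n) p -> Hom (K n.+1) p :=
  bimodule_hom_map (@res_d_hom _ _ _ K n).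

Fact hoch_diff_diff n (h : Hom (K n) p) : hoch_diff (hoch_diff h) = 0.
Proof. by apply: val_inj; apply/funext => a; apply: (@res_dd _ _ _ K n). Qed.

Definition hoch_complex : cochain_complex k :=
  @CochainComplex k (fun n => Hom (K n) p) hoch_diff
    (fun n => bimodule_hom_map_lin (@res_d_hom _ _ _ K n)) hoch_diff_diff.

(* The degree [p] part of H_gr^n(A, B).                                     *)
Definition Hgr (n : nat) : lmodType k := cohomology hoch_complex n.
End Complex.

Section Map.
Variables (B B' : bimodule_cat A) (f : gunder B -> gunder B').
Variables (K : inj_resolution B) (K' : inj_resolution B') (w : res_map K K' f).
Variable p : int.

Definition hoch_mapn n : Hom (K n) p -> Hom (K' n) p :=
  bimodule_hom_map (@rmap_hom _ _ _ _ _ _ _ w n).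

Fact hoch_mapn_d n (h : hoch_complex K p n) :
  hoch_mapn (cxd h : hoch_complex K p n.+1) =
  @cxd _ (hoch_complex K' p) n (hoch_mapn h).
Proof. by apply: val_inj; apply/funext => a; apply: (@rmap_d _ _ _ _ _ _ _ w n). Qed.

Definition hoch_map : cochain_map (hoch_complex K p) (hoch_complex K' p) :=
  @CochainMap k (hoch_complex K p) (hoch_complex K' p) hoch_mapn
    (fun n => bimodule_hom_map_lin (@rmap_hom _ _ _ _ _ _ _ w n)) hoch_mapn_d.

Definition Hgr_map n : Hgr K p n -> Hgr K' p n :=
  @cohomology_map _ _ _ hoch_map n.
End Map.
End Hochschild.

Definition rcomodule_resolution (k : fieldType) (A : galgebra k)
    (A0 : nonneg_graded A) (Aft : finite_type A)
    (M : glmodule A) (Mb : bounded_above M) :=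
  @inj_resolution k (rcomodule_cat (dual_coalgebra A0 Aft)) (rcomodule_of A0 Aft Mb).

Definition lcomodule_resolution (k : fieldType) (A : galgebra k)
    (A0 : nonneg_graded A) (Aft : finite_type A)
    (N : grmodule A) (Nb : bounded_above N) :=
  @inj_resolution k (lcomodule_cat (dual_coalgebra A0 Aft)) (lcomodule_of A0 Aft Nb).

Definition bimodule_resolution (k : fieldType) (A : galgebra k) (B : gbimodule A) :=
  @inj_resolution k (bimodule_cat A) B.

(* Main.v *)
(** A right C-comodule is a left A-module with the same underlying space, and
    under this dictionary the degree p part of X □_C Y is, up to signs, the
    space of bimodule maps A -> X ⊗ Y of degree p.  Over a field the total
    complex of I ⊗ J is a resolution of M ⊗ N by bimodules, so the identity of
    M ⊗ N lifts to a chain map from it to K; applying Hom(A, -) gives a map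
    Cotor -> H_gr, and the comparison theorem makes it natural.  Every injective
    resolution of M is homotopy equivalent to a cofree one, with terms V ⊗ C for
    bounded above V.  For cofree I and J the terms of I ⊗ J are sums of
    V ⊗ C ⊗ C ⊗ W; since A is nonnegatively graded of finite type and V, W are
    bounded above, this is the coinduced bimodule Hom(A ⊗ A, V ⊗ W).  Then I ⊗ J
    is itself an injective resolution of M ⊗ N, hence homotopy equivalent to K. *)

From mathcomp Require Import all_boot all_order all_algebra.
From mathcomp Require Import boolp classical_sets.
From mathcomp Require Import zify.
Require Import Defs.

Set Implicit Arguments.
Unset Strict Implicit.
Unset Printing Implicit Defensive.

Import Order.TTheory GRing.Theory Num.Theory.

Local Open Scope ring_scope.

(** * Linear algebra over a field *)

(** The resolutions [I], [J], [K] are arbitrary, and only [K] is known to consist of injective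
    bimodules. This fixes the direction of the map: a chain map can be built from the exact complex
    [I ⊗ J] to [K], but in general not back. Bijectivity is therefore never checked directly for
    given [I] and [J]. It is proved when the terms of [I ⊗ J] are injective, and naturality itself,
    applied to the identities of [M] and [N] with different resolutions on the two sides, carries it
    over to all [I] and [J]. The cofree terms stay bounded above because [C] lives in degrees at
    most 0. The bound is what makes tensors suffice: the bimodule map defined by a linear [g] sends
    [y] to the bilinear map taking [a], [b] to [g (a y b)], and such a map comes from a tensor in V
    ⊗ C ⊗ C ⊗ W only if it vanishes outside finitely many degrees of [a] and [b]. On cochains the
    identification is evaluation at 1: a degree [p] bimodule map out of [A] is the same as its value
    at 1, on which the left and right actions agree up to sign. *)

Lemma lin_zero (k : fieldType) (V W : lmodType k) : linear (fun _ : V => 0 : W).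
Proof. by move=> a u v; rewrite scaler0 addr0. Qed.

Lemma lin_comb (k : fieldType) (V W : lmodType k) a (f g : V -> W) :
  linear f -> linear g -> linear (fun x => a *: f x + g x).
Proof.
by move=> hf hg b u v; rewrite hf hg !scalerDr !scalerA [b * a]mulrC addrACA.
Qed.

Lemma lin_sub (k : fieldType) (V W : lmodType k) (f g : V -> W) :
  linear f -> linear g -> linear (fun x => f x - g x).
Proof. by move=> hf hg a u v; rewrite hf hg scalerBr opprD addrACA. Qed.

(* Zorn's lemma for the linear functional graphs that contain all the pairs  *)
(* (i v, f v); that common part is left out of the sets, so that the empty   *)
(* chain has an upper bound.                                                 *)
Lemma linear_extension (k : fieldType) (V W U : lmodType k)
    (i : V -> W) (f : V -> U) :
  linear i -> linear f -> (forall v, i v = 0 -> f v = 0) ->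
  exists g : W -> U, linear g /\ forall v, g (i v) = f v.
Proof.
move=> hi hf hk.
pose H (G : set (W * U)) (z : W * U) := G z \/ exists v, z = (i v, f v).
pose P G := (forall a y z, H G y -> H G z -> H G (a *: y + z)) /\
  (forall u, H G (0, u) -> u = 0).
have cGr G a y z : (exists v, y = (i v, f v)) -> (exists v, z = (i v, f v)) ->
    H G (a *: y + z).
  move=> [v ->] [w ->]; right; exists (a *: v + w); rewrite hi hf.
  by congr (_, _).
have fGr u v : (0, u) = (i v, f v) -> u = 0 by case=> /esym/hk <- ->.
case: (@Zorn_bigcup _ P).
  move=> F FP Ft; split=> [a y z|u].
    have up z' X : F X -> H X z' -> H (\bigcup_(X in F) X)%classic z'.
      by move=> FX [Xz|?]; [left; exists X|right].
    case=> [[X FX Xy]|gy] [[Y FY Yz]|gz].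
    - have [XY|YX] := Ft X Y FX FY.
        by apply: (up _ Y FY); apply: (FP _ FY).1; left=> //; apply: XY.
      by apply: (up _ X FX); apply: (FP _ FX).1; left=> //; apply: YX.
    - by apply: (up _ X FX); apply: (FP _ FX).1; [left|right].
    - by apply: (up _ Y FY); apply: (FP _ FY).1; [right|left].
    - exact: cGr.
  case=> [[X FX Xu]|[v /fGr //]].
  by apply: (FP _ FX).2; left.
move=> A [[Al Af] Amax].
have A0 : H A (0, 0) by right; exists 0; rewrite (lin0 hi) (lin0 hf).
have AZ a w u : H A (w, u) -> H A (a *: w, a *: u).
  by move=> h; have := Al a _ _ h A0; rewrite (addr0 (a *: (w, u) : W * U)).
have AD w u w' u' : H A (w, u) -> H A (w', u') -> H A (w + w', u + u').
  by move=> h h'; have := Al 1 _ _ h h'; rewrite scale1r.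
have Ainj w u u' : H A (w, u) -> H A (w, u') -> u = u'.
  move=> h h'; apply/eqP; rewrite -subr_eq0; apply/eqP/Af.
  have := AD _ _ _ _ h (AZ (-1) _ _ h').
  by rewrite !scaleN1r subrr.
have Atot w : exists u, H A (w, u).
  (* If [w] lies outside the domain of the maximal graph, [B] extends that graph by giving [w] the
     value 0, against maximality. *)
  apply: contrapT => nw; pose B z := exists c w' u, H A (w', u) /\ z = (w' + c *: w, u).
  have HB z : H B z -> B z.
    case=> // -[v ->]; exists 0, (i v), (f v); rewrite scale0r addr0.
    by split=> //; right; exists v.
  apply: (Amax B).
    split=> [[w' u] Az|BA].
      by exists 0, w', u; rewrite scale0r addr0; split=> //; left.
    apply: nw; exists 0; left; apply: BA.
    by exists 1, 0, 0; rewrite add0r scale1r.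
  split=> [a y z /HB[c [w1 [u1 [h1 ->]]]] /HB[d [w2 [u2 [h2 ->]]]]|u /HB].
    left; exists (a * c + d), (a *: w1 + w2), (a *: u1 + u2); split.
      exact: AD (AZ a _ _ h1) h2.
    congr (_, _); rewrite /= scalerDr scalerDl scalerA addrACA //.
  move=> [c [w' [u' [h [e ->]]]]].
  have [c0|c0] := eqVneq c 0.
    by move: e; rewrite c0 scale0r addr0 => w0; apply: Af; rewrite w0.
  case: nw; exists ((- c^-1) *: u').
  have -> : w = (- c^-1) *: w'.
    have -> : w' = - (c *: w) by apply/eqP; rewrite -addr_eq0 -e.
    by rewrite scaleNr scalerN opprK scalerA mulVf // scale1r.
  exact: AZ.
pose g w := sval (cid (Atot w)).
have gP w : H A (w, g w) by rewrite /g; case: cid.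
exists g; split=> [a u v|v].
  by apply: Ainj (gP _) _; apply: AD => //; apply: AZ.
by apply: Ainj (gP _) _; right; exists v.
Qed.

Lemma linear_retraction (k : fieldType) (V W : lmodType k) (i : V -> W) :
  linear i -> injective i -> exists r : W -> V, linear r /\ cancel i r.
Proof.
move=> hi ii; apply: linear_extension => // v e.
by apply: ii; rewrite e (lin0 hi).
Qed.

(** With [r] a projection onto the kernel of [f], the vector [v - r v] depends only on [f v];
    extending this dependence to all of [W] gives [g]. *)
Lemma linear_pinv (k : fieldType) (V W : lmodType k) (f : V -> W) : linear f ->
  exists g : W -> V, linear g /\ forall v, f (g (f v)) = f v.
Proof.
move=> hf.
have k0 : f 0 = 0 by exact: lin0.
have kP a u v : f u = 0 -> f v = 0 -> f (a *: u + v) = 0.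
  by rewrite hf => -> ->; rewrite scaler0 addr0.
pose K := Subspace k0 kP.
have [r [hr rK]] : exists r : V -> subv K, linear r /\ cancel (@subv_val _ _ K) r.
  apply: linear_retraction => //; exact: val_inj.
have hh : linear (fun v => v - subv_val (r v)).
  by apply: lin_sub => // a u v; rewrite hr.
have [|g [hg gE]] := linear_extension hf hh.
  by move=> v fv; rewrite -[v]/(subv_val (subv_of (S := K) fv)) rK subrr.
exists g; split=> // v; rewrite gE (linB hf) [f (subv_val _)](subvP (r v)).
by rewrite subr0.
Qed.

(** * Comparison of injective resolutions *)

Section Contraction.
Variables (k : fieldType) (D : gcategory k) (X : D) (R : inj_resolution X).
Let d n := @res_d _ _ _ R n.
Let d_lin n : linear (@d n) := @res_d_lin _ _ _ R n.
Let aug := res_aug R.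
Let aug_lin : linear aug := ghom_lin (res_aug_hom R).

(** Over a field an exact complex splits. With [g] a pseudo-inverse of each differential,
    [x - g (d x)] is a cocycle, hence a boundary, and [g] picks a preimage of it. The contraction is
    merely linear: it respects neither degrees nor the structure of [D], which is enough to prove
    exactness. *)
Lemma resolution_contraction :
  exists (r : gunder (R 0) -> gunder X)
    (s : forall n, gunder (R n.+1) -> gunder (R n)),
  [/\ linear r, forall n, linear (s n), cancel aug r,
      forall x, s 0 (d x) = x - aug (r x)
    & forall n x, s n.+1 (d x) = x - d (s n x)].
Proof.
have [r [hr rK]] := linear_retraction aug_lin (@res_aug_inj _ _ _ R).
have g0 n := cid (linear_pinv (@d_lin n)).
pose g n := sval (g0 n); have hg n : linear (g n) := (svalP (g0 n)).1.
have gE n x : d (g n (d x)) = d x := (svalP (g0 n)).2 x.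
pose s n x := g n (x - g n.+1 (d x)).
pose r' x := r (x - g 0 (d x)).
exists r', s; split.
- apply: (lin_comp hr); apply: lin_sub => //; exact: lin_comp (hg 0) (d_lin (n := 0)).
- move=> n; apply: (lin_comp (hg n)); apply: lin_sub => //.
  exact: lin_comp (hg n.+1) (d_lin (n := n.+1)).
- move=> x; rewrite /r' /d.
  have -> : res_d (res_aug R x) = 0 by apply/res_exact0; exists x.
  by rewrite (lin0 (hg 0)) subr0 rK.
- move=> x; have [y ey] : exists y, x - g 0 (d x) = aug y.
    by apply/res_exact0; rewrite -/(@d 0 _) (linB (d_lin (n := 0))) gE subrr.
  rewrite /s /r' ey rK -ey opprB addrCA subrr addr0.
  by rewrite /d res_dd (lin0 (hg 1)) subr0.
- move=> n x; have [y ey] : exists y, x - g n.+1 (d x) = d y.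
    by apply/res_exact; rewrite -/(@d n.+1 _) (linB (d_lin (n := n.+1))) gE subrr.
  rewrite /s ey gE -ey opprB addrCA subrr addr0.
  by rewrite /d res_dd (lin0 (hg n.+2)) subr0.
Qed.
End Contraction.

(** All that the comparison theorem uses, so that it is proved once for right comodules, left
    comodules and bimodules. [cat_factor] merges injectivity of [E] with the existence of the
    quotient by the kernel of [d], which need not be injective. *)
Record exact_cat (k : fieldType) (D : gcategory k) : Prop := ExactCat {
  cat_id : forall X : D, ghom (@id (gunder X));
  cat_comp : forall (X Y Z : D) (f : gunder Y -> gunder Z) (g : gunder X -> gunder Y),
    ghom f -> ghom g -> ghom (f \o g);
  cat_comb : forall (X Y : D) a (f g : gunder X -> gunder Y),
    ghom f -> ghom g -> ghom (fun x => a *: f x + g x);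
  cat_factor : forall (X Y E : D) (d : gunder X -> gunder Y)
    (f : gunder X -> gunder E), injective_object E -> ghom d -> ghom f ->
    (forall x, d x = 0 -> f x = 0) ->
    exists g : gunder Y -> gunder E, ghom g /\ forall x, g (d x) = f x }.

(* For unbounded I and J the terms of I ⊗ J need not be injective, so the    *)
(* source of a comparison map is only required to be exact.                 *)
Record exact_res (k : fieldType) (D : gcategory k) (X : D) := ExactRes {
  er :> nat -> D;
  er_aug : gunder X -> gunder (er 0);
  er_d : forall n, gunder (er n) -> gunder (er n.+1);
  er_aug_hom : ghom er_aug;
  er_d_hom : forall n, ghom (@er_d n);
  er_aug_inj : injective er_aug;
  er_exact0 : forall y, er_d y = 0 <-> exists x, y = er_aug x;
  er_exact : forall n (y : gunder (er n.+1)), er_d y = 0 <-> exists x, y = er_d x }.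

Definition er_of (k : fieldType) (D : gcategory k) (X : D) (R : inj_resolution X) :
    exact_res X :=
  ExactRes (res_aug_hom R) (@res_d_hom _ _ _ R) (@res_aug_inj _ _ _ R)
    (@res_exact0 _ _ _ R) (@res_exact _ _ _ R).

Section Comparison.
Variables (k : fieldType) (D : gcategory k) (Dx : exact_cat D).
Variables (X Y : D) (R : exact_res X) (S : inj_resolution Y).

Let augS_lin : linear (res_aug S) := ghom_lin (res_aug_hom S).
Let augR_lin : linear (er_aug R) := ghom_lin (er_aug_hom R).
Let dS_lin n : linear (@res_d _ _ _ S n) := @res_d_lin _ _ _ S n.

Lemma cat_sub (Z W : D) (f g : gunder Z -> gunder W) :
  ghom f -> ghom g -> ghom (fun x => f x - g x).
Proof.
move=> hf hg; have := cat_comb Dx (-1) hg hf; congr ghom.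
by apply/funext => x; rewrite scaleN1r addrC.
Qed.

Section Lift.
Variable f : gunder X -> gunder Y.
Hypothesis hf : ghom f.

(** The second clause is the invariant of the recursion: [res_d] after [h] must vanish on the kernel
    of [er_d] for [cat_factor] to produce the next map. *)
Let good n (h : gunder (R n) -> gunder (S n)) :=
  ghom h /\ forall x, er_d x = 0 -> res_d (h x) = 0.

Let lift0 : exists h : gunder (R 0) -> gunder (S 0),
  good h /\ forall x, h (er_aug R x) = res_aug S (f x).
Proof.
have [|h [hh hE]] := cat_factor Dx (@res_injective _ _ _ S 0) (er_aug_hom R)
  (cat_comp Dx (res_aug_hom S) hf).
  move=> x x0 /=; have -> : x = 0.
    by apply: (@er_aug_inj _ _ _ R); rewrite x0 (lin0 augR_lin).
  by rewrite (lin0 (ghom_lin hf)) (lin0 augS_lin).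
exists h; split=> //; split=> // x /er_exact0[y ->].
by rewrite hE; apply/res_exact0; exists (f y).
Qed.

Let liftS n (h : gunder (R n) -> gunder (S n)) : good h ->
  exists h' : gunder (R n.+1) -> gunder (S n.+1),
    good h' /\ forall x, h' (er_d x) = res_d (h x).
Proof.
move=> [hh hk].
have [h' [hh' hE]] := cat_factor Dx (@res_injective _ _ _ S n.+1) (@er_d_hom _ _ _ R n)
  (cat_comp Dx (@res_d_hom _ _ _ S n) hh) hk.
by exists h'; split=> //; split=> // x /er_exact[y ->]; rewrite hE res_dd.
Qed.

Lemma comparison : exists h : forall n, gunder (R n) -> gunder (S n),
  [/\ forall n, ghom (h n), forall n x, h n.+1 (er_d x) = res_d (h n x)
    & forall x, h 0 (er_aug R x) = res_aug S (f x)].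
Proof.
have [h0 [g0 e0]] := lift0.
pose step n (p : {h | @good n h}) := cid (liftS (svalP p)).
pose hs := fix hs n : {h | @good n h} := match n with
  | 0 => exist _ h0 g0
  | m.+1 => exist _ (sval (step m (hs m))) (svalP (step m (hs m))).1 end.
exists (fun n => sval (hs n)); split=> [n|n x|] //; first by case: (svalP (hs n)).
exact: (svalP (step n (hs n))).2.
Qed.
End Lift.

(** The map [h n.+1] minus [res_d] after [s n] vanishes on the boundaries, which are the kernel of
    the next [er_d], so it factors through [er_d]; the factor is [s n.+1]. *)
Lemma comparison_homotopy (h : forall n, gunder (R n) -> gunder (S n)) :
  (forall n, ghom (h n)) -> (forall n x, h n.+1 (er_d x) = res_d (h n x)) ->
  (forall x, h 0 (er_aug R x) = 0) ->
  exists s : forall n, gunder (R n.+1) -> gunder (S n),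
  [/\ forall n, ghom (s n), forall x, h 0 x = s 0 (er_d x)
    & forall n x, h n.+1 x = res_d (s n x) + s n.+1 (er_d x)].
Proof.
move=> hh hd h0.
(* The second clause says that the error left by [s] is a cocycle; this is what makes the next
   difference vanish on boundaries. *)
pose good n (s : gunder (R n.+1) -> gunder (S n)) :=
  ghom s /\ forall x, res_d (h n x - s (er_d x)) = 0.
have [|s0 [hs0 s0E]] := cat_factor Dx (@res_injective _ _ _ S 0) (@er_d_hom _ _ _ R 0)
  (hh 0).
  by move=> x /er_exact0[y ->].
have g0 : good 0 s0 by split=> // x; rewrite s0E subrr (lin0 (dS_lin (n := 0))).
have stepP n (s : gunder (R n.+1) -> gunder (S n)) : good n s -> exists s',
    good n.+1 s' /\ forall x, h n.+1 x = res_d (s x) + s' (er_d x).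
  move=> [hs sk].
  have hu := cat_sub (hh n.+1) (cat_comp Dx (@res_d_hom _ _ _ S n) hs).
  have [|s' [hs' sE]] := cat_factor Dx (@res_injective _ _ _ S n.+1)
      (@er_d_hom _ _ _ R n.+1) hu.
    move=> x /er_exact[y ->] /=.
    by rewrite hd -(linB (dS_lin (n := n))) sk.
  have E x : h n.+1 x = res_d (s x) + s' (er_d x) by rewrite sE /= addrC subrK.
  by exists s'; split=> //; split=> // x; rewrite E addrK res_dd.
pose step n (p : {s | @good n s}) := cid (stepP n _ (svalP p)).
pose ss := fix ss n : {s | @good n s} := match n with
  | 0 => exist _ s0 g0
  | m.+1 => exist _ (sval (step m (ss m))) (svalP (step m (ss m))).1 end.
exists (fun n => sval (ss n)); split=> [n|x|n x]; first by case: (svalP (ss n)).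
  by rewrite /= s0E.
exact: (svalP (step n (ss n))).2.
Qed.

Lemma comparison_unique (f : gunder X -> gunder Y)
    (u v : forall n, gunder (R n) -> gunder (S n)) :
  (forall n, ghom (u n)) -> (forall n x, u n.+1 (er_d x) = res_d (u n x)) ->
  (forall x, u 0 (er_aug R x) = res_aug S (f x)) ->
  (forall n, ghom (v n)) -> (forall n x, v n.+1 (er_d x) = res_d (v n x)) ->
  (forall x, v 0 (er_aug R x) = res_aug S (f x)) ->
  exists s : forall n, gunder (R n.+1) -> gunder (S n),
  [/\ forall n, ghom (s n), forall x, u 0 x - v 0 x = s 0 (er_d x)
    & forall n x, u n.+1 x - v n.+1 x = res_d (s n x) + s n.+1 (er_d x)].
Proof.
move=> hu ud ua hv vd va.
apply: (@comparison_homotopy (fun n x => u n x - v n x)) => [n|n x|x].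
- exact: cat_sub.
- by rewrite ud vd (linB (dS_lin (n := n))).
- by rewrite ua va subrr.
Qed.
End Comparison.

(** * Maps induced on cohomology *)

Section CohomologyTheory.
Variable k : fieldType.
Implicit Types X Y Z : cochain_complex k.

Lemma cohomology_ind X n (P : cohomology X n -> Prop) :
  (forall z, P (cohomology_class z)) -> forall c, P c.
Proof. by move=> h c; rewrite -[c]qreprK; apply: h. Qed.

Lemma coboundary0 X n : coboundary (0 : X n).
Proof. by case: n => [//|n]; exists 0; rewrite (lin0 (@cxd_lin _ X n)). Qed.

Lemma cohomology_map_lin X Y (f : cochain_map X Y) n :
  linear (@cohomology_map _ _ _ f n).
Proof.
move=> a; apply: cohomology_ind => z; apply: cohomology_ind => z'.
rewrite -[a *: _ + _](qcls_lin (coboundaries X n)) -/(cohomology_class _).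
rewrite !cohomology_mapE /cohomology_class -qcls_lin; congr qcls.
by apply: val_inj; apply: (@cmap_lin _ _ _ f n).
Qed.

(** Here and in the variants below, agreement up to coboundaries is asked of cocycles only, since
    the homotopies are evaluated on cocycles, where one of their two terms drops out. *)
Lemma cohomology_map_comp X Y Z (f : cochain_map X Y) (g : cochain_map Y Z)
    (h : cochain_map X Z) n :
  (forall x : X n, cxd x = 0 -> coboundary (cmap g (cmap f x) - cmap h x)) ->
  forall c : cohomology X n,
    cohomology_map g (cohomology_map f c) = cohomology_map h c.
Proof.
move=> e; apply: cohomology_ind => z; rewrite !cohomology_mapE.
by apply/qclsP; apply: e; exact: (subvP z).
Qed.

Lemma cohomology_map_id X (f : cochain_map X X) n :
  (forall x : X n, cxd x = 0 -> coboundary (cmap f x - x)) ->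
  forall c : cohomology X n, cohomology_map f c = c.
Proof.
move=> e; apply: cohomology_ind => z; rewrite !cohomology_mapE.
by apply/qclsP; apply: e; exact: (subvP z).
Qed.

Lemma cohomology_map_square X Y (Y' : cochain_complex k) Z (f : cochain_map X Y)
    (g : cochain_map Y Z) (f' : cochain_map X Y') (g' : cochain_map Y' Z) n :
  (forall x : X n, cxd x = 0 -> coboundary (cmap g (cmap f x) - cmap g' (cmap f' x))) ->
  forall c : cohomology X n,
    cohomology_map g (cohomology_map f c) = cohomology_map g' (cohomology_map f' c).
Proof.
move=> e; apply: cohomology_ind => z; rewrite !cohomology_mapE.
by apply/qclsP; apply: e; exact: (subvP z).
Qed.

Lemma cohomology_map_inverse X Y (f : cochain_map X Y)
    (g : cochain_map Y X) n :
  (forall x : X n, cxd x = 0 -> coboundary (cmap g (cmap f x) - x)) ->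
  cancel (@cohomology_map _ _ _ f n) (@cohomology_map _ _ _ g n).
Proof.
move=> e; apply: cohomology_ind => z; rewrite !cohomology_mapE.
by apply/qclsP; apply: e; exact: (subvP z).
Qed.

Lemma cohomology_map_bij X Y (f : cochain_map X Y) n :
  (forall m, bijective (@cmap _ _ _ f m)) -> bijective (@cohomology_map _ _ _ f n).
Proof.
move=> fb; have gex m : exists g, cancel (@cmap _ _ _ f m) g /\
    cancel g (@cmap _ _ _ f m) by case: (fb m) => g gK Kg; exists g.
pose g m := sval (cid (gex m)).
have gK m : cancel (@cmap _ _ _ f m) (g m) := (svalP (cid (gex m))).1.
have Kg m : cancel (g m) (@cmap _ _ _ f m) := (svalP (cid (gex m))).2.
have g_lin m : linear (g m).
  by move=> a x y; apply: (can_inj (gK m)); rewrite (@cmap_lin _ _ _ f m) !Kg.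
have g_d m (x : Y m) : g m.+1 (cxd x) = cxd (g m x).
  by apply: (can_inj (gK m.+1)); rewrite cmap_d !Kg.
exists (@cohomology_map _ _ _ (CochainMap g_lin g_d) n).
  apply: cohomology_ind => z; rewrite !cohomology_mapE; congr cohomology_class.
  exact/val_inj/gK.
apply: cohomology_ind => z; rewrite !cohomology_mapE; congr cohomology_class.
exact/val_inj/Kg.
Qed.
End CohomologyTheory.

(** * Graded quotients and extensions *)

Section QuotientMaps.
Variables (k : fieldType) (V W : lmodType k) (S : subspace V).

(** Evaluation on a chosen representative; independent of the choice once [f] vanishes on [S]. *)
Definition qind (f : V -> W) (q : quotv S) : W := f (qrepr q).

Lemma quot_ind (P : quotv S -> Prop) : (forall x, P (qcls S x)) -> forall q, P q.
Proof. by move=> h q; rewrite -[q]qreprK; apply: h. Qed.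

Variable f : V -> W.
Hypotheses (hf : linear f) (f0 : forall x, S x -> f x = 0).

Lemma qindE x : qind f (qcls S x) = f x.
Proof. by apply/eqP; rewrite -subr_eq0 -(linB hf); apply/eqP/f0/qcls_repr. Qed.

Lemma qind_lin : linear (qind f).
Proof.
by move=> a; apply: quot_ind => x; apply: quot_ind => y; rewrite -qcls_lin !qindE hf.
Qed.
End QuotientMaps.

Lemma qcls_eq0 (k : fieldType) (V : lmodType k) (S : subspace V) x :
  qcls S x = 0 <-> S x.
Proof.
rewrite -(lin0 (@qcls_lin _ _ S)); split=> [/qclsP|h]; first by rewrite subr0.
by apply/qclsP; rewrite subr0.
Qed.

Section GradedQuotient.
Variables (k : fieldType) (V : gvect k) (S : subspace V).
Hypothesis Sg : forall i x, S x -> S (gproj i x).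

Definition qproj i : quotv S -> quotv S := qind (fun x => qcls S (gproj i x)).

Let qf_lin i : linear (fun x => qcls S (gproj i x)) :=
  lin_comp (@qcls_lin _ _ S) (@gproj_lin _ V i).
Let qf0 i x : S x -> qcls S (gproj i x) = 0.
Proof. by move=> Sx; apply/qcls_eq0/Sg. Qed.

Lemma qprojE i x : qproj i (qcls S x) = qcls S (gproj i x).
Proof. exact: (qindE (@qf_lin i) (@qf0 i)). Qed.

Fact qproj_lin i : linear (qproj i).
Proof. exact: (qind_lin (@qf_lin i) (@qf0 i)). Qed.

Fact qprojK i j q : qproj i (qproj j q) = if i == j then qproj j q else 0.
Proof.
elim/(@quot_ind _ _ S): q => x; rewrite !qprojE gprojK.
by case: eqP => // _; rewrite (lin0 (@qcls_lin _ _ S)).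
Qed.

Fact qproj_fin q : exists s : seq int, uniq s /\ q = \sum_(i <- s) qproj i q.
Proof.
elim/(@quot_ind _ _ S): q => x; exists (gsupp x); split; first exact: gsupp_uniq.
rewrite {1}(gsuppE x) (lin_sum (@qcls_lin _ _ S)).
by apply: eq_bigr => i _; rewrite qprojE.
Qed.

Definition gquot : gvect k := GVect qproj_lin qprojK qproj_fin.

Lemma gquot_homogP i (q : gquot) : homog i q -> exists2 x, homog i x & q = qcls S x.
Proof.
rewrite /homog => <-; elim/(@quot_ind _ _ S): q => x.
by exists (gproj i x); [exact: homog_gproj|exact: qprojE].
Qed.

Lemma qcls_deg : deg_map (W := gquot) 0 (qcls S).
Proof. by apply: deg_map0 => i x hx; rewrite /homog /= qprojE hx. Qed.

Lemma qind_deg (W : gvect k) p (f : V -> W) : linear f ->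
  (forall x, S x -> f x = 0) -> deg_map p f -> deg_map (V := gquot) p (qind f).
Proof. by move=> hf f0 df i _ /gquot_homogP[x hx ->]; rewrite qindE //; apply: df. Qed.

Lemma gquot_bounded : bounded_above V -> bounded_above gquot.
Proof.
move=> [n hn]; exists n => i _ ni /gquot_homogP[x hx ->].
by rewrite (hn i x ni hx) (lin0 (@qcls_lin _ _ S)).
Qed.
End GradedQuotient.

Section KernelImage.
Variable k : fieldType.

Fact kernel_mem0 (U V : lmodType k) (d : U -> V) (hd : linear d) : d 0 = 0.
Proof. exact: lin0. Qed.
Fact kernel_memP (U V : lmodType k) (d : U -> V) (hd : linear d) a u v :
  d u = 0 -> d v = 0 -> d (a *: u + v) = 0.
Proof. by rewrite hd => -> ->; rewrite scaler0 addr0. Qed.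
Definition kernel (U V : lmodType k) (d : U -> V) (hd : linear d) : subspace U :=
  Subspace (kernel_mem0 hd) (kernel_memP hd).

Fact image_mem0 (U V : lmodType k) (d : U -> V) (hd : linear d) : exists u, 0 = d u.
Proof. by exists 0; rewrite lin0. Qed.
Fact image_memP (U V : lmodType k) (d : U -> V) (hd : linear d) a x y :
  (exists u, x = d u) -> (exists u, y = d u) -> exists u, a *: x + y = d u.
Proof. by move=> [u ->] [v ->]; exists (a *: u + v); rewrite hd. Qed.
Definition image (U V : lmodType k) (d : U -> V) (hd : linear d) : subspace V :=
  Subspace (image_mem0 hd) (image_memP hd).

Lemma deg0_gproj (U V : gvect k) (d : U -> V) : linear d -> deg_map 0 d ->
  forall i x, d (gproj i x) = gproj i (d x).
Proof. by move=> hd dd i x; rewrite (deg_map_gproj hd dd) addr0. Qed.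

Lemma kernel_graded (U V : gvect k) (d : U -> V) (hd : linear d) : deg_map 0 d ->
  forall i x, kernel hd x -> kernel hd (gproj i x).
Proof. by move=> dd i x /= h; rewrite deg0_gproj // h gproj0. Qed.

Lemma image_graded (U V : gvect k) (d : U -> V) (hd : linear d) : deg_map 0 d ->
  forall i x, image hd x -> image hd (gproj i x).
Proof. by move=> dd i x [u ->]; exists (gproj i u); rewrite deg0_gproj. Qed.

Lemma qind_kernel_inj (U V : lmodType k) (d : U -> V) (hd : linear d) :
  injective (qind (S := kernel hd) d).
Proof.
apply: quot_ind => x; apply: quot_ind => y; rewrite !qindE // => e.
by apply/qclsP; rewrite /= (linB hd) e subrr.
Qed.

Lemma qind_kernel_lin (U V : lmodType k) (d : U -> V) (hd : linear d) :
  linear (qind (S := kernel hd) d).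
Proof. exact: qind_lin. Qed.
End KernelImage.

Section GradedMaps.
Variable k : fieldType.
Implicit Types V W : gvect k.

Lemma deg_map_comb V W p a (f g : V -> W) :
  deg_map p f -> deg_map p g -> deg_map p (fun x => a *: f x + g x).
Proof. by move=> hf hg i x hx; apply: homogP; [apply: hf|apply: hg]. Qed.

Lemma tmap_comb (U U' V V' : lmodType k) a (f g : U -> U') (h : V -> V') x :
  linear f -> linear g -> linear h ->
  tmap (fun x => a *: f x + g x) h x = a *: tmap f h x + tmap g h x.
Proof.
move=> hf hg hh; have hfg := lin_comb a hf hg; move: x; apply: tens_ext.
- exact: tmap_lin.
- exact: lin_comb (tmap_lin hf hh) (tmap_lin hg hh).
- by move=> u v; rewrite !tmapE // tmul_linl.
Qed.

Lemma tmap_combr (U U' V V' : lmodType k) a (h : U -> U') (f g : V -> V') x :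
  linear h -> linear f -> linear g ->
  tmap h (fun x => a *: f x + g x) x = a *: tmap h f x + tmap h g x.
Proof.
move=> hh hf hg; have hfg := lin_comb a hf hg; move: x; apply: tens_ext.
- exact: tmap_lin.
- exact: lin_comb (tmap_lin hh hf) (tmap_lin hh hg).
- by move=> u v; rewrite !tmapE // tmul_linr.
Qed.

(** Over a field both maps have linear retractions, and the tensor product of these retracts
    [tmap f g]. *)
Lemma tmap_inj (U U' V V' : lmodType k) (f : U -> U') (g : V -> V') :
  linear f -> linear g -> injective f -> injective g -> injective (tmap f g).
Proof.
move=> hf hg fi gi; have [f' [hf' fK]] := linear_retraction hf fi.
have [g' [hg' gK]] := linear_retraction hg gi.
apply: (can_inj (g := tmap f' g')) => x; rewrite tmap_comp // -[RHS]tmap_id.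
by congr (tmap _ _ x); apply/funext.
Qed.

Lemma tmap_degD V V' W W' p q (f : V -> V') (g : W -> W') :
  linear f -> linear g -> deg_map p f -> deg_map q g ->
  deg_map (V := gtens V W) (W := gtens V' W') (p + q) (tmap f g).
Proof.
move=> hf hg df dg n x hx.
have hfg := tmap_lin hf hg; rewrite /homog /= -[in RHS]hx /=.
move: x {hx}; apply: (tens_homog_ext (f := fun x => tproj (n + (p + q)) (tmap f g x))
  (g := fun x => tmap f g (tproj n x))) => [||i j v w hv hw].
- exact: lin_comp (@tproj_lin _ _ _ _) hfg.
- exact: lin_comp hfg (@tproj_lin _ _ _ n).
- rewrite tmapE // (tprojE _ hv hw) (tprojE _ (df _ _ hv) (dg _ _ hw)).
  rewrite (addrACA i) (inj_eq (addIr _)).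
  by case: eqP => _; rewrite ?tmapE // (lin0 hfg).
Qed.

Lemma gtens_bounded V W :
  bounded_above V -> bounded_above W -> bounded_above (gtens V W).
Proof.
move=> [a ha] [b hb]; exists (a + b) => n x nab; rewrite /homog /= => <-.
move: x; apply: (tens_homog_ext (f := tproj n) (g := fun=> 0)).
- exact: tproj_lin.
- exact: lin_zero.
- move=> i j v w hv hw; rewrite (tprojE n hv hw); case: eqP => // nij.
  have [ia|ia] := ltP a i; first by rewrite (ha i v ia hv) (lin0 (@tmul_linl _ _ _ w)).
  have bj : b < j by lia.
  by rewrite (hb j w bj hw) (lin0 (@tmul_linr _ _ _ v)).
Qed.

(** An ungraded extension [g] is replaced by its degree 0 part, the sum of the [gproj j] after [g]
    after [gproj j]. It still extends [f], because [i] and [f] preserve degrees. *)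
Lemma graded_extension (V W U : gvect k) (i : V -> W) (f : V -> U) :
  linear i -> deg_map 0 i -> injective i -> linear f -> deg_map 0 f ->
  exists g : W -> U, [/\ linear g, deg_map 0 g & forall v, g (i v) = f v].
Proof.
move=> hi di ii hf df; have [|g [hg gE]] := linear_extension hi hf.
  by move=> v iv; rewrite -[v](_ : 0 = v) ?(lin0 hf) //; apply: ii; rewrite (lin0 hi).
pose h x := \sum_(j <- gsupp x) gproj j (g (gproj j x)).
have F_lin j : linear (fun x => gproj j (g (gproj j x))).
  apply: lin_comp (@gproj_lin _ _ j) _; exact: lin_comp hg (@gproj_lin _ _ j).
have F0 j x : gproj j x = 0 -> gproj j (g (gproj j x)) = 0.
  by move=> ->; rewrite (lin0 hg) gproj0.
have hE j x : homog j x -> h x = gproj j (g x).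
  by move=> hx; rewrite /h (gsum_homog (F := fun j => gproj j (g (gproj j x))) hx)
    ?hx // => l; apply: F0.
have hh : linear h by apply: (gsum_lin F_lin F0).
exists h; split=> //.
  by apply: deg_map0 => j x hx; rewrite (hE j) //; apply: homog_gproj.
apply: (homog_ext (lin_comp hh hi) hf) => j x hx /=.
have := di _ _ hx; rewrite addr0 => hix; rewrite (hE j) // gE.
by have := df _ _ hx; rewrite addr0.
Qed.
End GradedMaps.

(** * Quotient comodules *)

Lemma tens_deg_map (k : fieldType) (V W Z : gvect k) p (F : gtens V W -> Z) :
  linear F -> (forall i j (v : V) (w : W), homog i v -> homog j w ->
    homog (i + j + p) (F (v ⊗ w))) -> deg_map p F.
Proof.
move=> hF h n x hx; rewrite /homog.
suff: gproj (n + p) (F (tproj n x)) = F (tproj n x) by rewrite [tproj n x]hx.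
move: x {hx}; apply: (tens_homog_ext (f := fun x => gproj (n + p) (F (tproj n x)))
  (g := fun x => F (tproj n x))) => [||i j v w hv hw].
- exact: lin_comp (@gproj_lin _ _ _) (lin_comp hF (@tproj_lin _ _ _ _)).
- exact: lin_comp hF (@tproj_lin _ _ _ _).
- rewrite (tprojE _ hv hw); case: eqP => [->|_]; first exact: h.
  by rewrite (lin0 hF) gproj0.
Qed.

Lemma tassocV_deg (k : fieldType) (U V W : gvect k) :
  deg_map (V := gtens U (gtens V W)) (W := gtens (gtens U V) W) 0 (@tassocV k U V W).
Proof.
apply: tens_deg_map; first exact: tassocV_lin.
move=> i j u y hu hy; rewrite addr0 addrC.
have hF : deg_map (V := gtens V W) (W := gtens (gtens U V) W) i
    (fun y => tassocV (u ⊗ y)).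
  apply: tens_deg_map.
    exact: lin_comp (@tassocV_lin _ _ _ _) (@tmul_linr _ _ _ u).
  move=> a b v w hv hw; rewrite tassocVE addrC addrA.
  by apply: tmul_homog hw; apply: tmul_homog.
exact: hF.
Qed.

Lemma tswap_deg (k : fieldType) (V W : gvect k) :
  deg_map (V := gtens V W) (W := gtens W V) 0 (@tswap k V W).
Proof.
apply: tens_deg_map; first exact: tswap_lin.
by move=> i j v w hv hw; rewrite tswapE addr0 addrC; apply: tmul_homog.
Qed.

Lemma tswap_nat (k : fieldType) (V V' W W' : lmodType k) (f : V -> V') (g : W -> W') x :
  linear f -> linear g -> tswap (tmap f g x) = tmap g f (tswap x).
Proof.
move=> hf hg; move: x; apply: tens_ext => [||v w].
- exact: lin_comp (@tswap_lin _ _ _) (tmap_lin hf hg).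
- exact: lin_comp (tmap_lin hg hf) (@tswap_lin _ _ _).
- by rewrite !(tmapE, tswapE).
Qed.

Section Comodules.
Variables (k : fieldType) (C : gcoalgebra k).
Implicit Types X Y Z : grcomodule C.

Lemma rcomodule_map_comp X Y Z (f : Y -> Z) (g : X -> Y) :
  rcomodule_map f -> rcomodule_map g -> rcomodule_map (f \o g).
Proof.
move=> [fl fd fc] [gl gd gc]; split; first exact: lin_comp.
  by rewrite -[0]add0r; apply: deg_map_comp.
by move=> x /=; rewrite fc gc tmap_comp.
Qed.

Lemma rcomodule_map_comb X Y a (f g : X -> Y) :
  rcomodule_map f -> rcomodule_map g -> rcomodule_map (fun x => a *: f x + g x).
Proof.
move=> [fl fd fc] [gl gd gc]; split; first exact: lin_comb.
  exact: deg_map_comb.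
by move=> x; rewrite (@rcoact_lin _ _ Y) fc gc tmap_comb.
Qed.

Section Quotient.
Variables (X : grcomodule C) (S : subspace X).
Hypothesis Sg : forall i x, S x -> S (gproj i x).
(** This says that [S] is a subcomodule: the kernel of [qcls S ⊗ id] is S ⊗ C, which thus need not
    be named. *)
Hypothesis Sc : forall x, S x -> tmap (qcls S) id (rcoact x) = 0.
Let Q := gquot Sg.
Let cl : X -> Q := qcls S.
Let cl_lin : linear cl := @qcls_lin _ _ S.

Definition rquot_coact : Q -> gtens Q C := qind (fun x => tmap cl id (rcoact x)).

Let c_lin : linear (fun x : X => tmap cl (@id C) (rcoact x)) :=
  lin_comp (tmap_lin cl_lin (@lin_id _ C)) (@rcoact_lin _ _ X).

Lemma rquot_coactE x : rquot_coact (cl x) = tmap cl id (rcoact x).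
Proof. exact: (qindE c_lin Sc). Qed.

Fact rquot_coact_lin : linear rquot_coact.
Proof. exact: (qind_lin c_lin Sc). Qed.

Fact rquot_coact_deg : deg_map 0 rquot_coact.
Proof.
have td := tmap_deg (V' := Q) cl_lin (@lin_id _ C) (qcls_deg Sg) (@deg_map_id _ C).
have := deg_map_comp td (@rcoact_deg _ _ X); rewrite addr0.
exact: (@qind_deg _ _ _ Sg (gtens Q C) 0 _ c_lin Sc).
Qed.

Fact rquot_coactA q :
  tassoc (tmap rquot_coact id (rquot_coact q)) = tmap id (@comul k C) (rquot_coact q).
Proof.
have rl := @rcoact_lin _ _ X; have ql := rquot_coact_lin; have il := @lin_id _ C.
have ml := @comul_lin _ C.
elim/(@quot_ind _ _ S): q => x; rewrite -/(cl x) rquot_coactE !tmap_comp //.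
have -> : rquot_coact \o cl = tmap cl id \o @rcoact _ _ X.
  by apply/funext => y; apply: rquot_coactE.
have tl := tmap_lin cl_lin il.
rewrite -(@tmap_comp _ _ _ _ _ _ _ (@rcoact _ _ X) _ id id) // tassoc_nat //.
rewrite rcoactA tmap_comp //; last exact: tmap_lin.
congr (tmap _ _ _); apply/funext => z /=; exact: tmap_id.
Qed.

Fact rquot_coact1 q : contr_r (@counit k C) (rquot_coact q) = q.
Proof.
elim/(@quot_ind _ _ S): q => x; rewrite -/(cl x) rquot_coactE -{2}(rcoact1 x).
have el := @counit_lin _ C.
move: (rcoact x); apply: (tens_ext
  (f := fun z => contr_r (@counit k C) (tmap cl id z))
  (g := fun z => cl (contr_r (@counit k C) z))) => [||v c].
- exact: lin_comp (contr_r_lin el) (tmap_lin cl_lin (@lin_id _ C)).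
- exact: lin_comp cl_lin (contr_r_lin el).
- by rewrite tmapE // !contr_rE // (linZ cl_lin).
Qed.

Definition rquot : grcomodule C :=
  GRComodule rquot_coact_lin rquot_coact_deg rquot_coactA rquot_coact1.

Lemma rquot_cls_map : rcomodule_map (Y := rquot) cl.
Proof. by split; [exact: cl_lin|exact: qcls_deg|move=> x; exact: rquot_coactE]. Qed.

Lemma rquot_ind_map Y (f : X -> Y) : rcomodule_map f -> (forall x, S x -> f x = 0) ->
  rcomodule_map (X := rquot) (qind f).
Proof.
move=> [fl fd fc] f0; have ql := qind_lin fl f0.
split; [exact: ql|exact: (@qind_deg _ _ _ Sg Y 0 f fl f0 fd)|].
move=> q; elim/(@quot_ind _ _ S): q => x; rewrite qindE // fc.
transitivity (tmap (qind f) id (tmap cl id (rcoact x))).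
  rewrite tmap_comp //.
  by congr (tmap _ _ _); apply/funext => y /=; rewrite qindE.
by rewrite -rquot_coactE.
Qed.
End Quotient.

(** X / ker d embeds in [Y], and the embedding stays injective after tensoring with [C]; there the
    element in question becomes the coaction of [d x = 0]. *)
Lemma kernel_coact X Y (d : X -> Y) (hd : rcomodule_map d) (dl : linear d) x :
  kernel dl x -> tmap (qcls (kernel dl)) id (rcoact x) = 0.
Proof.
move=> /= dx; have [_ _ dc] := hd; have cl := @qcls_lin _ _ (kernel dl).
have ql := @qind_kernel_lin _ _ _ _ dl; have il := @lin_id _ C.
apply: (tmap_inj ql il (@qind_kernel_inj _ _ _ _ dl) (@inj_id _)).
rewrite tmap_comp // (lin0 (tmap_lin ql il)).
transitivity (rcoact (d x)); last by rewrite dx (lin0 (@rcoact_lin _ _ Y)).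
by rewrite dc; congr (tmap _ _ _); apply/funext => y /=; rewrite qindE.
Qed.

Lemma image_coact X Y (d : X -> Y) (hd : rcomodule_map d) (dl : linear d) x :
  image dl x -> tmap (qcls (image dl)) id (rcoact x) = 0.
Proof.
move=> [y ->]; have [_ _ dc] := hd.
rewrite dc tmap_comp //; last exact: qcls_lin.
by apply: tmap0l => // z; apply/qcls_eq0; exists z.
Qed.

Lemma rcomodule_exact_cat : exact_cat (rcomodule_cat C).
Proof.
split=> [X|X Y Z f g|X Y a f g|X Y E d f hE hd hf df].
- exact: rcomodule_map_id.
- exact: rcomodule_map_comp.
- exact: rcomodule_map_comb.
have [dl dd dc] := hd.
(* Both maps descend to X / ker d, where [d] becomes injective, so that injectivity of [E]
   applies. *)
pose Q := rquot (kernel_graded (hd := dl) dd) (kernel_coact hd (dl := dl)).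
have hqd : rcomodule_map (X := Q) (qind d) by exact: rquot_ind_map.
have hqf : rcomodule_map (X := Q) (qind f) by exact: rquot_ind_map.
have [g [hg gE]] := hE Q Y _ _ hqd (@qind_kernel_inj _ _ _ _ dl) hqf.
exists g; split=> // x; have := gE (qcls _ x).
by rewrite !qindE //; case: hf.
Qed.
End Comodules.

(** * Cofree comodules and their resolutions *)

Section Cofree.
Variables (k : fieldType) (C : gcoalgebra k).
Let comul_l := @comul_lin _ C.
Let il := @lin_id _ C.

Section Object.
Variable V : gvect k.
Let vl := @lin_id _ V.
Definition cofree_coact : gtens V C -> gtens (gtens V C) C :=
  fun x => tassocV (tmap id (@comul k C) x).

Fact cofree_coact_lin : linear cofree_coact.
Proof. exact: lin_comp (@tassocV_lin _ _ _ _) (tmap_lin vl comul_l). Qed.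

Lemma cofree_coactE v c : cofree_coact (v ⊗ c) = tassocV (v ⊗ comul c).
Proof. by rewrite /cofree_coact tmapE. Qed.

Fact cofree_coact_deg : deg_map 0 cofree_coact.
Proof.
have := deg_map_comp (@tassocV_deg k V C C)
  (tmap_deg vl comul_l (@deg_map_id _ V) (@comul_deg _ C)).
by rewrite addr0.
Qed.

Fact cofree_coactA x :
  tassoc (tmap cofree_coact id (cofree_coact x)) = tmap id (@comul k C) (cofree_coact x).
Proof.
have cl := cofree_coact_lin; have tcl := tmap_lin cl il.
have al := @tassoc_lin _ (gtens V C) C C; have avl := @tassocV_lin _ V C C.
have til := tmap_lin (@lin_id _ (gtens V C)) comul_l.
move: x; apply: tens_ext => [||v c].
- exact: lin_comp al (lin_comp tcl cl).
- exact: lin_comp til cl.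
rewrite cofree_coactE.
(* Both sides are brought to the form [v ⊗ _], where coassociativity of [C] finishes. *)
have -> : tassoc (tmap cofree_coact id (tassocV (v ⊗ comul c))) =
    tassocV (v ⊗ tassoc (tmap (@comul k C) id (comul c))).
  move: (comul c); apply: tens_ext => [||p q].
  - apply: (lin_comp al); apply: (lin_comp tcl); apply: (lin_comp avl); exact: tmul_linr.
  - apply: (lin_comp (@tassocV_lin _ _ _ _)); apply: (lin_comp (@tmul_linr _ _ _ v)).
    exact: (lin_comp (@tassoc_lin _ _ _ _) (tmap_lin comul_l il)).
  rewrite tassocVE !tmapE // cofree_coactE; move: (comul p).
  apply: tens_ext => [||a b].
  - apply: (lin_comp al); apply: (lin_comp (@tmul_linl _ _ _ q)).
    by apply: (lin_comp avl); apply: tmul_linr.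
  - apply: (lin_comp (@tassocV_lin _ _ _ _)); apply: (lin_comp (@tmul_linr _ _ _ v)).
    exact: (lin_comp (@tassoc_lin _ _ _ _) (@tmul_linl _ _ _ q)).
  by rewrite tassocVE !tassocE tassocVE.
rewrite comulA; move: (comul c); apply: tens_ext => [||p q].
- apply: (lin_comp (@tassocV_lin _ _ _ _)); apply: (lin_comp (@tmul_linr _ _ _ v)).
  exact: tmap_lin.
- apply: (lin_comp til); apply: (lin_comp avl); exact: tmul_linr.
by rewrite tassocVE !tmapE // tassocVE.
Qed.

Fact cofree_coact1 x : contr_r (@counit k C) (cofree_coact x) = x.
Proof.
have el := @counit_lin _ C; have cl := cofree_coact_lin.
move: x; apply: (tens_ext (g := id)) => // [|v c].
  exact: lin_comp (contr_r_lin el) cl.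
rewrite cofree_coactE -{2}[c]counitr; move: (comul c); apply: tens_ext => [||p q].
- apply: (lin_comp (contr_r_lin el)); apply: (lin_comp (@tassocV_lin _ _ _ _)).
  exact: tmul_linr.
- exact: lin_comp (@tmul_linr _ _ _ v) (contr_r_lin el).
by rewrite tassocVE !contr_rE // (linZ (@tmul_linr _ _ _ v)).
Qed.

Definition cofree : grcomodule C :=
  GRComodule cofree_coact_lin cofree_coact_deg cofree_coactA cofree_coact1.
End Object.

Lemma contr_r_deg (V : gvect k) :
  deg_map (V := gtens V C) 0 (@contr_r k V C (@counit k C)).
Proof.
have el := @counit_lin _ C.
apply: tens_deg_map; first exact: contr_r_lin.
move=> i j v c hv hc; rewrite contr_rE // addr0.
have [->|j0] := eqVneq j 0; first by rewrite addr0; apply: homogZ.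
by rewrite (counit_deg hc j0) scale0r; apply: homog0.
Qed.

(** One half of the universal property of V ⊗ C: a comodule map into it is recovered from its
    composite with the counit. The other half, that every graded linear map to [V] arises in this
    way, rests on [cofree_map]. *)
Lemma cofree_counit (V : gvect k) (X : grcomodule C) (f : X -> cofree V) x :
  rcomodule_map f ->
  f x = tmap (contr_r (@counit k C) \o f) id (rcoact x).
Proof.
move=> [fl fd fc]; have el := @counit_lin _ C; have cl := contr_r_lin (U := V) el.
rewrite -(@tmap_comp _ _ _ _ _ _ _ f _ id id) // -fc.
move: (f x); apply: (tens_ext (f := id)) => [||v c]; first exact: lin_id.
  exact: lin_comp (tmap_lin cl il) (@cofree_coact_lin V).
change (v ⊗ c = tmap (contr_r (@counit k C)) id (cofree_coact (v ⊗ c))).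
rewrite cofree_coactE -{1}[c]counitl; move: (comul c); apply: tens_ext => [||p q].
- exact: lin_comp (@tmul_linr _ _ _ v) (contr_l_lin el).
- apply: (lin_comp (tmap_lin cl il)); apply: (lin_comp (@tassocV_lin _ _ _ _)).
  exact: tmul_linr.
rewrite tassocVE tmapE // contr_lE // contr_rE // (linZ (@tmul_linr _ _ _ v)).
by rewrite (linZ (@tmul_linl _ _ _ q)).
Qed.

Lemma cofree_map (V : gvect k) (X : grcomodule C) (g : X -> V) :
  linear g -> deg_map 0 g ->
  rcomodule_map (Y := cofree V) (fun x => tmap g id (rcoact x)).
Proof.
move=> gl gd; have rl := @rcoact_lin _ _ X; split.
- exact: lin_comp (tmap_lin gl il) rl.
- have := deg_map_comp (tmap_deg gl il gd (@deg_map_id _ C)) (@rcoact_deg _ _ X).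
  by rewrite addr0.
move=> x.
transitivity (tassocV (tmap g id (tmap id (@comul k C) (rcoact x)))).
  change (cofree_coact (tmap g id (rcoact x)) =
    tassocV (tmap g id (tmap id (@comul k C) (rcoact x)))).
  rewrite /cofree_coact; congr tassocV; rewrite !tmap_comp //.
rewrite -rcoactA; transitivity (tmap (tmap g id) id (tmap (@rcoact _ _ X) id (rcoact x))).
  move: (tmap (@rcoact _ _ X) id (rcoact x)); apply: tens3_ext => [||a b c].
  - apply: (lin_comp (@tassocV_lin _ _ _ _)); apply: lin_comp (@tassoc_lin _ _ _ _).
    exact: (tmap_lin gl (@lin_id _ (gtens C C))).
  - exact: (tmap_lin (tmap_lin gl il) il).
  have gil := tmap_lin gl il; rewrite tassocE (tmapE _ _ gl (@lin_id _ _)) tassocVE.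
  by rewrite !tmapE.
by have gil := tmap_lin gl il; rewrite tmap_comp //.
Qed.

(** By the universal property an extension problem into V ⊗ C is an extension problem of graded
    vector spaces into [V]. *)
Lemma cofree_injective (V : gvect k) : injective_object (D := rcomodule_cat C) (cofree V).
Proof.
move=> X Y i f hi ii hf; have [il' id' ic] := hi; have [fl fd fc] := hf.
have el := @counit_lin _ C.
have bl : linear (contr_r (@counit k C) \o f) := lin_comp (contr_r_lin el) fl.
have bd : deg_map 0 (contr_r (@counit k C) \o f).
  by have := deg_map_comp (@contr_r_deg V) fd; rewrite addr0.
have [g [gl gd gE]] := graded_extension il' id' ii bl bd.
exists (fun y => tmap g id (rcoact y)); split; first exact: cofree_map.
move=> x; rewrite ic tmap_comp // (cofree_counit _ hf).
by congr (tmap _ _ _); apply/funext.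
Qed.

Lemma coact_map (X : grcomodule C) : rcomodule_map (Y := cofree X) (@rcoact k C X).
Proof.
have := cofree_map (@lin_id _ X) (@deg_map_id _ X).
by congr rcomodule_map; apply/funext => x; rewrite tmap_id.
Qed.

Lemma rcoact_inj (X : grcomodule C) : injective (@rcoact k C X).
Proof. exact: can_inj (@rcoact1 _ _ X). Qed.

Definition cokernel (X : grcomodule C) : grcomodule C :=
  @rquot k C (cofree X) (image (@rcoact_lin k C X))
    (image_graded (hd := @rcoact_lin k C X) (@rcoact_deg k C X))
    (image_coact (coact_map X) (dl := @rcoact_lin k C X)).

(** The terms are described by an equality of objects, not an isomorphism, so that injectivity of
    the associated bimodules can later be obtained by rewriting. *)
Lemma cofree_resolution (X : grcomodule C) :
  bounded_above C -> bounded_above X ->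
  exists (I : @inj_resolution k (rcomodule_cat C) X) (V : nat -> gvect k),
    forall n, bounded_above (V n) /\ res I n = cofree (V n).
Proof.
(* [Xs n] is the n-th cosyzygy: the coaction embeds it in the cofree comodule on its own underlying
   space, and [Xs n.+1] is the cokernel. The differential projects to [Xs n.+1] and embeds again. *)
move=> Cb Xb; pose Xs := fix Xs n := match n with 0 => X | m.+1 => cokernel (Xs m) end.
pose cl n : gtens (Xs n) C -> Xs n.+1 := qcls (image (@rcoact_lin k C (Xs n))).
pose d n : cofree (Xs n) -> cofree (Xs n.+1) := fun x => rcoact (cl n x).
have cl0 n x : cl n x = 0 <-> exists y, x = rcoact y by apply: qcls_eq0.
have d0 n x : d n x = 0 <-> exists y, x = rcoact y.
  rewrite -cl0 /d; split=> [h|->]; last exact: (lin0 (@rcoact_lin _ _ _)).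
  by apply: rcoact_inj; rewrite h (lin0 (@rcoact_lin _ _ _)).
have dh n : rcomodule_map (d n).
  by apply: rcomodule_map_comp (coact_map (Xs n.+1)) _; apply: rquot_cls_map.
have dx n y : d n.+1 y = 0 <-> exists x, y = d n x.
  rewrite d0; split=> [[z ->]|[x ->]]; last by exists (cl n x).
  by exists (qrepr z); rewrite /d /cl qreprK.
exists (@InjResolution k (rcomodule_cat C) X (fun n => cofree (Xs n)) _ d
  (coact_map X) dh (@rcoact_inj X) (d0 0) dx (fun n => @cofree_injective (Xs n))).
exists (fun n => Xs n); move=> n; split=> //.
elim: n => [//|n IH]; apply: gquot_bounded; exact: gtens_bounded.
Qed.
End Cofree.

(** * Left comodules as right comodules over the opposite coalgebra *)

Section Opposite.
Variable k : fieldType.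

(** Both sides reverse the three factors, sending (u ⊗ v) ⊗ w to w ⊗ (v ⊗ u). *)
Lemma tswap_assoc (U V W : lmodType k) (x : tens (tens U V) W) :
  tassoc (tmap (@tswap k V W) id (tswap (tassoc x))) =
  tmap id (@tswap k U V) (tswap x).
Proof.
have sl A B := @tswap_lin k A B.
move: x; apply: tens3_ext => [||u v w].
- exact: (lin_comp (@tassoc_lin _ _ _ _) (lin_comp (tmap_lin (sl _ _) (@lin_id _ _))
    (lin_comp (sl _ _) (@tassoc_lin _ _ _ _)))).
- exact: (lin_comp (tmap_lin (@lin_id _ _) (sl _ _)) (sl _ _)).
by rewrite tassocE !tswapE !tmapE // !tswapE tassocE.
Qed.

Lemma contr_r_swap (U V : lmodType k) (e : V -> k^o) (x : tens V U) : linear e ->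
  contr_r e (tswap x) = contr_l e x.
Proof.
move=> el; move: x; apply: tens_ext => [||v u].
- exact: lin_comp (contr_r_lin el) (@tswap_lin _ _ _).
- exact: contr_l_lin.
by rewrite tswapE contr_rE // contr_lE.
Qed.

Lemma contr_l_swap (U V : lmodType k) (e : V -> k^o) (x : tens U V) : linear e ->
  contr_l e (tswap x) = contr_r e x.
Proof. by move=> el; rewrite -contr_r_swap // tswapK. Qed.

Lemma deg_map_swap (V W U : gvect k) (f : U -> gtens V W) : deg_map 0 f ->
  deg_map (W := gtens W V) 0 (fun x => tswap (f x)).
Proof. by move=> df; have := deg_map_comp (@tswap_deg k V W) df; rewrite addr0. Qed.

Variable C : gcoalgebra k.
Let cm := @comul_lin _ C.

(** The flip carries no Koszul sign, in accordance with the unsigned left coaction attached to a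
    right module. *)
Definition cop_comul (c : C) : gtens C C := tswap (comul c).

Fact cop_lin : linear cop_comul.
Proof. exact: lin_comp (@tswap_lin _ _ _) cm. Qed.

Lemma swap_coassoc (X : lmodType k) (D : X -> tens C X) x : linear D ->
  tassoc (tmap (@comul k C) id (D x)) = tmap id D (D x) ->
  tassoc (tmap (fun x => tswap (D x)) id (tswap (D x))) =
    tmap id cop_comul (tswap (D x)).
Proof.
move=> hD e; have sl A B := @tswap_lin k A B.
have -> : tmap (fun x => tswap (D x)) id (tswap (D x)) =
    tmap (@tswap _ _ _) id (tswap (tmap id D (D x))).
  by rewrite tswap_nat // tmap_comp.
rewrite -e tswap_assoc tswap_nat // tmap_comp //.
Qed.

Lemma unswap_coassoc (X : lmodType k) (D : X -> tens X C) x : linear D ->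
  tassoc (tmap D id (D x)) = tmap id cop_comul (D x) ->
  tassoc (tmap (@comul k C) id (tswap (D x))) =
    tmap id (fun x => tswap (D x)) (tswap (D x)).
Proof.
move=> hD e; have sl A B := @tswap_lin k A B; have ol := cop_lin.
have -> : tmap (@comul k C) id (tswap (D x)) =
    tmap (@tswap _ _ _) id (tswap (tmap id cop_comul (D x))).
  rewrite tswap_nat // tmap_comp //; congr (tmap _ _ _); apply/funext => c.
  by rewrite /= /cop_comul tswapK.
by rewrite -e tswap_assoc tswap_nat // tmap_comp.
Qed.

Fact cop_comulA c :
  tassoc (tmap cop_comul id (cop_comul c)) = tmap id cop_comul (cop_comul c).
Proof. exact: swap_coassoc cm (comulA c). Qed.

Definition cop : gcoalgebra k :=
  @GCoalgebra k C cop_comul (@counit k C) cop_lin (deg_map_swap (@comul_deg _ C))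
    (@counit_lin _ C) (@counit_deg _ C) cop_comulA
    (fun c => etrans (contr_l_swap _ (@counit_lin _ C)) (counitr c))
    (fun c => etrans (contr_r_swap _ (@counit_lin _ C)) (counitl c)).

Definition lcop (X : glcomodule C) : grcomodule cop :=
  @GRComodule k cop X (fun x => tswap (lcoact x))
    (lin_comp (@tswap_lin _ _ _) (@lcoact_lin _ _ X)) (deg_map_swap (@lcoact_deg _ _ X))
    (fun x => swap_coassoc (@lcoact_lin _ _ X) (lcoactA x))
    (fun x => etrans (contr_r_swap _ (@counit_lin _ C)) (lcoact1 x)).

Definition rcop (X : grcomodule cop) : glcomodule C :=
  @GLComodule k C X (fun x => tswap (rcoact x))
    (lin_comp (@tswap_lin _ _ _) (@rcoact_lin _ _ X)) (deg_map_swap (@rcoact_deg _ _ X))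
    (fun x => unswap_coassoc (@rcoact_lin _ _ X) (rcoactA x))
    (fun x => etrans (contr_l_swap _ (@counit_lin _ C)) (rcoact1 x)).

Lemma lcop_map (X Y : glcomodule C) (f : X -> Y) :
  lcomodule_map f <-> rcomodule_map (X := lcop X) (Y := lcop Y) f.
Proof.
split=> -[fl fd fc]; split=> // x /=.
  by rewrite fc tswap_nat.
apply: (can_inj (@tswapK _ _ _)); rewrite tswap_nat //; exact: fc.
Qed.

Lemma rcop_map (X Y : grcomodule cop) (f : X -> Y) :
  rcomodule_map f <-> lcomodule_map (X := rcop X) (Y := rcop Y) f.
Proof.
split=> -[fl fd fc]; split=> // x /=.
  by rewrite fc tswap_nat.
apply: (can_inj (@tswapK _ _ _)); rewrite tswap_nat //; exact: fc.
Qed.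

(** Going over to [cop] and back flips the coaction twice, which is the identity only through
    [tswapK]. Maps between an object of one kind and a translated object of the other are therefore
    converted directly, here and in [rlcop_map]. *)
Lemma lrcop_map (X : glcomodule C) (Y : grcomodule cop) (f : X -> Y) :
  lcomodule_map (Y := rcop Y) f <-> rcomodule_map (X := lcop X) f.
Proof.
split=> -[fl fd fc]; split=> // x.
  apply: (can_inj (@tswapK _ _ _)); rewrite /= [LHS]fc tswap_nat //.
  by rewrite tswapK.
by rewrite /= fc tswap_nat //= tswapK.
Qed.

Lemma rlcop_map (X : grcomodule cop) (Y : glcomodule C) (f : X -> Y) :
  rcomodule_map (Y := lcop Y) f <-> lcomodule_map (X := rcop X) f.
Proof.
split=> -[fl fd fc]; split=> // x.
  apply: (can_inj (@tswapK _ _ _)); rewrite /= [LHS]fc tswap_nat //.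
  by rewrite tswapK.
by rewrite /= fc tswap_nat //= tswapK.
Qed.

Lemma lcop_injective (E : glcomodule C) :
  injective_object (D := lcomodule_cat C) E ->
  injective_object (D := rcomodule_cat cop) (lcop E).
Proof.
move=> hE X Y i f /rcop_map hi ii /rlcop_map hf.
by have [g [/rlcop_map hg gE]] := hE (rcop X) (rcop Y) i f hi ii hf; exists g.
Qed.

Lemma rcop_injective (E : grcomodule cop) :
  injective_object (D := rcomodule_cat cop) E ->
  injective_object (D := lcomodule_cat C) (rcop E).
Proof.
move=> hE X Y i f /lcop_map hi ii /lrcop_map hf.
by have [g [/lrcop_map hg gE]] := hE (lcop X) (lcop Y) i f hi ii hf; exists g.
Qed.

Lemma lcomodule_exact_cat : exact_cat (lcomodule_cat C).
Proof.
have h := rcomodule_exact_cat cop; split=> [X|X Y Z f g|X Y a f g|X Y E d f hE].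
- exact: lcomodule_map_id.
- move=> /lcop_map hf /lcop_map hg; apply/lcop_map; exact: (cat_comp h hf hg).
- move=> /lcop_map hf /lcop_map hg; apply/lcop_map; exact: (cat_comb h a hf hg).
move=> /lcop_map hd /lcop_map hf df.
have [g [hg gE]] := cat_factor h (lcop_injective hE) hd hf df.
by exists g; split=> //; apply/lcop_map.
Qed.

(** The cofree left comodule C ⊗ V appears as V ⊗ C with flipped coaction, so the elements of [A]
    are evaluated on the right-hand factor in both resolutions. *)
Lemma lcofree_resolution (X : glcomodule C) :
  bounded_above C -> bounded_above X ->
  exists (I : @inj_resolution k (lcomodule_cat C) X) (V : nat -> gvect k),
    forall n, bounded_above (V n) /\ res I n = rcop (cofree cop (V n)).
Proof.
move=> Cb Xb.
have [I [V hV]] := @cofree_resolution k cop (lcop X) Cb Xb.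
exists (@InjResolution k (lcomodule_cat C) X (fun n => rcop (res I n)) (res_aug I)
  (@res_d _ _ _ I) ((lrcop_map _).2 (res_aug_hom I))
  (fun n => (rcop_map _).1 (@res_d_hom _ _ _ I n)) (@res_aug_inj _ _ _ I)
  (@res_exact0 _ _ _ I) (@res_exact _ _ _ I)
  (fun n => rcop_injective (@res_injective _ _ _ I n))).
by exists V => n; have [? e] := hV n; split=> //=; rewrite e.
Qed.
End Opposite.

(** * Bimodules and evaluation on the dual *)

Section Bimodules.
Variables (k : fieldType) (A : galgebra k).
Implicit Types B : gbimodule A.

(** In degree 0 the Koszul sign is 1, so the rule for the left action extends linearly from
    homogeneous [a] to all [a]. *)
Lemma bimodule_map0P B B' (f : B -> B') : bimodule_map 0 f <->
  [/\ linear f, deg_map 0 f, forall a b, f (blact a b) = blact a (f b)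
    & forall b a, f (bract b a) = bract (f b) a].
Proof.
split=> -[fl fd fa fr]; split=> //; last by move=> i a b _; rewrite mul0r scale1r fa.
move=> a b; move: a; apply: homog_ext => [||i a ha].
- exact: lin_comp fl ((blact_bil B).1 b).
- exact: (blact_bil B').1.
by rewrite (fa i) // mul0r scale1r.
Qed.

Section Quotient.
Variables (B : gbimodule A) (S : subspace B).
Hypothesis Sg : forall i x, S x -> S (gproj i x).
Hypothesis Sl : forall a x, S x -> S (blact a x).
Hypothesis Sr : forall a x, S x -> S (bract x a).
Let Q := gquot Sg.
Let cl : B -> Q := qcls S.
Let cl_lin : linear cl := @qcls_lin _ _ S.
Let al a : linear (fun x => cl (blact a x)) := lin_comp cl_lin ((blact_bil B).2 a).
Let ar a : linear (fun x => cl (bract x a)) := lin_comp cl_lin ((bract_bil B).1 a).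
Let l0 a x : S x -> cl (blact a x) = 0.
Proof. by move=> Sx; apply/qcls_eq0/Sl. Qed.
Let r0 a x : S x -> cl (bract x a) = 0.
Proof. by move=> Sx; apply/qcls_eq0/Sr. Qed.

Definition bquot_lact (a : A) : Q -> Q := qind (fun x => cl (blact a x)).
Definition bquot_ract (q : Q) (a : A) : Q := qind (fun x => cl (bract x a)) q.

Lemma bquot_lactE a x : bquot_lact a (cl x) = cl (blact a x).
Proof. exact: (qindE (@al a) (@l0 a)). Qed.
Lemma bquot_ractE x a : bquot_ract (cl x) a = cl (bract x a).
Proof. exact: (qindE (@ar a) (@r0 a)). Qed.

Fact bquot_lact_bil : bilinear_map bquot_lact.
Proof.
split=> [q|a]; last exact: (qind_lin (@al a) (@l0 a)).
elim/(@quot_ind _ _ S): q => x c a b.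
by rewrite !bquot_lactE ((blact_bil B).1 x) cl_lin.
Qed.
Fact bquot_ract_bil : bilinear_map bquot_ract.
Proof.
split=> [a|q]; first exact: (qind_lin (@ar a) (@r0 a)).
elim/(@quot_ind _ _ S): q => x c a b.
by rewrite !bquot_ractE ((bract_bil B).2 x) cl_lin.
Qed.
Fact bquot_lactA a b q : bquot_lact (gmul a b) q = bquot_lact a (bquot_lact b q).
Proof.
by elim/(@quot_ind _ _ S): q => x; rewrite (bquot_lactE b x) !bquot_lactE blactA.
Qed.
Fact bquot_lact1 q : bquot_lact (gone A) q = q.
Proof. by elim/(@quot_ind _ _ S): q => x; rewrite !bquot_lactE blact1. Qed.
Fact bquot_ractA q a b : bquot_ract q (gmul a b) = bquot_ract (bquot_ract q a) b.
Proof.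
by elim/(@quot_ind _ _ S): q => x; rewrite (bquot_ractE x a) !bquot_ractE bractA.
Qed.
Fact bquot_ract1 q : bquot_ract q (gone A) = q.
Proof. by elim/(@quot_ind _ _ S): q => x; rewrite !bquot_ractE bract1. Qed.
Fact bquot_lractA a q b :
  bquot_ract (bquot_lact a q) b = bquot_lact a (bquot_ract q b).
Proof.
by elim/(@quot_ind _ _ S): q => x; rewrite -/(cl x) (bquot_lactE a x)
  (bquot_ractE (blact a x)) (bquot_ractE x) (bquot_lactE a (bract x b)) blractA.
Qed.
Let cl_homog i x : homog i x -> homog i (cl x).
Proof. by move=> hx; have := qcls_deg Sg hx; rewrite addr0. Qed.
Fact bquot_lact_deg i j a (q : Q) :
  homog i a -> homog j q -> homog (i + j) (bquot_lact a q).
Proof.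
move=> ha /gquot_homogP[x hx ->]; rewrite bquot_lactE.
by apply: cl_homog; apply: blact_deg.
Qed.
Fact bquot_ract_deg i j (q : Q) a :
  homog i q -> homog j a -> homog (i + j) (bquot_ract q a).
Proof.
move=> /gquot_homogP[x hx ->] ha; rewrite bquot_ractE.
by apply: cl_homog; apply: bract_deg.
Qed.

Definition bquot : gbimodule A :=
  GBimodule bquot_lact_bil bquot_lactA bquot_lact1 bquot_lact_deg
    bquot_ract_bil bquot_ractA bquot_ract1 bquot_ract_deg bquot_lractA.

Lemma bquot_ind_map B' (f : B -> B') : bimodule_map 0 f ->
  (forall x, S x -> f x = 0) -> bimodule_map (B := bquot) 0 (qind f).
Proof.
move=> /bimodule_map0P[fl fd fa fr] f0; apply/bimodule_map0P.
split; [exact: qind_lin|exact: (@qind_deg _ _ _ Sg B' 0 f fl f0 fd)| |].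
- move=> a q; elim/(@quot_ind _ _ S): q => x.
  transitivity (qind f (cl (blact a x))); first by rewrite -bquot_lactE.
  by rewrite !qindE.
- move=> q a; elim/(@quot_ind _ _ S): q => x.
  transitivity (qind f (cl (bract x a))); first by rewrite -bquot_ractE.
  by rewrite !qindE.
Qed.
End Quotient.

Lemma bimodule_exact_cat : exact_cat (bimodule_cat A).
Proof.
split=> [X|X Y Z f g|X Y a f g|X Y E d f hE hd hf df].
- by apply/bimodule_map0P; split=> //; apply: deg_map_id.
- exact: bimodule_map_comp.
- exact: (@bimodule_mapP k A X Y 0).
have /bimodule_map0P[dl dd dla dra] := hd.
have Sl a x : kernel dl x -> kernel dl (blact a x).
  by move=> /= h; rewrite dla h (lin0 ((blact_bil Y).2 a)).
have Sr a x : kernel dl x -> kernel dl (bract x a).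
  by move=> /= h; rewrite dra h (lin0 ((bract_bil Y).1 a)).
pose Q := bquot (kernel_graded (hd := dl) dd) Sl Sr.
have hqd : bimodule_map (B := Q) 0 (qind d) by exact: bquot_ind_map.
have hqf : bimodule_map (B := Q) 0 (qind f) by exact: bquot_ind_map.
have [g [hg gE]] := hE Q Y _ _ hqd (@qind_kernel_inj _ _ _ _ dl) hqf.
exists g; split=> // x; have := gE (qcls _ x).
by rewrite !qindE //; case: hf.
Qed.
End Bimodules.

Section DualEvaluation.
Variables (k : fieldType) (A : galgebra k).
Notation DA := (gdual A).

(** The coproduct [G] and the product [m] dual to it are parameters: for [C] the product is
    [gmul b a], for the opposite coalgebra it is [gmul a b]. *)
Lemma tev_comul (M : lmodType k) (G : DA -> gtens DA DA) (m : A -> A -> A)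
    (z : tens M DA) a b : linear G ->
  (forall phi, dual_app (tev (G phi) a) b = dual_app phi (m a b)) ->
  tev (tev (tassocV (tmap id G z)) a) b = tev z (m a b).
Proof.
move=> hG GE; move: z; apply: tens_ext => [||v phi].
- apply: (lin_comp (@tev_lin _ _ _ b)); apply: (lin_comp (@tev_lin _ _ _ a)).
  exact: lin_comp (@tassocV_lin _ _ _ _) (tmap_lin (@lin_id _ _) hG).
- exact: tev_lin.
rewrite tmapE // tevE -GE; move: (G phi).
apply: (tens_ext (f := fun w => tev (tev (tassocV (v ⊗ w)) a) b)
  (g := fun w : tens DA DA => dual_app (tev w a) b *: v)) => [||p q].
- by move=> c x y; rewrite tmul_linr tassocV_lin (@tev_lin _ _ _ a c) (@tev_lin _ _ _ b c).
- move=> c x y; rewrite (@tev_lin _ _ _ a c) (@dual_app_linl _ _ b c).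
  by rewrite scalerDl scalerA.
- rewrite tassocVE !tevE (linZ (@tev_lin _ _ _ b)) tevE.
  by rewrite (linZ (@dual_app_linl _ _ b)) scalerA.
Qed.

Lemma tev_tmap (M M' : lmodType k) (f : M -> M') (z : tens M DA) a : linear f ->
  tev (tmap f id z) a = f (tev z a).
Proof.
move=> hf; move: z; apply: tens_ext => [||m phi].
- exact: lin_comp (@tev_lin _ _ _ a) (tmap_lin hf (@lin_id _ _)).
- exact: lin_comp hf (@tev_lin _ _ _ a).
by rewrite tmapE // !tevE (linZ hf).
Qed.

(** Coassociativity, evaluated at two elements of [A], becomes associativity of the action
    [tev (D x) a]. *)
Lemma tev_coassoc (M : lmodType k) (D : M -> tens M DA) (G : DA -> gtens DA DA)
    (m : A -> A -> A) x a b : linear D -> linear G ->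
  (forall phi, dual_app (tev (G phi) a) b = dual_app phi (m a b)) ->
  tassoc (tmap D id (D x)) = tmap id G (D x) ->
  tev (D (tev (D x) a)) b = tev (D x) (m a b).
Proof.
move=> hD hG GE e; rewrite -(tev_comul (D x) hG GE) -e -tev_tmap //.
congr (tev (tev _ _) _); move: (tmap D id (D x)); apply: tens3_ext => [||u v w].
- exact: lin_id.
- exact: lin_comp (@tassocV_lin _ _ _ _) (@tassoc_lin _ _ _ _).
by rewrite tassocE tassocVE.
Qed.

Lemma tev_deg (M : gvect k) i a : homog i a ->
  deg_map (V := gtens M DA) (W := M) i (fun x => tev x a).
Proof.
move=> ha; apply: tens_deg_map; first exact: tev_lin.
move=> j l m phi hm hphi; rewrite tevE.
have [->|li] := eqVneq i (- l); first by rewrite addrK; apply: homogZ.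
have phi0 : dual_app phi a = 0 := (gdual_homogP l phi).1 hphi i a ha li.
by rewrite phi0 scale0r; apply: homog0.
Qed.

Lemma tev_exchange (w : tens DA DA) a b :
  dual_app (tevl w a) b = dual_app (tev w b) a.
Proof.
move: w; apply: tens_ext => [||p q].
- exact: lin_comp (@dual_app_linl _ _ b) (@tevl_lin _ _ _ a).
- exact: lin_comp (@dual_app_linl _ _ a) (@tev_lin _ _ _ b).
rewrite tevE tevlE !(linZ (@dual_app_linl _ _ _)).
by rewrite [LHS]mulrC.
Qed.

(** After reassociation to (U ⊗ W) ⊗ DA the hypothesis says that all evaluations of the tensor
    vanish, and [tev_eq0] applies. *)
Lemma tmapr_tev_eq0 (U W : lmodType k) (z : tens U (tens W DA)) :
  (forall b : A, tmap id (fun x => tev x b) z = 0) -> z = 0.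
Proof.
move=> h; have E b : tev (tassocV z) b = tmap id (fun x => tev x b) z.
  have tl := @tev_lin _ A W b; move: (z); apply: tens_ext => [||u y].
  - exact: lin_comp (@tev_lin _ _ _ b) (@tassocV_lin _ _ _ _).
  - exact: tmap_lin.
  rewrite tmapE //; move: y; apply: tens_ext => [||w phi].
  - apply: (lin_comp (@tev_lin _ _ _ b)); apply: (lin_comp (@tassocV_lin _ _ _ _)).
    exact: tmul_linr.
  - exact: lin_comp (@tmul_linr _ _ _ u) tl.
  by rewrite tassocVE !tevE (linZ (@tmul_linr _ _ _ u)).
rewrite -[z]tassocVK (@tev_eq0 _ A _ (tassocV z)) ?(lin0 (@tassoc_lin _ _ _ _)) //.
by move=> b; rewrite E.
Qed.

Lemma tmapl_tev_eq0 (U W : lmodType k) (z : tens (tens W DA) U) :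
  (forall a : A, tmap (fun x => tev x a) id z = 0) -> z = 0.
Proof.
move=> h; apply: (can_inj (@tswapK _ _ _)); rewrite (lin0 (@tswap_lin _ _ _)).
apply: tmapr_tev_eq0 => a; rewrite -tswap_nat ?h ?(lin0 (@tswap_lin _ _ _)) //.
exact: tev_lin.
Qed.

Section Two.
Variables V W : gvect k.
Notation E := (gtens (gtens V DA) (gtens W DA)).

(** A tensor in (V ⊗ DA) ⊗ (W ⊗ DA) is studied through the bilinear map A × A → V ⊗ W that it
    defines; [ev2_eq0] and [ev2_surj] say that it is determined by this map and which maps occur. *)
Definition ev2 (a b : A) : E -> gtens V W :=
  tmap (fun x => tev x a) (fun y => tev y b).

Lemma ev2_lin a b : linear (ev2 a b).
Proof. exact: tmap_lin (@tev_lin _ _ _ a) (@tev_lin _ _ _ b). Qed.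

Lemma ev2_eq0 z : (forall a b, ev2 a b z = 0) -> z = 0.
Proof.
move=> h; apply: tmapr_tev_eq0 => b; apply: tmapl_tev_eq0 => a.
have la := @tev_lin _ A V a; have lb := @tev_lin _ A W b.
by rewrite tmap_comp //; apply: h.
Qed.

Lemma ev2_homog i j a b : homog i a -> homog j b -> deg_map (i + j) (ev2 a b).
Proof. by move=> ha hb; apply: tmap_degD; try exact: tev_lin; apply: tev_deg. Qed.

Lemma ev2_bil z : bilinear_map (fun a b => ev2 a b z).
Proof.
split=> [b|a] c x y; move: z; apply: tens_ext => [||v w].
- exact: ev2_lin.
- exact: lin_comb (ev2_lin _ _) (ev2_lin _ _).
- by rewrite /ev2 !tmapE ?tev_linr ?tmul_linl //; exact: tev_lin.
- exact: ev2_lin.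
- exact: lin_comb (ev2_lin _ _) (ev2_lin _ _).
- by rewrite /ev2 !tmapE ?tev_linr ?tmul_linr //; exact: tev_lin.
Qed.

Lemma bilinear_homog_ext (U : lmodType k) (f g : A -> A -> U) :
  bilinear_map f -> bilinear_map g ->
  (forall i j a b, homog i a -> homog j b -> f a b = g a b) ->
  forall a b, f a b = g a b.
Proof.
move=> [fl fr] [gl gr] e a b; move: a; apply: homog_ext => // i a ha.
move: b; apply: homog_ext => // j b hb; exact: e ha hb.
Qed.

Lemma ev2_inj z z' : (forall i j a b, homog i a -> homog j b -> ev2 a b z = ev2 a b z') ->
  z = z'.
Proof.
move=> h; apply/eqP; rewrite -subr_eq0; apply/eqP/ev2_eq0 => a b.
rewrite (linB (ev2_lin a b)) (bilinear_homog_ext (ev2_bil z) (ev2_bil z') h).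
by rewrite subrr.
Qed.

(** The tensor ((v ⊗ w) ⊗ φ) ⊗ ψ goes to (v ⊗ φ) ⊗ (w ⊗ ψ), without sign. *)
Definition interchange (z : tens (tens (tens V W) DA) DA) : E :=
  tassoc (tmap (fun t => tassocV (tmap id (@tswap _ _ _) (tassoc t))) id z).

Lemma ev2_interchange z a b : ev2 a b (interchange z) = tev (tev z b) a.
Proof.
have sl := @tswap_lin k W DA; have il := @lin_id k V.
have rl : linear (fun t : tens (tens V W) DA =>
    tassocV (tmap id (@tswap _ _ _) (tassoc t))).
  exact: lin_comp (@tassocV_lin _ _ _ _) (lin_comp (tmap_lin il sl) (@tassoc_lin _ _ _ _)).
have rll := tmap_lin rl (@lin_id k DA).
move: z; apply: tens3_ext => [||x phi psi].
- exact: lin_comp (ev2_lin a b) (lin_comp (@tassoc_lin _ _ _ _) rll).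
- exact: lin_comp (@tev_lin _ _ _ a) (@tev_lin _ _ _ b).
rewrite /interchange tmapE // tevE (linZ (@tev_lin _ _ _ a)) tevE; move: x.
apply: tens_ext => [||v w].
- move=> c x y; rewrite tmul_linl (@tassoc_lin _ _ _ _ c) (@tmap_lin _ _ _ _ _ _ _ il sl c).
  by rewrite tassocV_lin tmul_linl tassoc_lin ev2_lin.
- move=> c x y; rewrite !scalerDr !scalerA; congr (_ *: _ + _).
  by rewrite -!mulrA [RHS]mulrC -!mulrA.
rewrite tassocE tmapE // tswapE tassocVE tassocE /ev2 tmapE ?tevE; try exact: tev_lin.
by rewrite (linZ (@tmul_linl _ _ _ _)) (linZ (@tmul_linr _ _ _ _)) scalerA mulrC -scalerA.
Qed.

(** Surjectivity of [tev] is used twice: for fixed [b] it turns [beta^~ b] into a tensor [F b] in (V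
    ⊗ W) ⊗ DA, and then it turns [F] itself into a tensor. *)
Lemma ev2_surj (beta : A -> A -> tens V W) (s : seq int) : finite_type A ->
  bilinear_map beta ->
  (forall i a b, homog i a -> i \notin s -> beta a b = 0) ->
  (forall j a b, homog j b -> j \notin s -> beta a b = 0) ->
  exists z, forall a b, ev2 a b z = beta a b.
Proof.
move=> Aft [bl br] sa sb.
have ex b := cid (tev_surj (f := beta^~ b) Aft (bl b) (fun i a => @sa i a b)).
pose F b := sval (ex b); have FE b a : tev (F b) a = beta a b := svalP (ex b) a.
have Fl : linear F.
  by move=> c x y; apply: tev_inj => i a _; rewrite tev_lin !FE br.
have F0 j b : homog j b -> j \notin s -> F b = 0.
  by move=> hb js; apply: tev_eq0 => a; rewrite FE; apply: sb hb js.
have [z zE] := tev_surj Aft Fl F0.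
by exists (interchange z) => a b; rewrite ev2_interchange zE FE.
Qed.
End Two.
End DualEvaluation.

(** * Comodules as modules over the dual algebra *)

Section ComoduleActions.
Variables (k : fieldType) (A : galgebra k).
Hypotheses (A0 : nonneg_graded A) (Aft : finite_type A).
Notation DA := (gdual A).
Notation C := (dual_coalgebra A0 Aft).

Lemma dual_comul_tev phi a b :
  dual_app (tev (@comul k C phi) a) b = dual_app phi (gmul b a).
Proof. exact: dual_comulE. Qed.

Lemma dual_cop_tev phi a b :
  dual_app (tev (@comul k (cop C) phi) a) b = dual_app phi (gmul a b).
Proof.
rewrite -dual_comul_tev -tev_exchange; congr (dual_app _ _); exact: tevl_swap.
Qed.

Section Left.
Variable X : grcomodule C.

(** The inverse of the passage from modules to comodules. It applies to any comodule, hence to every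
    term of an arbitrary resolution. *)
Definition com_lact (a : A) (x : X) : X := tev (rcoact x) a.

Fact com_lact_bil : bilinear_map com_lact.
Proof.
split=> [x|a]; first exact: tev_linr.
exact: lin_comp (@tev_lin _ _ _ a) (@rcoact_lin _ _ X).
Qed.

Fact com_lactA a b x : com_lact (gmul a b) x = com_lact a (com_lact b x).
Proof.
apply/esym; apply: (@tev_coassoc _ _ _ _ (@comul k C) (fun a b => gmul b a)).
- exact: rcoact_lin.
- exact: (@comul_lin _ C).
- by move=> phi; apply: dual_comul_tev.
- exact: rcoactA.
Qed.

Fact com_lact1 x : com_lact (gone A) x = x.
Proof. exact: rcoact1. Qed.

Fact com_lact_deg i j a x : homog i a -> homog j x -> homog (i + j) (com_lact a x).
Proof.
move=> ha hx; have := @rcoact_deg _ _ X _ _ hx; rewrite addr0 => hy.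
by rewrite addrC; apply: (tev_deg (M := X) ha).
Qed.

Definition lmod : glmodule A := GLModule com_lact_bil com_lactA com_lact1 com_lact_deg.
End Left.

Lemma rcomodule_map_lact (X Y : grcomodule C) (f : X -> Y) a x : rcomodule_map f ->
  f (com_lact a x) = com_lact a (f x).
Proof. by move=> [fl fd fc]; rewrite /com_lact fc tev_tmap. Qed.

Section Right.
Variable Y : glcomodule C.

Definition com_ract (y : Y) (a : A) : Y := tevl (lcoact y) a.

Lemma com_ractE y a : com_ract y a = tev (@rcoact k (cop C) (lcop Y) y) a.
Proof. by rewrite /com_ract -tev_swap. Qed.

Fact com_ract_bil : bilinear_map com_ract.
Proof.
split=> [a|y]; first exact: lin_comp (@tevl_lin _ _ _ a) (@lcoact_lin _ _ Y).
by move=> c a b; rewrite !com_ractE tev_linr.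
Qed.

Fact com_ractA y a b : com_ract y (gmul a b) = com_ract (com_ract y a) b.
Proof.
rewrite !com_ractE; apply/esym.
apply: (@tev_coassoc _ _ _ _ (@comul k (cop C)) (@gmul k A)).
- exact: (@rcoact_lin _ _ (lcop Y)).
- exact: (@comul_lin _ (cop C)).
- by move=> phi; apply: dual_cop_tev.
- exact: (@rcoactA _ _ (lcop Y)).
Qed.

Fact com_ract1 y : com_ract y (gone A) = y.
Proof. exact: lcoact1. Qed.

Fact com_ract_deg i j y a : homog i y -> homog j a -> homog (i + j) (com_ract y a).
Proof.
move=> hy ha; have := @rcoact_deg _ _ (lcop Y) _ _ hy; rewrite addr0 => hz.
by rewrite com_ractE; apply: (tev_deg (M := Y) ha).
Qed.

Definition rmod : grmodule A := GRModule com_ract_bil com_ractA com_ract1 com_ract_deg.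
End Right.

Lemma lcomodule_map_ract (X Y : glcomodule C) (f : X -> Y) x a : lcomodule_map f ->
  f (com_ract x a) = com_ract (f x) a.
Proof.
move=> hf; have [fl _ fc] := hf; rewrite !com_ractE /= fc tswap_nat //.
by rewrite tev_tmap.
Qed.

Definition bimod (X : grcomodule C) (Y : glcomodule C) : gbimodule A :=
  tens_bimodule (lmod X) (rmod Y).

Lemma bimod_lactE (X : grcomodule C) (Y : glcomodule C) a (z : bimod X Y) :
  blact a z = tmap (@com_lact X a) id z.
Proof. by []. Qed.

Lemma bimod_ractE (X : grcomodule C) (Y : glcomodule C) (z : bimod X Y) a :
  bract z a = tmap id (fun y => @com_ract Y y a) z.
Proof. by []. Qed.

Lemma bimod_map (X X' : grcomodule C) (Y Y' : glcomodule C) (f : X -> X') (g : Y -> Y') :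
  rcomodule_map f -> lcomodule_map g ->
  bimodule_map (B := bimod X Y) (B' := bimod X' Y') 0 (tmap f g).
Proof.
move=> hf hg; have [fl fd _] := hf; have [gl gd _] := hg; apply/bimodule_map0P; split.
- exact: tmap_lin.
- exact: tmap_deg.
- move=> a z; have l1 := @lact_linr _ _ (lmod X) a; have l2 := @lact_linr _ _ (lmod X') a.
  rewrite [LHS]tmap_comp // [RHS]tmap_comp //.
  by congr (tmap _ _ _); apply/funext => x /=; apply: rcomodule_map_lact.
- move=> z a; have l1 := @ract_linl _ _ (rmod Y) a; have l2 := @ract_linl _ _ (rmod Y') a.
  rewrite [LHS]tmap_comp // [RHS]tmap_comp //.
  by congr (tmap _ _ _); apply/funext => x /=; apply: lcomodule_map_ract.
Qed.

Lemma tmap_middle_eq0 (U W : lmodType k) (z : tens U (tens DA W)) :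
  (forall a : A, tmap id (fun y => tevl y a) z = 0) -> z = 0.
Proof.
move=> h; have sl := @tswap_lin k DA W; have il := @lin_id k U.
apply: (tmap_inj il sl (@inj_id _) (can_inj (@tswapK _ _ _))).
rewrite (lin0 (tmap_lin il sl)); apply: tmapr_tev_eq0 => a.
rewrite tmap_comp //; last exact: tev_lin.
rewrite -[RHS](h a); congr (tmap _ _ _); apply/funext => y /=; exact: tev_swap.
Qed.

(** Evaluating the middle factor of X ⊗ C ⊗ Y at [a] turns the two sides of the cotensor condition
    into [a z] and [z a], and a tensor all of whose evaluations vanish is zero. *)
Lemma cotensorP (X : grcomodule C) (Y : glcomodule C) (z : bimod X Y) :
  cotensor X Y z <-> forall a, blact a z = bract z a.
Proof.
have xl := @rcoact_lin _ _ X; have yl := @lcoact_lin _ _ Y.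
have El a : tmap id (fun y => tevl y a) (tassoc (tmap (@rcoact _ _ X) id z)) =
    blact a z.
  have vl := @tevl_lin _ A Y a; have tl := tmap_lin (@lin_id _ X) vl.
  have xil := tmap_lin xl (@lin_id _ Y).
  have cl := @lact_linr _ _ (lmod X) a.
  rewrite bimod_lactE; move: (z : tens X Y); apply: tens_ext => [||x y].
  - exact: (lin_comp tl (lin_comp (@tassoc_lin _ _ _ _) xil)).
  - exact: tmap_lin.
  rewrite !tmapE // /com_lact; move: (rcoact x); apply: tens_ext => [||u phi].
  - apply: (lin_comp tl); apply: (lin_comp (@tassoc_lin _ _ _ _)); exact: tmul_linl.
  - exact: lin_comp (@tmul_linl _ _ _ y) (@tev_lin _ _ _ a).
  rewrite tassocE tmapE // tevE tevlE.
  by rewrite (linZ (@tmul_linl _ _ _ y)) (linZ (@tmul_linr _ _ _ u)).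
have Er a : tmap id (fun y => tevl y a) (tmap id (@lcoact _ _ Y) z) = bract z a.
  by rewrite tmap_comp //; apply: tevl_lin.
split=> [h a|h]; first by rewrite -El -Er; congr (tmap _ _ _); exact: h.
apply/eqP; rewrite -subr_eq0; apply/eqP/tmap_middle_eq0 => a.
have tl := tmap_lin (@lin_id _ X) (@tevl_lin _ A Y a).
by rewrite (linB tl) El Er h subrr.
Qed.

Section InjectiveBimodule.
Variables V W : gvect k.
Hypotheses (Vb : bounded_above V) (Wb : bounded_above W).
Let X := cofree C V.
Let Y := rcop (cofree (cop C) W).
Let E := bimod X Y.

Let lactE a (x : X) b : tev (com_lact a x) b = tev x (gmul b a).
Proof.
apply: (@tev_comul _ _ _ (@comul k C) (fun a b => gmul b a)); first exact: (@comul_lin _ C).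
by move=> phi; apply: dual_comul_tev.
Qed.

Let ractE (y : Y) a b : tev (com_ract y a) b = tev y (gmul a b).
Proof.
have -> : com_ract y a = tev (cofree_coact (C := cop C) y) a.
  exact: tevl_swap.
apply: (@tev_comul _ _ _ (@comul k (cop C)) (@gmul k A)).
  exact: (@comul_lin _ (cop C)).
by move=> phi; apply: dual_cop_tev.
Qed.

(** In terms of bilinear maps, [A] acts on the left by right translation of the first argument and
    on the right by left translation of the second: the structure of a coinduced bimodule. *)
Lemma ev2_lact a b c (z : E) : ev2 b c (blact a z) = ev2 (gmul b a) c z.
Proof.
have vl := @tev_lin _ A V b; have wl := @tev_lin _ A W c.
have l1 := @lact_linr _ _ (lmod X) a.
rewrite bimod_lactE /ev2 tmap_comp //; congr (tmap _ _ z).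
by apply/funext => x; apply: lactE.
Qed.

Lemma ev2_ract a b c (z : E) : ev2 b c (bract z a) = ev2 b (gmul a c) z.
Proof.
have vl := @tev_lin _ A V b; have wl := @tev_lin _ A W c.
have l1 := @ract_linl _ _ (rmod Y) a.
rewrite bimod_ractE /ev2 tmap_comp //; congr (tmap _ _ z).
by apply/funext => y; apply: ractE.
Qed.

(* Degreewise, (V ⊗ DA) ⊗ (DA ⊗ W) is the coinduced bimodule                *)
(* Hom(A ⊗ A, V ⊗ W).                                                       *)
Lemma cofree_bimod_injective : injective_object (D := bimodule_cat A) E.
Proof.
move=> P Q i f hi ii hf; have [il id _ _] := hi.
have /bimodule_map0P[_ _ ia ir] := hi; have /bimodule_map0P[fl fd fa fr] := hf.
(* A bimodule map into the coinduced bimodule is determined by its values at the pair (1, 1); so it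
   suffices to extend the linear map [h]. *)
pose h : P -> gtens V W := ev2 (gone A) (gone A) \o f.
have hl : linear h by apply: lin_comp fl; apply: ev2_lin.
have hd : deg_map 0 h.
  have ed := ev2_homog (V := V) (W := W) (gone_deg A) (gone_deg A).
  by have := deg_map_comp ed fd; rewrite !addr0.
have [g [gl gd gE]] := graded_extension il id ii hl hd.
have [n hn] := gtens_bounded Vb Wb.
(* This is the bilinear map that a bimodule map with value [g] at (1, 1) must assign to [y]. *)
pose beta y a b := g (blact a (bract y b)).
have beta_bil y : bilinear_map (beta y).
  split=> [b|a]; first exact: lin_comp gl ((blact_bil Q).1 _).
  apply: (lin_comp gl); apply: (lin_comp ((blact_bil Q).2 a)).
  exact: ((bract_bil Q).2 y).
have beta_lin a b : linear (beta^~ a ^~ b).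
  apply: (lin_comp gl); apply: (lin_comp ((blact_bil Q).2 a)).
  exact: ((bract_bil Q).1 b).
have beta_deg i1 i2 j a b y : homog i1 a -> homog i2 b -> homog j y ->
    homog (i1 + (j + i2)) (beta y a b).
  move=> ha hb hy; have := gd _ _ (blact_deg ha (bract_deg hy hb)).
  by rewrite addr0.
have ex y : exists z : E, forall a b, ev2 a b z = beta y a b.
  (* For [y] of degree [j] the value [beta y a b] has degree |a| + j + |b| and vanishes above [n].
     As |a| and |b| are nonnegative, each may be taken at most n - j, and [K] bounds this for all
     [j] in the support. *)
  pose K := \sum_(j <- gsupp y) `|n - j|.
  pose s := [seq Posz m | m <- iota 0 `|K|.+1].
  have sP i1 i2 a b : homog i1 a -> homog i2 b -> (i1 \notin s) || (i2 \notin s) ->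
      beta y a b = 0.
    move=> ha hb si; rewrite (gsuppE y) (lin_sum (beta_lin a b)) big_seq big1 //.
    move=> j yj; have hj := beta_deg _ _ _ _ _ _ ha hb (homog_gproj j y).
    have [i10|i10] := ltP i1 0.
      by rewrite /beta (A0 i10 ha) (lin0 ((blact_bil Q).1 _)) (lin0 gl).
    have [i20|i20] := ltP i2 0.
      rewrite /beta (A0 i20 hb) (lin0 ((bract_bil Q).2 _)).
      by rewrite (lin0 ((blact_bil Q).2 _)) (lin0 gl).
    apply: hn hj; have jK : `|n - j| <= K.
      rewrite /K (big_rem j) //= lerDl; apply: sumr_ge0 => l _; exact: normr_ge0.
    have nK (i' : int) : 0 <= i' -> i' \notin s -> ~~ (i' <= K).
      move=> i'0; apply: contra => iK; apply/mapP; exists `|i'|%N; last by lia.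
      by rewrite mem_iota; lia.
    by case/orP: si => /nK; [move/(_ i10)|move/(_ i20)]; lia.
  apply: (@ev2_surj _ _ _ _ (beta y) s Aft (beta_bil y)) => [i1 a b ha si|i2 a b hb si].
    move: b; apply: homog_ext => [||i2 b hb]; first exact: (beta_bil y).2.
      exact: lin_zero.
    by apply: sP ha hb _; rewrite si.
  move: a; apply: homog_ext => [||i1 a ha]; first exact: (beta_bil y).1.
    exact: lin_zero.
  by apply: sP ha hb _; rewrite si orbT.
pose G y : E := sval (cid (ex y)).
have GE y a b : ev2 a b (G y) = beta y a b := svalP (cid (ex y)) a b.
exists G; split; last first.
  move=> x; apply: ev2_inj => i1 i2 a b _ _.
  by rewrite GE /beta -ir -ia gE /h /= fa fr ev2_lact ev2_ract gmul1l gmul1r.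
apply/bimodule_map0P; split.
- move=> c x y; apply: ev2_inj => i1 i2 a b _ _.
  by rewrite (ev2_lin a b c) !GE beta_lin.
- apply: deg_map0 => j y hy; apply: ev2_inj => i1 i2 a b ha hb.
  rewrite (deg_map_gproj (ev2_lin a b) (ev2_homog ha hb)) GE.
  have := beta_deg _ _ _ _ _ _ ha hb hy; rewrite /homog.
  by rewrite addrCA.
- move=> c y; apply: ev2_inj => i1 i2 a b _ _.
  by rewrite ev2_lact !GE /beta blractA blactA.
- move=> y c; apply: ev2_inj => i1 i2 a b _ _.
  by rewrite ev2_ract !GE /beta bractA.
Qed.
End InjectiveBimodule.
End ComoduleActions.

(** * Total bimodules *)

Section Total.
Variables (k : fieldType) (A : galgebra k).
Implicit Types B : nat -> nat -> gbimodule A.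

Notation family B := (dprod (fun i => dprod (fun j => gv_sort (gbm (B i j))))).

(** The direct sum over i + j = n is taken inside the families over all pairs. This avoids transport
    along equations i + j = n and agrees with the total complex that defines [Cotor]. *)
Definition diag_mem B (n : nat) (x : family B) : Prop :=
  forall i j, (i + j)%N != n -> x i j = 0.
Fact diag_mem0 B n : diag_mem n (0 : family B).
Proof. by []. Qed.
Fact diag_memP B n a (x y : family B) :
  diag_mem n x -> diag_mem n y -> diag_mem n (a *: x + y).
Proof.
move=> hx hy i j ij; change (a *: x i j + y i j = 0).
by rewrite hx // hy // scaler0 addr0.
Qed.
Definition diag B n : subspace (family B) := Subspace (@diag_mem0 B n) (@diag_memP B n).

Definition dcomp B n (x : subv (diag B n)) i j : B i j := subv_val x i j.

Lemma dcomp_lin B n i j : linear (fun x : subv (diag B n) => dcomp x i j).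
Proof. by []. Qed.

Lemma dcomp0 B n (x : subv (diag B n)) i j : (i + j)%N != n -> dcomp x i j = 0.
Proof. exact: (subvP x). Qed.

Lemma diag_ext B n (x y : subv (diag B n)) :
  (forall i j, dcomp x i j = dcomp y i j) -> x = y.
Proof.
move=> e; apply: val_inj; apply: functional_extensionality_dep => i.
by apply: functional_extensionality_dep => j; apply: e.
Qed.

Section Map.
Variables (B B' : nat -> nat -> gbimodule A) (n : nat) (F : forall i j, B i j -> B' i j).
Hypothesis Fl : forall i j, linear (@F i j).

Fact diag_map_mem (x : subv (diag B n)) :
  diag B' n (fun i j => F (dcomp x i j)).
Proof. by move=> i j ij; rewrite dcomp0 // (lin0 (@Fl i j)). Qed.

Definition diag_map (x : subv (diag B n)) : subv (diag B' n) :=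
  subv_of (diag_map_mem x).

Lemma diag_mapE x i j : dcomp (diag_map x) i j = F (dcomp x i j).
Proof. by []. Qed.

Lemma diag_map_lin : linear diag_map.
Proof. by move=> a x y; apply: diag_ext => i j; apply: (@Fl i j). Qed.
End Map.

Section Object.
Variables (B : nat -> nat -> gbimodule A) (n : nat).
Notation Tn := (subv (diag B n)).

Definition tot_proj (p : int) : Tn -> Tn :=
  diag_map (fun i j => @gproj_lin _ (B i j) p).

Fact tot_proj_lin p : linear (tot_proj p).
Proof. exact: diag_map_lin. Qed.

Fact tot_projK p q x :
  tot_proj p (tot_proj q x) = if p == q then tot_proj q x else 0.
Proof.
apply: diag_ext => i j; rewrite !diag_mapE gprojK.
by case: eqP.
Qed.

Fact tot_proj_fin x : exists s : seq int, uniq s /\ x = \sum_(p <- s) tot_proj p x.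
Proof.
(* Only the components (i, n - i) with i at most n can be nonzero, so the union of their supports is
   finite. *)
pose s := undup (flatten [seq gsupp (dcomp x i (n - i)) | i <- iota 0 n.+1]).
exists s; split; first exact: undup_uniq.
apply: diag_ext => i j; rewrite (lin_sum (@dcomp_lin B n i j)).
have [ijn|ij] := eqVneq (i + j)%N n; last first.
  by rewrite dcomp0 // big1 // => p _; rewrite diag_mapE dcomp0 // gproj0.
have -> : j = (n - i)%N by lia.
rewrite {1}(gsuppE (dcomp x i (n - i))); apply/esym.
apply: sum_widen => [|||p]; [exact: gsupp_uniq|exact: undup_uniq| |exact: gsuppN].
move=> p px; rewrite mem_undup; apply/flattenP.
exists (gsupp (dcomp x i (n - i))) => //; apply/mapP; exists i => //.
by rewrite mem_iota; lia.
Qed.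

Definition tot_gvect : gvect k := GVect tot_proj_lin tot_projK tot_proj_fin.

Lemma tot_homogP p (x : tot_gvect) :
  homog p x <-> forall i j, homog (V := B i j) p (dcomp x i j).
Proof.
split=> [h i j|h]; first by rewrite /homog -[in RHS]h.
by apply: diag_ext => i j; rewrite diag_mapE; apply: h.
Qed.

Definition tot_lact (a : A) : tot_gvect -> tot_gvect :=
  diag_map (fun i j => (blact_bil (B i j)).2 a).
Definition tot_ract (x : tot_gvect) (a : A) : tot_gvect :=
  diag_map (fun i j => (bract_bil (B i j)).1 a) x.

Fact tot_lact_bil : bilinear_map tot_lact.
Proof.
split=> [x|a]; last exact: diag_map_lin.
by move=> c a b; apply: diag_ext => i j; apply: (blact_bil (B i j)).1.
Qed.
Fact tot_ract_bil : bilinear_map tot_ract.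
Proof.
split=> [a|x]; first exact: diag_map_lin.
by move=> c a b; apply: diag_ext => i j; apply: (bract_bil (B i j)).2.
Qed.
Fact tot_lactA a b x : tot_lact (gmul a b) x = tot_lact a (tot_lact b x).
Proof. by apply: diag_ext => i j; apply: blactA. Qed.
Fact tot_lact1 x : tot_lact (gone A) x = x.
Proof. by apply: diag_ext => i j; apply: blact1. Qed.
Fact tot_ractA x a b : tot_ract x (gmul a b) = tot_ract (tot_ract x a) b.
Proof. by apply: diag_ext => i j; apply: bractA. Qed.
Fact tot_ract1 x : tot_ract x (gone A) = x.
Proof. by apply: diag_ext => i j; apply: bract1. Qed.
Fact tot_lractA a x b : tot_ract (tot_lact a x) b = tot_lact a (tot_ract x b).
Proof. by apply: diag_ext => i j; apply: blractA. Qed.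
Fact tot_lact_deg p q a (x : tot_gvect) :
  homog p a -> homog q x -> homog (p + q) (tot_lact a x).
Proof.
by move=> ha /tot_homogP hx; apply/tot_homogP => i j; apply: blact_deg (hx i j).
Qed.
Fact tot_ract_deg p q (x : tot_gvect) a :
  homog p x -> homog q a -> homog (p + q) (tot_ract x a).
Proof.
by move=> /tot_homogP hx ha; apply/tot_homogP => i j; apply: bract_deg (hx i j) ha.
Qed.

Definition tot_bimod : gbimodule A :=
  GBimodule tot_lact_bil tot_lactA tot_lact1 tot_lact_deg
    tot_ract_bil tot_ractA tot_ract1 tot_ract_deg tot_lractA.

Lemma tot_comp_map i j : bimodule_map (B := tot_bimod) (B' := B i j) 0
  (fun x => dcomp x i j).
Proof. by apply/bimodule_map0P; split=> //; apply: deg_map0 => p x /tot_homogP. Qed.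

Lemma tot_map_into (P : gbimodule A) (g : P -> tot_bimod) :
  (forall i j, bimodule_map (B' := B i j) 0 (fun y => dcomp (g y) i j)) ->
  bimodule_map 0 g.
Proof.
move=> gP; have hg i j := (bimodule_map0P _).1 (gP i j); apply/bimodule_map0P; split.
- by move=> a x y; apply: diag_ext => i j; have [h _ _ _] := hg i j; apply: h.
- by move=> p x hx; apply/tot_homogP => i j; have [_ h _ _] := hg i j; apply: h.
- by move=> a x; apply: diag_ext => i j; have [_ _ h _] := hg i j; apply: h.
- by move=> x a; apply: diag_ext => i j; have [_ _ _ h] := hg i j; apply: h.
Qed.

Lemma tot_injective :
  (forall i j, injective_object (D := bimodule_cat A) (B i j)) ->
  injective_object (D := bimodule_cat A) tot_bimod.
Proof.
move=> hB P Q u f hu ui hf.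
pose F i j x : B i j := dcomp (f x) i j.
have hF i j : bimodule_map 0 (F i j) by apply: bimodule_map_comp (tot_comp_map i j) hf.
pose G i j := sval (cid (hB i j P Q u (F i j) hu ui (hF i j))).
have GP i j : bimodule_map 0 (G i j) /\ forall x, G i j (u x) = F i j x.
  exact: (svalP (cid (hB i j P Q u (F i j) hu ui (hF i j)))).
(* Extensions are chosen at all pairs, and reset to 0 off the antidiagonal so that the family lands
   in [diag]. *)
pose H i j y : B i j := if (i + j)%N == n then G i j y else 0.
have Hm y : diag B n (fun i j => H i j y).
  by move=> i j /negbTE ij; rewrite /H ij.
exists (fun y => subv_of (Hm y) : tot_bimod); split; last first.
  move=> x; apply: diag_ext => i j; change (H i j (u x) = dcomp (f x) i j).
  rewrite /H; case: eqVneq => [_|ij]; first exact: (GP i j).2.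
  by rewrite dcomp0.
apply: tot_map_into => i j; change (bimodule_map 0 (H i j)).
have [h _] := GP i j; rewrite /H; case: eqP => // _.
exact: bimodule_map0.
Qed.
End Object.
End Total.

(** * The tensor product of two resolutions *)

Lemma tmap_sub (k : fieldType) (U U' V V' : lmodType k) (f g : U -> U') (h : V -> V') x :
  linear f -> linear g -> linear h ->
  tmap (fun x => f x - g x) h x = tmap f h x - tmap g h x.
Proof.
move=> hf hg hh; have -> : (fun x => f x - g x) = (fun x => (-1) *: g x + f x).
  by apply/funext => y; rewrite scaleN1r addrC.
by rewrite tmap_comb // scaleN1r addrC.
Qed.

Lemma tmap_subr (k : fieldType) (U U' V V' : lmodType k) (h : U -> U') (f g : V -> V') x :
  linear h -> linear f -> linear g ->
  tmap h (fun x => f x - g x) x = tmap h f x - tmap h g x.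
Proof.
move=> hh hf hg; have -> : (fun x => f x - g x) = (fun x => (-1) *: g x + f x).
  by apply/funext => y; rewrite scaleN1r addrC.
by rewrite tmap_combr // scaleN1r addrC.
Qed.

Section TensorResolution.
Variables (k : fieldType) (A : galgebra k).
Hypotheses (A0 : nonneg_graded A) (Aft : finite_type A).
Notation C := (dual_coalgebra A0 Aft).
Variables (X : rcomodule_cat C) (Y : lcomodule_cat C).
Variables (I : inj_resolution X) (J : inj_resolution Y).

Definition resB (i j : nat) : gbimodule A := bimod (I i) (J j).
Notation T := (dprod (fun i => dprod (fun j => tens (gunder (I i)) (gunder (J j))))).
Definition Tot n : gbimodule A := tot_bimod resB n.
Notation D := (tot_d (I := I) (J := J)).

Let dI i := @res_d _ _ _ I i.
Let dJ j := @res_d _ _ _ J j.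
Let dIl i : linear (@dI i) := @res_d_lin _ _ _ I i.
Let dJl j : linear (@dJ j) := @res_d_lin _ _ _ J j.

Lemma tot_dl_map n i j :
  bimodule_map (B := Tot n) (B' := resB i j) 0 (fun x => tot_dl (subv_val x) i j).
Proof.
case: i => [|i]; first exact: (@bimodule_map0 _ _ (Tot n) (resB 0 j) 0).
have h := bimod_map (@res_d_hom _ _ _ I i) (lcomodule_map_id (J j)).
exact: (bimodule_map_comp h (@tot_comp_map _ _ resB n i j)).
Qed.

Lemma tot_dr_map n i j :
  bimodule_map (B := Tot n) (B' := resB i j) 0 (fun x => tot_dr (subv_val x) i j).
Proof.
case: j => [|j]; first exact: (@bimodule_map0 _ _ (Tot n) (resB i 0) 0).
have h := bimod_map (rcomodule_map_id (I i)) (@res_d_hom _ _ _ J j).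
exact: (bimodule_map_comp h (@tot_comp_map _ _ resB n i j)).
Qed.

Lemma tot_d_diag n (x : T) : diag resB n x -> diag resB n.+1 (D x).
Proof.
move=> hx i j ij; have hl : tot_dl x i j = 0.
  case: i ij => [//|i]; rewrite addSn eqSS => /hx e /=; rewrite e.
  exact: (lin0 (tmap_lin (@dIl i) (@lin_id _ _))).
have hr : tot_dr x i j = 0.
  case: j ij {hl} => [//|j]; rewrite addnS eqSS => /hx e /=; rewrite e.
  exact: (lin0 (tmap_lin (@lin_id _ _) (@dJl j))).
by rewrite /tot_d hl hr scaler0 addr0.
Qed.

Definition Tot_d n (x : Tot n) : Tot n.+1 := subv_of (tot_d_diag (subvP x)).

Lemma Tot_d_map n : bimodule_map 0 (@Tot_d n).
Proof.
apply: tot_map_into => i j.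
have := bimodule_mapP ((-1) ^+ i) (@tot_dr_map n i j) (@tot_dl_map n i j).
by congr (bimodule_map 0); apply/funext => x; rewrite addrC.
Qed.

Lemma Tot_eq0 n (x : Tot n) : x = 0 <-> subv_val x = 0 :> T.
Proof. by split=> [->//|e]; apply: val_inj. Qed.

Lemma Tot_dd n (x : Tot n) : Tot_d (Tot_d x) = 0.
Proof. by apply/Tot_eq0; apply: tot_dd. Qed.

Definition aug_comp (x : tens (gunder X) (gunder Y)) : T := fun i j =>
  match i, j with
  | 0, 0 => tmap (res_aug I) (res_aug J) x
  | _, _ => 0
  end.

Fact aug_diag x : diag resB 0 (aug_comp x).
Proof. by move=> [|i] [|j]. Qed.

Definition Tot_aug (x : bimod X Y) : Tot 0 := subv_of (aug_diag x).

Lemma Tot_aug_map : bimodule_map 0 Tot_aug.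
Proof.
apply: tot_map_into => -[|i] [|j].
- exact: bimod_map (res_aug_hom I) (res_aug_hom J).
- exact: (@bimodule_map0 _ _ (bimod X Y) (resB 0 j.+1) 0).
- exact: (@bimodule_map0 _ _ (bimod X Y) (resB i.+1 0) 0).
- exact: (@bimodule_map0 _ _ (bimod X Y) (resB i.+1 j.+1) 0).
Qed.

Let augIl : linear (res_aug I) := ghom_lin (res_aug_hom I).
Let augJl : linear (res_aug J) := ghom_lin (res_aug_hom J).

Lemma Tot_aug_inj : injective Tot_aug.
Proof.
move=> x y /(congr1 (fun z : Tot 0 => dcomp z 0 0)).
exact: (tmap_inj augIl augJl (@res_aug_inj _ _ _ I) (@res_aug_inj _ _ _ J)).
Qed.

Lemma Tot_d_aug x : Tot_d (Tot_aug x) = 0.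
Proof.
have dIa y : @dI 0 (res_aug I y) = 0 by apply/res_exact0; exists y.
have dJa y : @dJ 0 (res_aug J y) = 0 by apply/res_exact0; exists y.
have il V := @lin_id k V.
apply: diag_ext => i j.
change (tot_dl (aug_comp x) i j + ((-1) ^+ i : k) *: tot_dr (aug_comp x) i j = 0).
have -> : tot_dl (aug_comp x) i j = 0.
  case: i j => [//|[|i]] [|j]; try exact: (lin0 (tmap_lin (@dIl _) (il _))).
  change (tmap (@dI 0) id (tmap (res_aug I) (res_aug J) x) = 0).
  by rewrite tmap_comp //; apply: tmap0l.
have -> : tot_dr (aug_comp x) i j = 0.
  case: j i => [//|[|j]] [|i]; try exact: (lin0 (tmap_lin (il _) (@dJl _))).
  change (tmap id (@dJ 0) (tmap (res_aug I) (res_aug J) x) = 0).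
  by rewrite tmap_comp //; apply: tmap0r.
by rewrite scaler0 addr0.
Qed.

(* If s and s' contract I and J, then s ⊗ 1 contracts the double complex onto *)
(* the column M ⊗ J, which s' contracts in turn.                            *)
Section Exactness.
Variables (r : gunder (I 0) -> gunder X) (s : forall n, gunder (I n.+1) -> gunder (I n)).
Variables (r' : gunder (J 0) -> gunder Y) (s' : forall n, gunder (J n.+1) -> gunder (J n)).
Hypotheses (rl : linear r) (sl : forall n, linear (@s n)).
Hypothesis sl' : forall n, linear (@s' n).
Hypothesis s0 : forall x, @s 0 (@dI 0 x) = x - res_aug I (r x).
Hypothesis sS : forall n x, @s n.+1 (@dI n.+1 x) = x - @dI n (@s n x).
Hypothesis s0' : forall x, @s' 0 (@dJ 0 x) = x - res_aug J (r' x).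
Hypothesis sS' : forall n x, @s' n.+1 (@dJ n.+1 x) = x - @dJ n (@s' n x).

Let il V := @lin_id k V.
Let e := res_aug I \o r.
Let e' := res_aug J \o r'.
Let el : linear e := lin_comp augIl rl.

Definition contr1 (z : T) : T := fun i j => tmap (@s i) id (z i.+1 j).
Definition contr2 (z : T) : T := fun i j =>
  match i with
  | 0 => tmap e (@s' j) (z 0 j.+1)
  | _ => 0
  end.

Variable z : T.
Hypothesis dz : D z = 0.
Let dzE i j : tot_dl z i j + ((-1) ^+ i : k) *: tot_dr z i j = 0.
Proof. by have /(congr1 (fun u : T => u i j)) := dz. Qed.

(** Apply s ⊗ 1 to the component (1, j) of [D z = 0]. The sign of column 1 turns the J-differential
    of [contr1 z] into s d ⊗ 1 applied to [z 0 j], and s d = 1 - e. *)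
Lemma tot_d_contr1_0 j : D (contr1 z) 0 j = z 0 j - tmap e id (z 0 j).
Proof.
have := congr1 (tmap (@s 0) id) (dzE 1 j).
have sil := tmap_lin (@sl 0) (@il (J j)); rewrite (linD sil) (linZ sil) (lin0 sil).
rewrite expr1 scaleN1r => /eqP; rewrite subr_eq0 => /eqP h.
rewrite /tot_d /= add0r expr0 scale1r.
transitivity (tmap (@s 0) id (tot_dr z 1 j)).
  case: j {h sil} => [|j] /=; first by rewrite (lin0 (tmap_lin (@sl 0) (@il _))).
  by rewrite !tmap_comp //; (exact: (@dJl j) || exact: (@sl _)).
rewrite -h /= tmap_comp //; try (exact: (@dIl 0) || exact: (@sl _)).
have -> : @s 0 \o res_d (i:=I) (n:=0) = (fun x => x - e x) by apply/funext => x; apply: s0.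
by rewrite tmap_sub // tmap_id.
Qed.

(** The same computation in a positive column, where s d = 1 - d s: the J-part contributes [z] minus
    the term d s ⊗ 1, which the I-part restores. *)
Lemma tot_d_contr1_S i j : D (contr1 z) i.+1 j = z i.+1 j.
Proof.
have := congr1 (tmap (@s i.+1) id) (dzE i.+2 j).
have sil := tmap_lin (@sl i.+1) (@il (J j)); rewrite (linD sil) (linZ sil) (lin0 sil).
rewrite exprS mulN1r scaleNr => /eqP; rewrite subr_eq0 => /eqP h.
rewrite /tot_d /=.
have -> : ((-1) ^+ i.+1 : k) *: tot_dr (contr1 z) i.+1 j =
    tmap (@s i.+1) id (tot_dl z i.+2 j).
  rewrite h; congr (_ *: _).
  case: j {h sil} => [|j] /=; first by rewrite (lin0 (tmap_lin (@sl i.+1) (@il _))).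
  by rewrite !tmap_comp //; (exact: (@dJl j) || exact: (@sl _)).
rewrite /= /contr1 !tmap_comp //; try (exact: (@dIl _) || exact: (@sl _)).
have -> : @s i.+1 \o res_d (i:=I) (n:=i.+1) = (fun x => x - @dI i (@s i x)).
  by apply/funext => x; apply: sS.
rewrite tmap_sub //; last exact: lin_comp (@dIl i) (@sl i).
by rewrite tmap_id addrC subrK.
Qed.

Lemma tot_dr_col0 j : tmap id (@dJ j) (z 0 j) = 0.
Proof. by have := dzE 0 j.+1; rewrite /= add0r expr0 scale1r. Qed.

(** The values of [e] lie in the image of the augmentation, which the I-differential kills; so only
    the J-direction remains, where column 0 of [z] consists of J-cocycles. *)
Lemma tot_d_contr2 i j : D (contr2 z) i j =
  match i with 0 => if j is 0 then 0 else tmap e id (z 0 j) | _ => 0 end.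
Proof.
have dIa y : @dI 0 (res_aug I y) = 0 by apply/res_exact0; exists y.
rewrite /tot_d; have -> : tot_dl (contr2 z) i j = 0.
  case: i => [//|[|i]] /=; last exact: (lin0 (tmap_lin (@dIl _) (@il _))).
  rewrite tmap_comp //; try (exact: (@dIl 0) || exact: (@sl' _)).
  by apply: tmap0l => [v|]; [exact: dIa|exact: (@sl' _)].
rewrite add0r; case: i => [|i]; last first.
  by case: j => [|j] /=; rewrite ?(lin0 (tmap_lin (@il _) (@dJl _))) scaler0.
rewrite expr0 scale1r; case: j => [//|j] /=.
rewrite tmap_comp //; try (exact: (@dJl j) || exact: (@sl' _)).
have -> : res_d (i:=J) (n:=j) \o @s' j = (fun x => x - @s' j.+1 (@dJ j.+1 x)).
  by apply/funext => x; rewrite sS' opprB addrC subrK.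
have sdl := lin_comp (@sl' j.+1) (@dJl j.+1).
rewrite tmap_subr //.
have -> : tmap e (fun x => @s' j.+1 (@dJ j.+1 x)) (z 0 j.+1) = 0.
  have := congr1 (tmap e (@s' j.+1)) (tot_dr_col0 j.+1).
  rewrite (lin0 (tmap_lin el (@sl' _))) tmap_comp //;
    (exact: (@dJl j.+1) || exact: (@sl' _)).
by rewrite subr0; congr (tmap _ _ _).
Qed.

(** The part of column 0 missed by [contr1] is supplied by [contr2], except at the corner, where the
    remainder e ⊗ e' is the augmentation of r ⊗ r' applied to [z 0 0]. *)
Lemma tot_contraction i j :
  z i j = D (contr1 z + contr2 z) i j +
    match i, j with 0, 0 => tmap e e' (z 0 0) | _, _ => 0 end.
Proof.
rewrite (linD (@tot_d_lin _ _ _ _ I J)).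
change (z i j = D (contr1 z) i j + D (contr2 z) i j +
    match i, j with 0, 0 => tmap e e' (z 0 0) | _, _ => 0 end).
rewrite tot_d_contr2; case: i => [|i]; last by rewrite tot_d_contr1_S !addr0.
rewrite tot_d_contr1_0; case: j => [|j]; last by rewrite addr0 subrK.
rewrite addr0; have -> : tmap e e' (z 0 0) = tmap e id (z 0 0); last by rewrite subrK.
have -> : e' = (fun x => x - @s' 0 (@dJ 0 x)).
  by apply/funext => x; rewrite s0' opprB addrC subrK.
have sdl := lin_comp (@sl' 0) (@dJl 0); rewrite tmap_subr //.
have -> : tmap e (fun x => @s' 0 (@dJ 0 x)) (z 0 0) = 0.
  have := congr1 (tmap e (@s' 0)) (tot_dr_col0 0).
  rewrite (lin0 (tmap_lin el (@sl' _))) tmap_comp //; (exact: (@dJl 0) || exact: (@sl' _)).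
by rewrite subr0; congr (tmap _ _ _).
Qed.
End Exactness.

Lemma tot_d_corner w : D w 0 0 = 0.
Proof.
change (0 + ((-1) ^+ 0 : k) *: 0 = 0 :> tens (gunder (I 0)) (gunder (J 0))).
by rewrite scaler0 addr0.
Qed.

Lemma Tot_exact0 (y : Tot 0) : Tot_d y = 0 <-> exists x, y = Tot_aug x.
Proof.
split=> [/Tot_eq0 dy|[x ->]]; last exact: Tot_d_aug.
have [r [s [rl sl _ s0 sS]]] := resolution_contraction I.
have [r' [s' [rl' sl' _ s0' sS']]] := resolution_contraction J.
exists (tmap r r' (dcomp y 0 0)); apply: diag_ext => i j.
have [ij|/dcomp0 ij] := eqVneq (i + j)%N 0%N; last first.
  by rewrite ij; case: i j ij => [|i] [|j].
have [-> ->] : i = 0%N /\ j = 0%N by lia.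
have := tot_contraction rl sl sl' s0 sS s0' sS' dy 0 0.
rewrite tot_d_corner add0r => e; rewrite [LHS]e -tmap_comp //.
Qed.

Lemma Tot_exact n (y : Tot n.+1) : Tot_d y = 0 <-> exists x, y = Tot_d x.
Proof.
split=> [/Tot_eq0 dy|[x ->]]; last exact: Tot_dd.
have [r [s [rl sl _ s0 sS]]] := resolution_contraction I.
have [r' [s' [rl' sl' _ s0' sS']]] := resolution_contraction J.
pose z := subv_val y.
have hz : diag resB n.+1 z by exact: (subvP y).
have hc : diag resB n (contr1 s z + contr2 r s' z).
  move=> i j ij; change (contr1 s z i j + contr2 r s' z i j = 0).
  have il V := @lin_id k V.
  rewrite /contr1 hz ?(lin0 (tmap_lin (sl i) (il _))) ?add0r //.
  case: i ij => [|//] ij /=; rewrite hz //.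
  exact: (lin0 (tmap_lin (lin_comp augIl rl) (sl' j))).
exists (subv_of hc : Tot n); apply: diag_ext => i j.
have := tot_contraction rl sl sl' s0 sS s0' sS' dy i j.
rewrite -/z; case: i => [|i]; first case: j => [|j]; rewrite ?addr0 // => _.
(* In positive total degree the corner component of [z] is zero, so the remainder plays no part. *)
rewrite [LHS](hz 0%N 0%N) //; apply/esym/tot_d_corner.
Qed.
End TensorResolution.

(** * Homotopy invariance of Cotor *)

(** Discharges linearity of one member of a family from a hypothesis about all members. *)
Ltac from_context := try solve [match goal with H : _ |- _ => exact: H end].

Section TotalMaps.
Variables (k : fieldType) (C : gcoalgebra k).
Variables (M M' : rcomodule_cat C) (N N' : lcomodule_cat C).
Variables (I : inj_resolution M) (J : inj_resolution N).
Variables (I' : inj_resolution M') (J' : inj_resolution N').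
Notation T := (dprod (fun i => dprod (fun j => tens (gunder (I i)) (gunder (J j))))).
Notation T' :=
  (dprod (fun i => dprod (fun j => tens (gunder (I' i)) (gunder (J' j))))).
Notation D := (tot_d (I := I) (J := J)).
Notation D' := (tot_d (I := I') (J := J')).
Let dIl i : linear (@res_d _ _ _ I i) := @res_d_lin _ _ _ I i.
Let dJl j : linear (@res_d _ _ _ J j) := @res_d_lin _ _ _ J j.
Let dIl' i : linear (@res_d _ _ _ I' i) := @res_d_lin _ _ _ I' i.
Let dJl' j : linear (@res_d _ _ _ J' j) := @res_d_lin _ _ _ J' j.

Definition tot_tmap (U : forall i, gunder (I i) -> gunder (I' i))
    (V : forall j, gunder (J j) -> gunder (J' j)) (x : T) : T' :=
  fun i j => tmap (U i) (V j) (x i j).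

Lemma tot_d_tmap (U : forall i, gunder (I i) -> gunder (I' i))
    (V : forall j, gunder (J j) -> gunder (J' j)) x :
  (forall i, linear (U i)) -> (forall j, linear (V j)) ->
  (forall i x, U i.+1 (res_d x) = res_d (U i x)) ->
  (forall j x, V j.+1 (res_d x) = res_d (V j x)) ->
  D' (tot_tmap U V x) = tot_tmap U V (D x).
Proof.
move=> Ul Vl Ud Vd; apply: functional_extensionality_dep => i.
apply: functional_extensionality_dep => j; have UV i j := tmap_lin (Ul i) (Vl j).
rewrite /tot_d /tot_tmap (linD (UV i j)) (linZ (UV i j)); congr (_ + _ *: _).
  case: i => [|i] /=; first by rewrite (lin0 (UV 0%N j)).
  have := @dIl i; have := @dIl' i; have := Ul i; have := Ul i.+1; have := Vl j.
  move=> ? ? ? ? ?; rewrite !tmap_comp //.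
  by congr (tmap _ _ _); apply/funext => y /=; rewrite Ud.
case: j => [|j] /=; first by rewrite (lin0 (UV i 0%N)).
have := @dJl j; have := @dJl' j; have := Vl j; have := Vl j.+1; have := Ul i.
move=> ? ? ? ? ?; rewrite !tmap_comp //.
by congr (tmap _ _ _); apply/funext => y /=; rewrite Vd.
Qed.

Section Homotopy.
Variables (U U2 : forall i, gunder (I i) -> gunder (I' i)).
Variables (V V2 : forall j, gunder (J j) -> gunder (J' j)).
Variables (s : forall i, gunder (I i.+1) -> gunder (I' i)).
Variables (t : forall j, gunder (J j.+1) -> gunder (J' j)).
Hypotheses (Ul : forall i, linear (@U i)) (U2h : forall i, rcomodule_map (@U2 i)).
Hypotheses (Vh : forall j, lcomodule_map (@V j)) (V2l : forall j, linear (@V2 j)).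
Hypotheses (sh : forall i, rcomodule_map (@s i)) (th : forall j, lcomodule_map (@t j)).
Hypothesis U2d : forall i x, @U2 i.+1 (res_d x) = res_d (@U2 i x).
Hypothesis Vd : forall j x, @V j.+1 (res_d x) = res_d (@V j x).
Hypothesis s0 : forall x, @U 0 x - @U2 0 x = @s 0 (res_d x).
Hypothesis sS : forall i x,
  @U i.+1 x - @U2 i.+1 x = res_d (@s i x) + @s i.+1 (res_d x).
Hypothesis t0 : forall x, @V 0 x - @V2 0 x = @t 0 (res_d x).
Hypothesis tS : forall j x,
  @V j.+1 x - @V2 j.+1 x = res_d (@t j x) + @t j.+1 (res_d x).

Let U2l i : linear (@U2 i). Proof. by case: (U2h i). Qed.
Let Vl i : linear (@V i). Proof. by case: (Vh i). Qed.
Let sl i : linear (@s i). Proof. by case: (sh i). Qed.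
Let tl i : linear (@t i). Proof. by case: (th i). Qed.

(** One factor is changed at a time: [s ⊗ V] joins U ⊗ V to U2 ⊗ V, and [U2 ⊗ t], with the sign that
    the J-part of [tot_d] carries, joins U2 ⊗ V to U2 ⊗ V2. *)
Definition tot_homotopy (x : T) : T' := fun i j =>
  tmap (@s i) (@V j) (x i.+1 j) + ((-1) ^+ i : k) *: tmap (@U2 i) (@t j) (x i j.+1).

Let S1 (x : T) : T' := fun i j => tmap (@s i) (@V j) (x i.+1 j).
Let S2 (x : T) : T' := fun i j => ((-1) ^+ i : k) *: tmap (@U2 i) (@t j) (x i j.+1).

Let sign_sq i : ((-1) ^+ i * (-1) ^+ i : k) = 1.
Proof. by rewrite -exprMn mulrNN mulr1 expr1n. Qed.

Variable x : T.
Hypothesis dx : D x = 0.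
Let dxE i j : tot_dl x i j + ((-1) ^+ i : k) *: tot_dr x i j = 0.
Proof. by have /(congr1 (fun u : T => u i j)) := dx. Qed.

Let tot_d_S1 i j : D' (S1 x) i j =
  tmap (@U i) (@V j) (x i j) - tmap (@U2 i) (@V j) (x i j).
Proof.
have dl := @dIl; have dl' := @dIl'; have cl := @dJl; have cl' := @dJl'.
have svl := tmap_lin (@sl i) (@Vl j).
have := congr1 (tmap (@s i) (@V j)) (dxE i.+1 j).
rewrite (linD svl) (linZ svl) (lin0 svl) exprS mulN1r scaleNr => /eqP.
rewrite subr_eq0 => /eqP h.
rewrite /tot_d; have -> : ((-1) ^+ i : k) *: tot_dr (S1 x) i j =
    tmap (@s i) (@V j) (tot_dl x i.+1 j).
  rewrite h; congr (_ *: _); case: j {svl h} => [|j] /=.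
    by rewrite (lin0 (tmap_lin (@sl i) (@Vl 0))).
  rewrite /S1 tmap_comp ?tmap_comp //; from_context.
  by congr (tmap _ _ _); apply/funext => y /=; rewrite Vd.
apply: (etrans _ (tmap_sub (x i j) (@Ul i) (@U2l i) (@Vl j))).
rewrite /= tmap_comp //; from_context; case: i {svl h} => [|i] /=.
  rewrite add0r; congr (tmap _ _ _); apply/funext => y /=; exact/esym/s0.
rewrite /S1 tmap_comp //; from_context; have sdl := lin_comp (@sl i.+1) (@dl i.+1).
have dsl := lin_comp (@dl' i) (@sl i).
rewrite (_ : (fun z => @U i.+1 z - @U2 i.+1 z) =
  (fun z => 1 *: (@res_d _ _ _ I' i \o @s i) z + (@s i.+1 \o @res_d _ _ _ I i.+1) z)).
  by rewrite (tmap_comb 1 _ dsl sdl (@Vl j)) scale1r.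
by apply/funext => z; rewrite scale1r sS.
Qed.

Let tot_d_S2 i j : D' (S2 x) i j =
  tmap (@U2 i) (@V j) (x i j) - tmap (@U2 i) (@V2 j) (x i j).
Proof.
have dl := @dIl; have dl' := @dIl'; have cl := @dJl; have cl' := @dJl'.
have utl := tmap_lin (@U2l i) (@tl j).
have := congr1 (tmap (@U2 i) (@t j)) (dxE i j.+1).
rewrite (linD utl) (linZ utl) (lin0 utl) => /eqP; rewrite addr_eq0 => /eqP h.
have E : tot_dl (S2 x) i j = tmap (@U2 i) (@t j) (tot_dr x i j.+1).
  transitivity ((- ((-1) ^+ i) : k) *: tmap (@U2 i) (@t j) (tot_dl x i j.+1)); last first.
    by rewrite h scalerN scaleNr opprK scalerA sign_sq scale1r.
  case: i {utl h} => [|i] /=.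
    by rewrite (lin0 (tmap_lin (@U2l 0) (@tl j))) scaler0.
  rewrite /S2 (linZ (tmap_lin (@dl' i) (@lin_id _ (J' j)))) exprS mulN1r opprK.
  congr (_ *: _); rewrite !tmap_comp //; from_context.
  by congr (tmap _ _ _); apply/funext => y /=; rewrite U2d.
rewrite /tot_d E; apply: (etrans _ (tmap_subr (x i j) (@U2l i) (@Vl j) (@V2l j))).
rewrite /= tmap_comp //; from_context; case: j {utl h E} => [|j] /=.
  rewrite scaler0 addr0; congr (tmap _ _ _); apply/funext => y /=; exact/esym/t0.
rewrite /S2 (linZ (tmap_lin (@lin_id _ (I' i)) (@cl' j))) scalerA sign_sq scale1r.
rewrite tmap_comp //; from_context; have tdl := lin_comp (@tl j.+1) (@cl j.+1).
have dtl := lin_comp (@cl' j) (@tl j).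
rewrite (_ : (fun z => @V j.+1 z - @V2 j.+1 z) =
  (fun z => 1 *: (@t j.+1 \o @res_d _ _ _ J j.+1) z + (@res_d _ _ _ J' j \o @t j) z)).
  by rewrite (tmap_combr 1 _ (@U2l i) tdl dtl) scale1r addrC.
by apply/funext => z; rewrite scale1r tS addrC.
Qed.

(** As [x] is a cocycle, the other half of the homotopy formula, the homotopy applied to [D x], is
    absent. *)
Lemma tot_d_homotopy : D' (tot_homotopy x) = tot_tmap U V x - tot_tmap U2 V2 x.
Proof.
have -> : tot_homotopy x = S1 x + S2 x by [].
rewrite (linD (@tot_d_lin _ _ _ _ I' J')).
apply: functional_extensionality_dep => i; apply: functional_extensionality_dep => j.
change (D' (S1 x) i j + D' (S2 x) i j =
  tmap (@U i) (@V j) (x i j) - tmap (@U2 i) (@V2 j) (x i j)).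
by rewrite tot_d_S1 tot_d_S2 addrA subrK.
Qed.

Lemma tot_homotopy_mem p n : tot_sub I J p n.+1 x -> tot_sub I' J' p n (tot_homotopy x).
Proof.
move=> hx i j; have [x1 x2 x3] := hx i.+1 j; have [y1 y2 y3] := hx i j.+1.
have [_ sd _] := sh i; have [_ td _] := th j.
have [_ ud _] := U2h i; have [_ vd _] := Vh j.
rewrite /tot_homotopy; split.
- apply: subspaceD; last apply: subspaceZ.
    exact: cotensor_map (sh i) (Vh j) x1.
  exact: cotensor_map (U2h i) (th j) y1.
- apply: homogD; last apply: homogZ.
    by have := tmap_deg (@sl i) (@Vl j) sd vd x2; rewrite addr0.
  by have := tmap_deg (@U2l i) (@tl j) ud td y2; rewrite addr0.
- move=> ij; rewrite x3 ?y3 ?addSn ?addnS ?eqSS //.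
  by rewrite (lin0 (tmap_lin (@sl i) (@Vl j))) (lin0 (tmap_lin (@U2l i) (@tl j)))
    scaler0 addr0.
Qed.

(** A coboundary in degree 0 is zero by definition, so there homotopic maps have to agree exactly on
    cocycles; this provides it. *)
Lemma tot_homotopy0 p : tot_sub I J p 0 x -> tot_homotopy x = 0.
Proof.
move=> hx; apply: functional_extensionality_dep => i.
apply: functional_extensionality_dep => j; rewrite /tot_homotopy.
have [_ _ x3] := hx i.+1 j; have [_ _ y3] := hx i j.+1; rewrite x3 // y3 ?addnS //.
by rewrite (lin0 (tmap_lin (@sl i) (@Vl j))) (lin0 (tmap_lin (@U2l i) (@tl j)))
  scaler0 addr0.
Qed.
End Homotopy.
End TotalMaps.

Section CotorHomotopy.
Variables (k : fieldType) (C : gcoalgebra k).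
Variables (M : rcomodule_cat C) (N : lcomodule_cat C).
Variables (I I' : inj_resolution M) (J J' : inj_resolution N).

(** Each round trip and the identity lift the same map, hence are homotopic on [I] and on [J];
    [tot_homotopy] combines the two homotopies. *)
Lemma Cotor_map_cancel (u : res_map I I' id) (u' : res_map I' I id)
    (v : res_map J J' id) (v' : res_map J' J id) n p :
  cancel (@Cotor_map _ _ _ _ _ _ _ _ _ _ _ _ u v p n)
         (@Cotor_map _ _ _ _ _ _ _ _ _ _ _ _ u' v' p n).
Proof.
have rx := rcomodule_exact_cat C; have lx := lcomodule_exact_cat C.
have [s [sh s0 sS]] := comparison_unique (f := id) rx (R := er_of I) (S := I)
  (u := fun n => @rmap _ _ _ _ _ _ _ u' n \o @rmap _ _ _ _ _ _ _ u n)
  (v := fun n => id)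
  (fun n => cat_comp rx (@rmap_hom _ _ _ _ _ _ _ u' n) (@rmap_hom _ _ _ _ _ _ _ u n))
  (fun n x => etrans (congr1 _ (rmap_d u x)) (rmap_d u' _))
  (fun x => etrans (congr1 _ (rmap_aug u x)) (rmap_aug u' _))
  (fun n => cat_id rx (I n)) (fun n x => erefl) (fun x => erefl).
have [t [th t0 tS]] := comparison_unique (f := id) lx (R := er_of J) (S := J)
  (u := fun n => @rmap _ _ _ _ _ _ _ v' n \o @rmap _ _ _ _ _ _ _ v n)
  (v := fun n => id)
  (fun n => cat_comp lx (@rmap_hom _ _ _ _ _ _ _ v' n) (@rmap_hom _ _ _ _ _ _ _ v n))
  (fun n x => etrans (congr1 _ (rmap_d v x)) (rmap_d v' _))
  (fun x => etrans (congr1 _ (rmap_aug v x)) (rmap_aug v' _))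
  (fun n => cat_id lx (J n)) (fun n x => erefl) (fun x => erefl).
apply: cohomology_map_inverse => x /(congr1 (@subv_val _ _ _)) dx.
have ul i := ghom_lin (@rmap_hom _ _ _ _ _ _ _ u i).
have ul' i := ghom_lin (@rmap_hom _ _ _ _ _ _ _ u' i).
have vl i := ghom_lin (@rmap_hom _ _ _ _ _ _ _ v i).
have vl' i := ghom_lin (@rmap_hom _ _ _ _ _ _ _ v' i).
pose S := tot_homotopy (fun i => id)
  (fun j => @rmap _ _ _ _ _ _ _ v' j \o @rmap _ _ _ _ _ _ _ v j) s t.
have SE : tot_d (S (subv_val x)) =
    subv_val (cmap (tot_map u' v' p) (cmap (tot_map u v p) x) - x).
  rewrite (tot_d_homotopy (V2 := fun j => id) (fun i => lin_comp (ul' i) (ul i))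
    (fun i => cat_id rx (I i))
    (fun n => cat_comp lx (@rmap_hom _ _ _ _ _ _ _ v' n) (@rmap_hom _ _ _ _ _ _ _ v n))
    (fun j => @lin_id _ (J j)) sh th (fun i x => erefl)
    (fun n x => etrans (congr1 _ (rmap_d v x)) (rmap_d v' _)) s0 sS t0 tS dx).
  apply: functional_extensionality_dep => i; apply: functional_extensionality_dep => j.
  change (tmap (@rmap _ _ _ _ _ _ _ u' i \o @rmap _ _ _ _ _ _ _ u i)
      (@rmap _ _ _ _ _ _ _ v' j \o @rmap _ _ _ _ _ _ _ v j) (subv_val x i j)
    - tmap id id (subv_val x i j) =
    tmap (@rmap _ _ _ _ _ _ _ u' i) (@rmap _ _ _ _ _ _ _ v' j)
     (tmap (@rmap _ _ _ _ _ _ _ u i) (@rmap _ _ _ _ _ _ _ v j) (subv_val x i j))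
    - subv_val x i j).
  by rewrite tmap_comp // tmap_id.
have Vh j := cat_comp lx (@rmap_hom _ _ _ _ _ _ _ v' j) (@rmap_hom _ _ _ _ _ _ _ v j).
case: n x dx SE => [|n] x dx SE.
  apply: val_inj; rewrite /= -[LHS]SE /S.
  rewrite (tot_homotopy0 (fun i => cat_id rx (I i)) Vh sh th (subvP x)).
  exact: (lin0 (@tot_d_lin _ _ _ _ I J)).
have hS := tot_homotopy_mem (fun i => cat_id rx (I i)) Vh sh th (subvP x).
exists (subv_of hS : tot_complex I J p n); apply: val_inj; exact/esym/SE.
Qed.
End CotorHomotopy.

(** * From the cotensor product to bimodule maps *)

Section Sign.
Variables (k : fieldType) (p : int).

(* An element x of X □_C Y satisfies a x = x a, whereas the image y of 1     *)
(* under a bimodule map of degree p satisfies a y = (-1)^(p |a|) y a.       *)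
(* Multiplying X^i ⊗ Y^j by (-1)^(p i) exchanges the two conditions.        *)
Definition sgn (i : int) : k := (-1) ^+ absz (p * i).

Lemma sgnD i j : sgn (i + j) = sgn i * sgn j.
Proof.
rewrite /sgn -exprD -signr_odd -[RHS]signr_odd; congr (_ ^+ nat_of_bool _).
by rewrite mulrDr; move: (p * i) (p * j) => a b; lia.
Qed.

Lemma sgn_sq i : sgn i * sgn i = 1.
Proof. by rewrite /sgn -exprMn mulrNN mulr1 expr1n. Qed.

Section Space.
Variable V : gvect k.

Definition twist (x : V) : V := \sum_(i <- gsupp x) sgn i *: gproj i x.

Lemma twist_lin : linear twist.
Proof.
apply: (gsum_lin (F := fun i x => sgn i *: gproj i x)) => [i a x y|i x ->].
  by rewrite gproj_lin scalerDr !scalerA [sgn i * a]mulrC.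
by rewrite scaler0.
Qed.

Lemma twist_homog i x : homog i x -> twist x = sgn i *: x.
Proof.
move=> hx; rewrite /twist (gsum_homog (F := fun i => sgn i *: gproj i x) hx) ?hx //.
by move=> j ->; rewrite scaler0.
Qed.

Lemma twist_deg : deg_map 0 twist.
Proof. by apply: deg_map0 => i x hx; rewrite (twist_homog hx); apply: homogZ. Qed.

Lemma twistK : involutive twist.
Proof.
apply: (homog_ext (lin_comp twist_lin twist_lin) (@lin_id _ V)) => i x hx /=.
by rewrite (twist_homog hx) (linZ twist_lin) (twist_homog hx) scalerA sgn_sq scale1r.
Qed.
End Space.

Lemma twist_nat (V W : gvect k) (f : V -> W) x : linear f -> deg_map 0 f ->
  twist (f x) = f (twist x).
Proof.
move=> hf df; have tv := @twist_lin V; have tw := @twist_lin W.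
move: x; apply: (homog_ext (lin_comp tw hf) (lin_comp hf tv)) => i x hx /=.
have := df _ _ hx; rewrite addr0 => hfx.
by rewrite (twist_homog hx) (twist_homog hfx) (linZ hf).
Qed.
End Sign.

(** Since [A] is free on 1 as a right module, [y] may be any element on which left and right
    multiplication agree up to the Koszul sign; [regular_bimodule_mapE] shows that every map has
    this form, with [y] its value at 1. *)
Lemma regular_bimodule_map (k : fieldType) (A : galgebra k) (B : gbimodule A) p (y : B) :
  homog p y -> (forall i a, homog i a -> blact a y = sgn k p i *: bract y a) ->
  bimodule_map (B := regular_bimodule A) p (fun a => bract y a).
Proof.
move=> hy hc; split=> [|i a ha|i a b ha|b a].
- exact: (bract_bil B).2.
- by rewrite addrC; apply: bract_deg.
- rewrite /= bractA -blractA (hc i a ha) (linZ ((bract_bil B).1 b)) scalerA.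
  by rewrite -/(sgn k p i) sgn_sq scale1r.
- exact: bractA.
Qed.

Lemma regular_bimodule_mapE (k : fieldType) (A : galgebra k) (B : gbimodule A) p
    (f : regular_bimodule A -> B) :
  bimodule_map p f ->
  [/\ homog p (f (gone A)), forall a, f a = bract (f (gone A)) a
    & forall i a, homog i a -> blact a (f (gone A)) = sgn k p i *: bract (f (gone A)) a].
Proof.
move=> [fl fd fa fr].
have E a : f a = bract (f (gone A)) a by rewrite -fr /= gmul1l.
split=> [|//|i a ha]; first by have := fd _ _ (gone_deg A); rewrite add0r.
rewrite -E; have := fa i a (gone A) ha; rewrite /= gmul1r => ->.
by rewrite scalerA -/(sgn k p i) sgn_sq scale1r.
Qed.

(** * Homotopic lifts on Hochschild cochains *)

Section HochschildHomotopy.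
Variables (k : fieldType) (A : galgebra k) (B B' : bimodule_cat A).
Variables (R : exact_res B) (K : inj_resolution B').

(** [P] and [Q] lift the same map, so they differ by a homotopy [s]. On the cocycle [h] its term
    through [er_d] vanishes, and [s] after [h] is the primitive sought. *)
Lemma hoch_homotopic (f : gunder B -> gunder B')
    (P Q : forall n, gunder (R n) -> gunder (K n)) p n
    (h : regular_bimodule A -> gunder (R n)) (g : hoch_complex K p n) :
  (forall n, bimodule_map 0 (@P n)) -> (forall n x, P n.+1 (er_d x) = res_d (P n x)) ->
  (forall x, P 0 (er_aug R x) = res_aug K (f x)) ->
  (forall n, bimodule_map 0 (@Q n)) -> (forall n x, Q n.+1 (er_d x) = res_d (Q n x)) ->
  (forall x, Q 0 (er_aug R x) = res_aug K (f x)) ->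
  bimodule_map p h -> (forall a, er_d (h a) = 0) ->
  (forall a, subv_val g a = P n (h a) - Q n (h a)) -> coboundary g.
Proof.
move=> hP Pd Pa hQ Qd Qa hh dh gE.
have [s [sh s0 sS]] := comparison_unique (bimodule_exact_cat A) hP Pd Pa hQ Qd Qa.
have sl n := ghom_lin (sh n).
case: n h g hh dh gE => [|n] h g hh dh gE.
  by apply: val_inj; apply/funext => a; rewrite [LHS]gE s0 dh (lin0 (sl 0%N)).
have hs : bimodule_hom (regular_bimodule A) (K n) p (s n \o h).
  exact: bimodule_map_comp (sh n) hh.
exists (subv_of hs : hoch_complex K p n); apply: val_inj; apply/funext => a.
by rewrite [LHS]gE sS dh (lin0 (sl n.+1)) addr0.
Qed.
End HochschildHomotopy.

(** * Cocycles of the total complex as bimodule maps out of A *)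

Section Chi.
Variables (k : fieldType) (A : galgebra k).
Hypotheses (A0 : nonneg_graded A) (Aft : finite_type A).
Notation C := (dual_coalgebra A0 Aft).
Variables (X : rcomodule_cat C) (Y : lcomodule_cat C).
Variables (I : inj_resolution X) (J : inj_resolution Y).
Notation TotIJ := (Tot I J).
Variable p : int.

Definition tot_twist
    (x : dprod (fun i => dprod (fun j => tens (gunder (I i)) (gunder (J j))))) :=
  tot_tmap (I' := I) (J' := J) (fun i => @twist k p (I i)) (fun j => id) x.

Lemma tot_twistK : involutive tot_twist.
Proof.
move=> x; apply: functional_extensionality_dep => i.
apply: functional_extensionality_dep => j.
rewrite /tot_twist /tot_tmap tmap_comp //; try exact: twist_lin.
rewrite -[RHS]tmap_id; congr (tmap _ _ _); apply/funext => y; exact: twistK.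
Qed.

Lemma tot_twist_d x : tot_d (tot_twist x) = tot_twist (tot_d x).
Proof.
apply: tot_d_tmap => [i|j|i y|//].
- exact: twist_lin.
- exact: lin_id.
- have [dl dd _] := @res_d_hom _ _ _ I i; exact: twist_nat.
Qed.

Lemma tot_twist_diag n x : diag (resB I J) n x -> diag (resB I J) n (tot_twist x).
Proof.
move=> hx i j /hx e; rewrite /tot_twist /tot_tmap e.
exact: (lin0 (tmap_lin (@twist_lin _ _ _) (@lin_id _ _))).
Qed.

Lemma tot_sub_diag n x : tot_sub I J p n x -> diag (resB I J) n x.
Proof. by move=> hx i j ij; have [_ _ ->] := hx i j. Qed.

(** The value at 1 of the degree [p] bimodule map attached to [x]. Twisting the I-factor alone
    suffices, and it commutes with the differentials because they have degree 0. *)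
Definition theta n (x : tot_complex I J p n) : TotIJ n :=
  subv_of (tot_twist_diag (tot_sub_diag (subvP x))).

Lemma theta_homog n (x : tot_complex I J p n) : homog p (theta x).
Proof.
apply/tot_homogP => i j; have [_ hx _] := subvP x i j.
have := tmap_deg (@twist_lin _ p (I i)) (@lin_id _ (J j)) (@twist_deg _ p (I i))
  (@deg_map_id _ (J j)) hx.
by rewrite addr0.
Qed.

Lemma twist_lact (Z : grcomodule C) i a (z : Z) : homog i a ->
  com_lact a (twist p z) = sgn k p i *: twist p (com_lact a z).
Proof.
move=> ha; have tl := @twist_lin k p Z.
have al : linear (@com_lact _ _ _ _ Z a) := @lact_linr _ _ (lmod Z) a.
have sl : linear (fun z : Z => sgn k p i *: twist p (com_lact a z)).
  move=> c x y; rewrite (al c) tl scalerDr !scalerA.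
  by rewrite [sgn k p i * c]mulrC.
move: z; apply: (homog_ext (lin_comp al tl) sl) => j z hz /=.
rewrite (twist_homog p hz) (linZ al) (twist_homog p (com_lact_deg ha hz)).
by rewrite sgnD !scalerA mulrA sgn_sq mul1r.
Qed.

Definition twist2 (V W : gvect k) : tens V W -> tens V W :=
  tmap (@twist k p V) id.

Lemma twist2_lin (V W : gvect k) : linear (@twist2 V W).
Proof. exact: tmap_lin (@twist_lin _ _ _) (@lin_id _ _). Qed.

Lemma twist2_lact (Z : grcomodule C) (W : glcomodule C) i a (z : bimod Z W) :
  homog i a ->
  blact a (twist2 z : bimod Z W) = sgn k p i *: (twist2 (blact a z) : bimod Z W).
Proof.
move=> ha; have tl := @twist_lin k p Z; have il := @lin_id k W.
have al : linear (@com_lact _ _ _ _ Z a) := @lact_linr _ _ (lmod Z) a.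
have h1 := lin_comp al tl; have h2 := lin_comp tl al; have h3 := tmap_lin h2 il.
change (tmap (@com_lact _ _ _ _ Z a) id (tmap (@twist k p Z) id z) =
  sgn k p i *: tmap (@twist k p Z) id (tmap (@com_lact _ _ _ _ Z a) id z)).
rewrite !tmap_comp //; move: (z : tens Z W); apply: tens_ext => [||u v].
- exact: tmap_lin.
- by move=> c x y; rewrite h3 scalerDr !scalerA [sgn k p i * c]mulrC.
rewrite !tmapE //= -(linZ (@tmul_linl _ _ _ v)); congr (_ ⊗ _).
exact: twist_lact.
Qed.

Lemma twist2_ract (Z : grcomodule C) (W : glcomodule C) a (z : bimod Z W) :
  bract (twist2 z : bimod Z W) a = twist2 (bract z a).
Proof.
have tl := @twist_lin k p Z; have il := @lin_id k W.
have al : linear (fun y => @com_ract _ _ _ _ W y a) := @ract_linl _ _ (rmod W) a.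
by rewrite [LHS]tmap_comp // [RHS]tmap_comp.
Qed.

(** On [x] the two actions agree by [cotensorP]; the twist leaves the right action alone and changes
    the left one by [sgn k p i]. *)
Lemma theta_commute n (x : tot_complex I J p n) i a : homog i a ->
  blact a (theta x) = sgn k p i *: bract (theta x) a.
Proof.
move=> ha; apply: diag_ext => l m; have [cx _ _] := subvP x l m.
have e := (cotensorP _).1 cx a.
change (blact a (twist2 (subv_val x l m) : bimod (I l) (J m)) =
  sgn k p i *: bract (twist2 (subv_val x l m) : bimod (I l) (J m)) a).
by rewrite (twist2_lact _ ha) e twist2_ract.
Qed.

Lemma theta_hom n (x : tot_complex I J p n) :
  bimodule_map (B := regular_bimodule A) p (fun a => bract (theta x) a).
Proof. exact: regular_bimodule_map (theta_homog x) (@theta_commute n x). Qed.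

Lemma theta_d n (x : tot_complex I J p n) : theta (cxd x) = Tot_d (theta x).
Proof. by apply: val_inj; rewrite /= tot_twist_d. Qed.

Lemma theta_cocycle n (x : tot_complex I J p n) a : cxd x = 0 ->
  Tot_d (bract (theta x) a) = 0.
Proof.
move=> dx; have /bimodule_map0P[_ _ _ ->] := @Tot_d_map _ _ A0 Aft _ _ I J n.
rewrite -theta_d dx (_ : theta 0 = 0) ?(lin0 ((bract_bil _).1 a)) //.
apply: val_inj => /=; apply: functional_extensionality_dep => i.
apply: functional_extensionality_dep => j.
exact: (lin0 (tmap_lin (@twist_lin _ _ _) (@lin_id _ _))).
Qed.

Lemma theta_lin n : linear (@theta n).
Proof.
move=> a x y; apply: diag_ext => i j.
exact: (tmap_lin (@twist_lin k p (I i)) (@lin_id _ (J j))).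
Qed.

Section Comparison.
Variables (B : bimodule_cat A) (K : inj_resolution B).
Variable t : forall n, TotIJ n -> gunder (K n).
Hypothesis th : forall n, bimodule_map 0 (@t n).
Hypothesis td : forall n (x : TotIJ n), @t n.+1 (Tot_d x) = res_d (@t n x).

Definition tot_to_hochn n (x : tot_complex I J p n) : hoch_complex K p n :=
  subv_of (S := bimodule_hom (regular_bimodule A) (K n) p)
    (bimodule_map_comp (@th n) (theta_hom x)).

Lemma tot_to_hochnE n (x : tot_complex I J p n) a :
  subv_val (tot_to_hochn x) a = t (bract (theta x) a).
Proof. by []. Qed.

Fact tot_to_hochn_lin n : linear (@tot_to_hochn n).
Proof.
move=> a x y; apply: val_inj; apply/funext => b.
rewrite [LHS]tot_to_hochnE theta_lin ((bract_bil (TotIJ n)).1 b).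
by have [tl _ _ _] := @th n; rewrite tl.
Qed.

Fact tot_to_hochn_d n (x : tot_complex I J p n) :
  tot_to_hochn (cxd x) = cxd (tot_to_hochn x).
Proof.
apply: val_inj; apply/funext => a; rewrite [LHS]tot_to_hochnE theta_d.
have /bimodule_map0P[_ _ _ <-] := @Tot_d_map _ _ A0 Aft _ _ I J n.
exact: td.
Qed.

Definition tot_to_hoch : cochain_map (tot_complex I J p) (hoch_complex K p) :=
  CochainMap tot_to_hochn_lin tot_to_hochn_d.
End Comparison.

Lemma theta_inj n : injective (@theta n).
Proof.
move=> x y /(congr1 (fun z : TotIJ n => tot_twist (subv_val z))).
by rewrite !tot_twistK => e; apply: val_inj.
Qed.

(** The twist is an involution, so the preimage of [y] is [y] twisted once more; the signs cancel
    and leave the cotensor condition. *)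
Lemma theta_surj n (y : TotIJ n) : homog p y ->
  (forall i a, homog i a -> blact a y = sgn k p i *: bract y a) ->
  exists x : tot_complex I J p n, theta x = y.
Proof.
move=> /tot_homogP hy cy.
have hx : tot_sub I J p n (tot_twist (subv_val y)).
  move=> l m; have tl := @twist_lin k p (I l); have il := @lin_id k (J m).
  split.
  - apply/cotensorP => a; pose B := bimod (I l) (J m).
    move: a; apply: homog_ext; first exact: (blact_bil B).1.
      exact: (bract_bil B).2.
    move=> i a ha; change (blact a (twist2 (dcomp y l m) : B) =
      bract (twist2 (dcomp y l m) : B) a).
    have e : blact a (dcomp y l m) = sgn k p i *: bract (dcomp y l m) a.
      by have := congr1 (fun z : TotIJ n => dcomp z l m) (cy i a ha).
    rewrite (twist2_lact _ ha) e (linZ (@twist2_lin _ _)) scalerA sgn_sq scale1r.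
    by rewrite twist2_ract.
  - have := tmap_deg tl il (@twist_deg _ p (I l)) (@deg_map_id _ (J m)) (hy l m).
    by rewrite addr0.
  - exact: tot_twist_diag (subvP y) l m.
exists (subv_of hx : tot_complex I J p n); apply: val_inj; exact: tot_twistK.
Qed.
End Chi.

(** * The isomorphism *)

Section Isomorphism.
Variables (k : fieldType) (A : galgebra k).
Hypotheses (A0 : nonneg_graded A) (Aft : finite_type A).
Notation C := (dual_coalgebra A0 Aft).

(** The two bimodules share their underlying graded space, but one action is given and the other is
    read off the chosen coaction; they are equal only by [coactionE] and [lcoactionE]. *)
Lemma bimod_of_map (M : glmodule A) (N : grmodule A)
    (Mb : bounded_above M) (Nb : bounded_above N) :
  bimodule_map (B := tens_bimodule M N)
    (B' := bimod (rcomodule_of A0 Aft Mb) (lcomodule_of A0 Aft Nb)) 0 id.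
Proof.
apply/bimodule_map0P; split=> // [|a z|z a]; first exact: deg_map_id.
- change (tmap (@lact _ _ M a) id z =
    tmap (@com_lact _ _ A0 Aft (rcomodule_of A0 Aft Mb) a) id z).
  by congr (tmap _ _ z); apply/funext => m; apply/esym/coactionE.
- change (tmap id (fun n => @ract _ _ N n a) z =
    tmap id (fun n => @com_ract _ _ A0 Aft (lcomodule_of A0 Aft Nb) n a) z).
  by congr (tmap _ _ z); apply/funext => n; apply/esym/lcoactionE.
Qed.

Section Objects.
Variables (M : glmodule A) (N : grmodule A).
Variables (Mb : bounded_above M) (Nb : bounded_above N).
Variables (I : rcomodule_resolution A0 Aft Mb) (J : lcomodule_resolution A0 Aft Nb).

Definition MN : bimodule_cat A := tens_bimodule M N.

(** The [id] is the map of [bimod_of_map], which changes the bimodule structure. *)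
Definition Tot_aug_of : MN -> Tot I J 0 := @Tot_aug _ _ _ _ _ _ I J \o id.

Fact Tot_aug_of_map : bimodule_map 0 Tot_aug_of.
Proof. exact: bimodule_map_comp (Tot_aug_map I J) (bimod_of_map Mb Nb). Qed.

Definition Tot_res : exact_res MN :=
  @ExactRes k (bimodule_cat A) MN (Tot I J) Tot_aug_of _ Tot_aug_of_map
    (@Tot_d_map _ _ A0 Aft _ _ I J) (@Tot_aug_inj _ _ A0 Aft _ _ I J)
    (@Tot_exact0 _ _ A0 Aft _ _ I J) (@Tot_exact _ _ A0 Aft _ _ I J).

Section Map.
Variable K : bimodule_resolution (tens_bimodule M N).

(** An arbitrary choice of lift; by [hoch_homotopic] another choice induces the same map on
    cohomology. *)
Let ex := cid (comparison (bimodule_exact_cat A) Tot_res K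
  (cat_id (bimodule_exact_cat A) MN)).

Definition Tot_lift n : Tot I J n -> gunder (K n) := sval ex n.

Lemma Tot_lift_map n : bimodule_map 0 (@Tot_lift n).
Proof. by have [h _ _] := svalP ex; apply: h. Qed.
Lemma Tot_lift_d n (x : Tot I J n) : Tot_lift (Tot_d x) = res_d (Tot_lift x).
Proof. by have [_ h _] := svalP ex; apply: h. Qed.
Lemma Tot_lift_aug x : Tot_lift (Tot_aug_of x) = res_aug K x.
Proof. by have [_ _ h] := svalP ex; apply: h. Qed.

Definition Cotor_to_Hgr p n : Cotor I J n p -> Hgr K p n :=
  @cohomology_map _ _ _ (tot_to_hoch p Tot_lift_map Tot_lift_d) n.
End Map.
End Objects.

Section Naturality.
Variables (M M' : glmodule A) (N N' : grmodule A).
Variables (Mb : bounded_above M) (Mb' : bounded_above M').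
Variables (Nb : bounded_above N) (Nb' : bounded_above N').
Variables (I : rcomodule_resolution A0 Aft Mb) (I' : rcomodule_resolution A0 Aft Mb').
Variables (J : lcomodule_resolution A0 Aft Nb) (J' : lcomodule_resolution A0 Aft Nb').
Variables (K : bimodule_resolution (tens_bimodule M N))
  (K' : bimodule_resolution (tens_bimodule M' N')).
Variables (f : M -> M') (g : N -> N') (fl : linear f) (gl : linear g).
Variables (u : res_map I I' f) (v : res_map J J' g) (w : res_map K K' (tmap f g)).
Let U i := @rmap _ _ _ _ _ _ _ u i.
Let V j := @rmap _ _ _ _ _ _ _ v j.
Let W n := @rmap _ _ _ _ _ _ _ w n.
Let Ul i : linear (@U i) := ghom_lin (@rmap_hom _ _ _ _ _ _ _ u i).
Let Vl j : linear (@V j) := ghom_lin (@rmap_hom _ _ _ _ _ _ _ v j).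

Fact Tot_map_diag n x : diag (resB I J) n x -> diag (resB I' J') n (tot_tmap U V x).
Proof. by move=> hx i j /hx e; rewrite /tot_tmap e (lin0 (tmap_lin (@Ul i) (@Vl j))). Qed.

Definition Tot_map n (x : Tot I J n) : Tot I' J' n :=
  subv_of (Tot_map_diag (subvP x)).

Lemma Tot_map_hom n : bimodule_map 0 (@Tot_map n).
Proof.
apply: tot_map_into => i j.
have h := bimod_map (@rmap_hom _ _ _ _ _ _ _ u i) (@rmap_hom _ _ _ _ _ _ _ v j).
exact: (bimodule_map_comp h (@tot_comp_map _ _ (resB I J) n i j)).
Qed.

Lemma Tot_map_d n (x : Tot I J n) : Tot_map (Tot_d x) = Tot_d (Tot_map x).
Proof.
apply: val_inj; apply/esym; apply: (@tot_d_tmap _ _ _ _ _ _ I J I' J').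
- exact: Ul.
- exact: Vl.
- move=> i y; exact: (rmap_d u y).
- move=> j y; exact: (rmap_d v y).
Qed.

Lemma Tot_map_aug x : Tot_map (Tot_aug_of I J x) = Tot_aug_of I' J' (tmap f g x).
Proof.
apply: diag_ext => i j.
have augI := ghom_lin (res_aug_hom I); have augJ := ghom_lin (res_aug_hom J).
have augI' := ghom_lin (res_aug_hom I'); have augJ' := ghom_lin (res_aug_hom J').
change (tmap (@U i) (@V j) (aug_comp I J x i j) = aug_comp I' J' (tmap f g x) i j).
case: i j => [|i] [|j]; try exact: (lin0 (tmap_lin (@Ul _) (@Vl _))).
have u0 := @Ul 0; have v0 := @Vl 0.
rewrite /= !tmap_comp //.
by congr (tmap _ _ x); apply/funext => y /=; [exact: (rmap_aug u)|exact: (rmap_aug v)].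
Qed.

Lemma theta_map p n (x : tot_complex I J p n) :
  theta (cmap (tot_map u v p) x) = Tot_map (theta x).
Proof.
apply: diag_ext => i j.
have [ul ud _] := @rmap_hom _ _ _ _ _ _ _ u i; have vl := @Vl j.
change (tmap (@twist k p (I' i)) id (tmap (@U i) (@V j) (subv_val x i j)) =
  tmap (@U i) (@V j) (tmap (@twist k p (I i)) id (subv_val x i j))).
have tl := @twist_lin k p (I i); have tl' := @twist_lin k p (I' i).
have il := @lin_id k (J j); have il' := @lin_id k (J' j).
rewrite !tmap_comp //; congr (tmap _ _ _); apply/funext => y /=; exact: twist_nat.
Qed.

(** Both ways around the square are lifts of [tmap f g] from the exact complex [Tot I J] to the
    injective resolution [K'], hence homotopic. *)
Lemma Cotor_to_Hgr_natural p n (c : Cotor I J n p) :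
  Cotor_to_Hgr K' (Cotor_map u v c) = Hgr_map w (Cotor_to_Hgr K c).
Proof.
apply: cohomology_map_square c => x dx.
apply: (hoch_homotopic (R := Tot_res I J) (K := K') (f := tmap f g)
  (P := fun n => @Tot_lift _ _ _ _ I' J' K' n \o @Tot_map n)
  (Q := fun n => @W n \o @Tot_lift _ _ _ _ I J K n)
  (h := fun a => bract (theta x) a)).
- by move=> m; apply: bimodule_map_comp; [exact: Tot_lift_map|exact: Tot_map_hom].
- by move=> m y; rewrite -[RHS]Tot_lift_d -Tot_map_d.
- by move=> y; rewrite /= Tot_map_aug; apply: (Tot_lift_aug I' J' K').
- move=> m; apply: (bimodule_map_comp (@rmap_hom _ _ _ _ _ _ _ w m)).
  exact: Tot_lift_map.
- by move=> m y; rewrite -[RHS](rmap_d w) -Tot_lift_d.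
- by move=> y; rewrite -(rmap_aug w) -(Tot_lift_aug I J K).
- exact: theta_hom.
- by move=> a; apply: theta_cocycle.
move=> a; have /bimodule_map0P[_ _ _ hr] := Tot_map_hom n.
change (Tot_lift K' (bract (theta (cmap (tot_map u v p) x)) a) -
    W (Tot_lift K (bract (theta x) a)) =
  Tot_lift K' (Tot_map (bract (theta x) a)) - W (Tot_lift K (bract (theta x) a))).
by rewrite hr theta_map.
Qed.
End Naturality.

Section Bijectivity.
Variables (M : glmodule A) (N : grmodule A).
Variables (Mb : bounded_above M) (Nb : bounded_above N).
Notation X := (rcomodule_of A0 Aft Mb).
Notation Y := (lcomodule_of A0 Aft Nb).
Variable K : bimodule_resolution (tens_bimodule M N).

Lemma Hgr_map_cancel (R S : bimodule_resolution (tens_bimodule M N))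
    (w : res_map R S id) (w' : res_map S R id) p n :
  cancel (@Hgr_map _ _ _ _ _ _ _ w p n) (@Hgr_map _ _ _ _ _ _ _ w' p n).
Proof.
apply: cohomology_map_inverse => x /(congr1 (@subv_val _ _ _)) dx.
have bx := bimodule_exact_cat A.
apply: (hoch_homotopic (R := er_of R) (K := R) (f := id)
  (P := fun n => @rmap _ _ _ _ _ _ _ w' n \o @rmap _ _ _ _ _ _ _ w n)
  (Q := fun n => id) (h := subv_val x)).
- by move=> m; apply: bimodule_map_comp (@rmap_hom _ _ _ _ _ _ _ w' m)
    (@rmap_hom _ _ _ _ _ _ _ w m).
- by move=> m y /=; rewrite [X in rmap _ X]rmap_d rmap_d.
- by move=> y /=; rewrite [X in rmap _ X]rmap_aug rmap_aug.
- by move=> m; apply: (cat_id bx).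
- by [].
- by [].
- exact: subvP x.
- by move=> a; have := congr1 (fun h => h a) dx.
- by [].
Qed.

(** The map factors through the cohomology of Hom(A, R) with [R] the total complex. The first factor
    is bijective already on cochains, through [theta]; the second is induced by a comparison of the
    injective resolutions [R] and [K]. *)
Lemma Cotor_to_Hgr_bij_cofree (I : rcomodule_resolution A0 Aft Mb)
    (J : lcomodule_resolution A0 Aft Nb) p n :
  (forall i j, injective_object (D := bimodule_cat A) (resB I J i j)) ->
  bijective (@Cotor_to_Hgr _ _ _ _ I J K p n).
Proof.
move=> hB; have bx := bimodule_exact_cat A.
pose R : inj_resolution (MN M N) :=
  @InjResolution k (bimodule_cat A) _ (Tot I J) (Tot_aug_of I J) _
    (Tot_aug_of_map I J) (@Tot_d_map _ _ A0 Aft _ _ I J)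
    (@Tot_aug_inj _ _ A0 Aft _ _ I J) (@Tot_exact0 _ _ A0 Aft _ _ I J)
    (@Tot_exact _ _ A0 Aft _ _ I J) (fun m => @tot_injective _ _ (resB I J) m hB).
have idh m : bimodule_map (B' := R m) 0 (@id (Tot I J m)) by apply: (cat_id bx).
(* The construction of the comparison map with the identity of [R] in place of the lift to [K]. *)
pose chi_id := @tot_to_hoch _ _ A0 Aft _ _ I J p _ R (fun n => id) idh (fun _ _ => erefl).
have chi_bij m : bijective (@cmap _ _ _ chi_id m).
  have inj : injective (@cmap _ _ _ chi_id m).
    move=> x y /(congr1 (fun h : hoch_complex R p m => subv_val h (gone A))).
    change (bract (theta x) (gone A) = bract (theta y) (gone A) -> x = y).
    by rewrite !bract1 => /theta_inj.
  have surj (h : hoch_complex R p m) : exists x, @cmap _ _ _ chi_id m x = h.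
    have [h1 h2 h3] := regular_bimodule_mapE (subvP h).
    have [x xE] := theta_surj h1 h3.
    exists x; apply: val_inj; apply/funext => a.
    by rewrite [RHS]h2 -xE.
  pose inv h := sval (cid (surj h)).
  have invK h : cmap chi_id (inv h) = h := svalP (cid (surj h)).
  by exists inv => // x; apply: inj; rewrite invK.
pose w : res_map R K id := @ResMap _ _ _ _ R K id (@Tot_lift _ _ _ _ I J K)
  (@Tot_lift_map _ _ _ _ I J K) (@Tot_lift_d _ _ _ _ I J K)
  (@Tot_lift_aug _ _ _ _ I J K).
have [h [hh hd ha]] := comparison bx (er_of K) R (cat_id bx (MN M N)).
pose w' : res_map K R id := @ResMap _ _ _ _ K R id h hh hd ha.
have E c : Cotor_to_Hgr K c = Hgr_map w (@cohomology_map _ _ _ chi_id n c).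
  apply/esym/cohomology_map_comp => x dx.
  rewrite (_ : _ - _ = 0); last by apply/eqP; rewrite subr_eq0; apply/eqP/val_inj.
  exact: coboundary0.
apply: (eq_bij (f := @Hgr_map _ _ _ _ _ _ _ w p n \o @cohomology_map _ _ _ chi_id n)).
  apply: bij_comp; last exact: cohomology_map_bij.
  by exists (@Hgr_map _ _ _ _ _ _ _ w' p n); apply: Hgr_map_cancel.
by move=> c; rewrite E.
Qed.

(** Naturality along the identities of [M] and [N] expresses the map for [I], [J] as the map for a
    cofree pair after the isomorphism [Cotor_map u v]. *)
Lemma Cotor_to_Hgr_bij (I : rcomodule_resolution A0 Aft Mb)
    (J : lcomodule_resolution A0 Aft Nb) p n :
  bijective (@Cotor_to_Hgr _ _ _ _ I J K p n).
Proof.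
have Cb : bounded_above C := gdual_bounded_above A0.
have [I' [V hV]] := @cofree_resolution k C X Cb Mb.
have [J' [W hW]] := @lcofree_resolution k C Y Cb Nb.
have hB i j : injective_object (D := bimodule_cat A) (resB I' J' i j).
  have [Vb eV] := hV i; have [Wb eW] := hW j.
  by rewrite /resB eV eW; apply: cofree_bimod_injective.
have rx := rcomodule_exact_cat C; have lx := lcomodule_exact_cat C.
have lift (D : gcategory k) (Z : D) (R S : inj_resolution Z) :
    exact_cat D -> exists u : res_map R S id, True.
  move=> dx; have [h [hh hd ha]] := comparison dx (er_of R) S (cat_id dx Z).
  by exists (@ResMap _ _ _ _ R S id h hh hd ha).
have [u _] := lift _ _ I I' rx; have [u' _] := lift _ _ I' I rx.
have [v _] := lift _ _ J J' lx; have [v' _] := lift _ _ J' J lx.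
(* Naturality asks for a lift of [tmap id id], which equals the identity only through [tmap_id]. *)
pose w : res_map K K (tmap id id) := @ResMap _ _ _ _ K K (tmap id id) (fun n => id)
  (fun n => cat_id (bimodule_exact_cat A) (K n)) (fun _ _ => erefl)
  (fun x => congr1 (res_aug K) (esym (tmap_id x))).
have E c : Cotor_to_Hgr K (Cotor_map u v c) = Cotor_to_Hgr K c :> Hgr K p n.
  rewrite (Cotor_to_Hgr_natural (@lin_id _ M) (@lin_id _ N) u v w).
  apply: (@cohomology_map_id _ _ (hoch_map w p)) => x _.
  rewrite (_ : _ - _ = 0); last by apply/eqP; rewrite subr_eq0; apply/eqP/val_inj.
  exact: coboundary0.
apply: (eq_bij (f := @Cotor_to_Hgr _ _ _ _ I' J' K p n \o
  @Cotor_map _ _ _ _ _ _ _ _ _ _ _ _ u v p n)); last by move=> c; exact: E.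
apply: bij_comp; first exact: Cotor_to_Hgr_bij_cofree.
by exists (@Cotor_map _ _ _ _ _ _ _ _ _ _ _ _ u' v' p n); apply: Cotor_map_cancel.
Qed.
End Bijectivity.
End Isomorphism.

(** With identities for [f] and [g], the naturality clause also expresses compatibility with a
    change of resolutions. *)
Theorem theorem5p6 (k : fieldType) (A : galgebra k)
    (A0 : nonneg_graded A) (Aft : finite_type A) (n : nat) :
  exists phi : forall (M : glmodule A) (N : grmodule A)
      (Mb : bounded_above M) (Nb : bounded_above N)
      (I : rcomodule_resolution A0 Aft Mb)
      (J : lcomodule_resolution A0 Aft Nb)
      (K : bimodule_resolution (tens_bimodule M N)) (p : int),
      Cotor I J n p -> Hgr K p n,
    (forall (M : glmodule A) (N : grmodule A)
        (Mb : bounded_above M) (Nb : bounded_above N)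
        (I : rcomodule_resolution A0 Aft Mb)
        (J : lcomodule_resolution A0 Aft Nb)
        (K : bimodule_resolution (tens_bimodule M N)) (p : int),
      linear (phi M N Mb Nb I J K p) /\ bijective (phi M N Mb Nb I J K p)) /\
    (forall (M M' : glmodule A) (N N' : grmodule A)
        (Mb : bounded_above M) (Mb' : bounded_above M')
        (Nb : bounded_above N) (Nb' : bounded_above N')
        (I : rcomodule_resolution A0 Aft Mb)
        (I' : rcomodule_resolution A0 Aft Mb')
        (J : lcomodule_resolution A0 Aft Nb)
        (J' : lcomodule_resolution A0 Aft Nb')
        (K : bimodule_resolution (tens_bimodule M N))
        (K' : bimodule_resolution (tens_bimodule M' N'))
        (f : M -> M') (g : N -> N')
        (u : res_map I I' f) (v : res_map J J' g) (w : res_map K K' (tmap f g)),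
      lmodule_map f -> rmodule_map g ->
      forall (p : int) (c : Cotor I J n p),
        phi M' N' Mb' Nb' I' J' K' p (Cotor_map u v c) =
        Hgr_map w (phi M N Mb Nb I J K p c)).
Proof.
exists (fun M N Mb Nb I J K p => @Cotor_to_Hgr k A A0 Aft M N Mb Nb I J K p n); split.
  move=> M N Mb Nb I J K p; split; first exact: cohomology_map_lin.
  exact: Cotor_to_Hgr_bij.
move=> M M' N N' Mb Mb' Nb Nb' I I' J J' K K' f g u v w [fl _ _] [gl _ _] p c.
exact: Cotor_to_Hgr_natural.
Qed.
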